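(* Let $M$ be one of $\mathbb R$, $I=[-1,1]$, $\mathbb T^1$, let $f:M\to M$ satisfy A1 and A2 (see context), and let $(\xi_n)_{n\ge 1}$ be a sequence of independent real random variables on a probability space $(\Omega,\mathcal F,\mathbb P)$ with $p>2$ finite moments satisfying A3($p$) (see context). Suppose that for some $x\in M$ there is an increasing sequence of positive integers $(n_k)$ such that $$\lim_{k\to\infty}\frac{\Lambda_p(x,n_k)}{(\Lambda_2(x,n_k))^{p/2}}=0 .$$ Let $(\sigma_k)$ be a sequence of positive numbers, and assume one of the following two conditions: (H1) A3($p$) holds with $p>2$ and $$\lim_{k\to\infty}\frac{\|f''\|_{C_0}\,\big\|\max_{1\le j\le n_k}|\xi_j|\big\|_p^2\,(\widehat\Lambda(x,n_k))^6\,\sigma_k}{\sqrt{\Lambda_2(x,n_k)}}=0;$$ (H2) A3($p$) holds with $p\ge 4$ and $$\lim_{k\to\infty}\frac{\|f''\|_{C_0}\,\big\|\max_{1\le j\le n_k}|\xi_j|\big\|_p^2\,(\widehat\Lambda(x,n_k))^3\,\sigma_k}{\sqrt{\Lambda_2(x,n_k)}}=0 .$$ Then there exists a sequence of events $B_k\in\mathcal F$ such that: (M1) $\lim_{k\to\infty}\mathbb P[B_k]=1$; (M2) the processes $$w_{n_k}(x,\sigma_k)=\frac{x_{n_k}(x,\sigma_k)-f^{n_k}(x)}{\sigma_k\sqrt{\operatorname{var}[L_{n_k}(x)]}},\qquad \widetilde w_{n_k}(x,\sigma_k)=\frac{(x_{n_k}(x,\sigma_k)-f^{n_k}(x))\mathbf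 1_{B_k}}{\sqrt{\operatorname{var}[(x_{n_k}(x,\sigma_k)-f^{n_k}(x))\mathbf 1_{B_k}]}}$$ both converge in distribution to a standard Gaussian as $k\to\infty$. Furthermore, if the sequence $(\xi_n)$ is supported on a compact set, then one can choose $B_k=\Omega$ for all $k$.
   Context: Assumptions. A1: $f:M\to M$ is $C^2$, where $M=\mathbb R$, $I=[-1,1]$ or $\mathbb T^1$. A2: if $M=I$, there is $a>0$ such that $f\in C^2([-1-a,1+a])$ and $f([-1-a,1+a])\subset I$. A3($p$): $\mathbb E[\xi_n]=0$ for all $n$, and there are constants $c,C>0$ with $c\le\|\xi_n\|_2\le\|\xi_n\|_p\le C$ for all $n$, where $\|\xi\|_s=(\mathbb E|\xi|^s)^{1/s}$. For a function $h$ on $M$, $\|h\|_{C_0}=\sup_{x\in M}|h(x)|$. The noisy system. For $x\in M$ and $\sigma>0$ put $x_0=x$, $x_m=f(x_{m-1})+\sigma\xi_m$, and let $x_n(x,\sigma)$ be the value at time $n$. For $M=\mathbb T^1$, orbits and differences are computed using a lift of $f$ to $\mathbb R$. For $M=I$, $x_n(x,\sigma)$ is defined by this recursion on the event $\Omega\setminus C_n$, $C_n=\{\sigma\max_{1\le j\le n}|\xi_j|>a\}$ (on which the orbit stays in $[-1-a,1+a]$), and one conditions on that event. Lyapunov functions. For $s\ge0$, $$\Lambda_s(x,n)=\sum_{j=1}^n\big|(f^{n-j})'\circ f^j(x)\big|^s,\qquad \widehat\Lambda(x,n)=\max_{0\le i\le n}\sum_{j=0}^i\big|(f^{i-j})'\circ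 f^j(x)\big| .$$ Linearized effective noise: $L_n(x)=\sum_{j=1}^n (f^{n-j})'\circ f^j(x)\,\xi_j$. Here $f^0=\mathrm{id}$. *)

(* Defs.v *)
From HB Require Import structures.
From mathcomp Require Import all_boot all_order all_algebra.
From mathcomp Require Import all_classical all_reals all_analysis.
From mathcomp Require Import measurable_realfun.

Set Implicit Arguments.
Unset Strict Implicit.
Unset Printing Implicit Defensive.

Import Order.TTheory GRing.Theory Num.Theory.
Import numFieldNormedType.Exports.

Local Open Scope classical_set_scope.
Local Open Scope ring_scope.

(* The three phase spaces are handled by maps [f : R -> R]:
    - [Line]: [f] itself;
    - [Interval], M = [-1, 1]: only the values of [f] on [-1 - a, 1 + a] matter,
      the values outside this interval are arbitrary;
    - [Circle], M = R/Z: [f] is a lift to the real line of the circle map, a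
      point of the circle is given by a representative [x : R], and orbits,
      differences and derivatives are those of the lift. *)

Inductive phase_space := Line | Interval | Circle.

Section dynamics.
Context {R : realType}.
Implicit Types (M : phase_space) (D : set R) (f h : R -> R) (a s x : R).

Definition carrier M : set R :=
  if M is Interval then `[-1, 1]%classic else setT.

(* For a closed interval [D] this is the class C^2(D): [f1] and [f2] are the
   continuous extensions to [D] of f' and f'' on the interior; by the mean value
   theorem they are also the one-sided derivatives at the endpoints. *)
Definition C2_on D f : Prop :=
  exists f1 f2 : R -> R,
    [/\ {within D, continuous f}, {within D, continuous f1},
        {within D, continuous f2},
        forall y, interior D y -> is_derive y (1 : R) f (f1 y) &
        forall y, interior D y -> is_derive y (1 : R) f1 (f2 y)].

Definition circle_lift f : Prop :=
  exists d : int, forall y, f (y + 1) = f y + d%:~R.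

Definition A1 M f : Prop :=
  [/\ f @` carrier M `<=` carrier M, C2_on (carrier M) f &
      M = Circle -> circle_lift f].

Definition A2 M a f : Prop :=
  M = Interval ->
  [/\ 0 < a, C2_on `[-1 - a, 1 + a]%classic f &
      f @` `[-1 - a, 1 + a]%classic `<=` carrier M].

Definition C0_norm M h : \bar R := ereal_sup [set `|h y|%:E | y in carrier M].

(* When [M] is [Interval], [carrier M] lies in the interior of [-1 - a, 1 + a],
   so all derivatives below are two-sided derivatives of [f] or of its iterates
   at interior points of the domain. *)
Definition transfer f x n j : R := derive1 (iter (n - j) f) (iter j f x).

Definition Lambda f s x n : R :=
  \sum_(1 <= j < n.+1) `|transfer f x n j| `^ s.

Definition Lambda_hat f x n : R :=
  \big[Num.max/0]_(0 <= i < n.+1) \sum_(0 <= j < i.+1) `|transfer f x i j|.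

End dynamics.

Section random.
Context {R : realType} d {T : measurableType d}.
Implicit Types P : probability T R.

Definition mutually_independent P (I : set nat) (X : nat -> {RV P >-> R}) :
    Prop :=
  forall (s : seq nat) (A : nat -> set R),
    uniq s -> (forall i, i \in s -> I i) -> (forall i, measurable (A i)) ->
    P (\bigcap_(i in [set` s]) X i @^-1` A i) =
      (\prod_(i <- s) P (X i @^-1` A i))%E.

(* The conditional probability given [G]; it is [P] if [P G = 0]. *)
Definition cond_prob P (G : set T) (mG : measurable G) : probability T R :=
  mnormalize (mrestr P mG) P.

Definition cvg_in_distribution (P_ : nat -> probability T R)
    (X_ : nat -> T -> R) (mu : probability (measurableTypeR R) R) : Prop :=
  (forall k, measurable_fun setT (X_ k)) /\
  forall t : R, {for t, continuous (fun r => fine (mu `]-oo, r]%classic))} ->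
    P_ k [set w | X_ k w <= t] @[k --> \oo] --> mu `]-oo, t]%classic.

End random.

(* The noise is [xi 1, xi 2, ...]; [xi 0] is never used. *)

Section noisy_system.
Context {R : realType} d {T : measurableType d} (P : probability T R).
Implicit Types (M : phase_space) (xi : nat -> {RV P >-> R}) (f : R -> R).
Implicit Types (a p x sigma : R).

Definition A3 xi p : Prop :=
  (forall n, (0 < n)%N -> ('E_P[xi n] = 0)%E) /\
  exists c C : R, [/\ 0 < c, 0 < C & forall n, (0 < n)%N ->
    [/\ (c%:E <= 'N[P]_2%:E[EFin \o xi n])%E,
        ('N[P]_2%:E[EFin \o xi n] <= 'N[P]_p%:E[EFin \o xi n])%E &
        ('N[P]_p%:E[EFin \o xi n] <= C%:E)%E]].

Definition compactly_supported xi : Prop :=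
  exists2 K : set R, compact K &
    forall n, (0 < n)%N -> P (xi n @^-1` K) = 1%E.

Fixpoint noisy_orbit f xi x sigma (m : nat) (w : T) : R :=
  if m is m'.+1 then f (noisy_orbit f xi x sigma m' w) + sigma * xi m w else x.

Definition max_noise xi n (w : T) : R :=
  \big[Num.max/0]_(1 <= j < n.+1) `|xi j w|.

Lemma measurable_max_noise xi n : measurable_fun setT (max_noise xi n).
Proof.
rewrite /max_noise; elim: (index_iota _ _) => [|j s IH].
  by under eq_fun do rewrite big_nil; exact: measurable_cst.
under eq_fun do rewrite big_cons; apply: measurable_maxr => //.
exact: measurableT_comp.
Qed.

(* For [Interval], an event on which the orbit stays in [-1 - a, 1 + a] up to
   time [n]; on the other phase spaces there is no restriction. *)
Definition good_event M a xi sigma n : set T :=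
  if M is Interval then [set w | sigma * max_noise xi n w <= a] else setT.

Lemma measurable_good_event M a xi sigma n :
  measurable (good_event M a xi sigma n).
Proof.
case: M => //=; rewrite -[X in measurable X]setTI.
apply: measurable_fun_le => //.
by apply: measurable_funM => //; exact: measurable_max_noise.
Qed.

Definition cond_good M a xi sigma n : probability T R :=
  cond_prob P (measurable_good_event M a xi sigma n).

(* x_n(x, sigma) - f^n(x), set to 0 outside of the good event, where x_n(x, sigma)
   is not defined; [cond_good] does not charge that complement (if the good
   event is null, [deviation] vanishes almost surely). *)
Definition deviation M a f xi x sigma n (w : T) : R :=
  (noisy_orbit f xi x sigma n w - iter n f x)
  * \1_(good_event M a xi sigma n) w.

Definition linear_noise f xi x n (w : T) : R :=
  \sum_(1 <= j < n.+1) transfer f x n j * xi j w.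

Definition normalized_deviation M a f xi x sigma n (w : T) : R :=
  deviation M a f xi x sigma n w
  / (sigma * Num.sqrt (fine 'V_P[linear_noise f xi x n]%E)).

Definition truncated_deviation M a f xi x sigma n (B : set T) (w : T) : R :=
  deviation M a f xi x sigma n w * \1_B w.

Definition self_normalized_deviation M a f xi x sigma n (B : set T) (w : T) :
    R :=
  truncated_deviation M a f xi x sigma n B w
  / Num.sqrt (fine 'V_(cond_good M a xi sigma n)
                     [truncated_deviation M a f xi x sigma n B]%E).

Definition nonlinearity_ratio M f xi p x n (e : nat) sigma : \bar R :=
  (C0_norm M (derive1 (derive1 f)) * 'N[P]_p%:E[EFin \o max_noise xi n] ^+ 2
   * (Lambda_hat f x n ^+ e * sigma / Num.sqrt (Lambda f 2 x n))%R%:E)%E.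

Definition gaussian_scaling_limit M a f xi x (n_ : nat -> nat)
    (sigma_ : nat -> R) (B : nat -> set T) : Prop :=
  [/\ P (B k) @[k --> \oo] --> 1%E,
      cvg_in_distribution
        (fun k => cond_good M a xi (sigma_ k) (n_ k))
        (fun k => normalized_deviation M a f xi x (sigma_ k) (n_ k))
        (normal_prob 0 1) &
      cvg_in_distribution
        (fun k => cond_good M a xi (sigma_ k) (n_ k))
        (fun k => self_normalized_deviation M a f xi x (sigma_ k) (n_ k) (B k))
        (normal_prob 0 1)].

End noisy_system.

(* Main.v *)
Require Import Defs.
From HB Require Import structures.
From mathcomp Require Import all_boot all_order all_algebra.
From mathcomp Require Import all_classical all_reals all_analysis.
From mathcomp Require Import measurable_realfun.
From mathcomp Require Import ring lra.

(** Write [e n] for the difference between the noisy and the unperturbed orbit.  By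
    Taylor's formula it solves [e n.+1 = f' (f^n x) * e n + sigma * xi n.+1] up to a
    remainder of order [e n ^+ 2], so by variation of constants [e n] is [sigma]
    times the linear functional [linear_noise] of the noise plus a sum of remainders
    with the same coefficients [transfer f x n j].  If all [`|xi j|], [j <= n], are
    at most [tau], a bootstrap on the size of [e] shows that the remainders
    contribute at most a constant times
    [F * sigma ^+ 2 * tau ^+ 2 * Lambda_hat f x n ^+ 3], where [F] is the supremum of
    the second derivative ([linearization_error], [deviation_linearization]).  The
    standard deviation of [sigma * linear_noise] is at least a constant times
    [sigma * Num.sqrt (Lambda f 2 x n)], so the relative error is of order
    [F * q * tau ^+ 2] with
    [q = sigma * Lambda_hat f x n ^+ 3 / Num.sqrt (Lambda f 2 x n)].

    The hypothesis says that [rho = F * q * N ^+ 2] tends to zero, [N] being the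
    norm of the maximal noise (an exponent [6] in place of [3] only makes the ratio
    larger, since [Lambda_hat] is at least one).  Taking [tau = N / theta] with
    [theta] tending to zero slowly, the relative error [rho / theta ^+ 2] still tends
    to zero, and the event that the maximal noise is at most [tau] has probability
    tending to one by Markov's inequality ([scaling_limit_Lp]).  These events are the
    [B k].  For compactly supported noise a constant [tau] works, almost surely, and
    [B k] can be the whole space ([scaling_limit_compact]).

    The normalized linear functionals converge to the standard Gaussian law by the
    central limit theorem under Lyapunov's condition ([lyapunov_clt]), to which the
    hypothesis on [Lambda f p / Lambda f 2 `^ (p / 2)] amounts.  It is proved by
    Lindeberg's method for test functions with a third order Taylor bound
    ([lindeberg_swapping]): the terms are replaced one at a time by Gaussian variables
    of the same variance, realized by integration against Gaussian measures, which
    form a convolution semigroup.  Ramps among the test functions yield convergence of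
    distribution functions, stable under perturbations small in probability
    ([slutsky_cdf]) and under conditioning on events of probability tending to one
    ([cvg_normalized]).

    For the self-normalized deviations one also needs the variance of the truncated
    variables.  Convergence in law together with unit variance makes the squares of
    the normalized functionals uniformly integrable ([uniform_integrability]), so the
    truncated normalized deviations are close to them in mean square, and their
    variance tends to one ([cvg_self_normalized]).

    On the interval the noisy orbit leaves [[-1, 1]] while [F] only sees this
    interval.  The second derivative on the larger domain is bounded by a multiple of
    [F] as soon as [F] is positive, and [F = 0] is incompatible with Lyapunov's
    condition: the map would be an affine contraction ([quadratic_control]). *)

Set Implicit Arguments.
Unset Strict Implicit.
Unset Printing Implicit Defensive.

Import Order.TTheory GRing.Theory Num.Theory.
Import numFieldNormedType.Exports.

Local Open Scope classical_set_scope.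
Local Open Scope ring_scope.

(** * Third-order test functions *)

Section taylor.
Context {R : realType}.
Implicit Types (f g : R -> R) (M r t u y h : R).

(** Integrating a power bound on the derivative gains one power: this is the
    step repeated to obtain Taylor remainders, with a symmetric domain so that
    both signs of the increment are treated at once. *)
Lemma bound_of_derive_bound f f' M (k : nat) r :
  (forall t, is_derive t (1 : R) f (f' t)) -> f 0 = 0 -> 0 <= M ->
  (forall t, `|t| <= r -> `|f' t| <= M * `|t| ^+ k) ->
  forall t, `|t| <= r -> `|f t| <= M * `|t| ^+ k.+1.
Proof.
move=> df f0 M0 bf t tr.
have cf : continuous f.
  by move=> z; apply/differentiable_continuous/derivable1_diffP; case: (df z).
have [c cb ct] : exists2 c, `|c| <= `|t| & f t = f' c * t.
  case: (leP 0 t) => t0.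
    have [c] := MVT_segment t0 (fun x _ => df x) (continuous_subspaceT cf).
    rewrite in_itv/= f0 !subr0 => /andP[c0 ct] e; exists c => //.
    by rewrite !ger0_norm.
  have [c] := MVT_segment (ltW t0) (fun x _ => df x) (continuous_subspaceT cf).
  rewrite in_itv/= f0 !sub0r => /andP[ct c0] e; exists c.
    by rewrite !ler0_norm// ?lerN2// ltW.
  by move/eqP: e; rewrite mulrN eqr_opp => /eqP.
rewrite ct normrM exprSr mulrA ler_wpM2r// (le_trans (bf _ _))//.
  exact: le_trans tr.
by rewrite ler_wpM2l// lerXn2r ?nnegrE.
Qed.

Lemma taylor2_bound g g1 g2 g3 M r y :
  (forall t, is_derive t (1 : R) g (g1 t)) ->
  (forall t, is_derive t (1 : R) g1 (g2 t)) ->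
  (forall t, is_derive t (1 : R) g2 (g3 t)) ->
  0 <= M -> (forall h, `|h| <= r -> `|g3 (y + h)| <= M) ->
  forall h, `|h| <= r ->
  `|g (y + h) - g y - g1 y * h - g2 y * h ^+ 2 / 2| <= M * `|h| ^+ 3.
Proof.
move=> d1 d2 d3 M0 b3.
have dsh (f f' : R -> R) t : (forall t, is_derive t (1 : R) f (f' t)) ->
    is_derive t (1 : R) (fun h => f (y + h)) (f' (y + t)).
  move=> df; have := is_derive1_comp (df (y + t)) (is_deriveD (is_derive_cst y t 1) (is_derive_id t 1)).
  by rewrite add0r mulr1.
apply: (@bound_of_derive_bound _ (fun h => g1 (y + h) - g1 y - g2 y * h)).
- move=> t; have H := dsh _ _ t d1.
  by apply: is_derive_eq; rewrite /GRing.scale/=; field.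
- by rewrite addr0 subrr mulr0 expr0n/= mulr0 mul0r !subr0.
- by [].
apply: (@bound_of_derive_bound _ (fun h => g2 (y + h) - g2 y)).
- move=> t; have H := dsh _ _ t d2.
  by apply: is_derive_eq; rewrite /GRing.scale/=; ring.
- by rewrite addr0 subrr mulr0 subr0.
- by [].
apply: (@bound_of_derive_bound _ (fun h => g3 (y + h))).
- move=> t; have H := dsh _ _ t d3.
  by apply: is_derive_eq; rewrite /GRing.scale/=; ring.
- by rewrite addr0 subrr.
- by [].
by move=> t tr; rewrite expr0 mulr1; exact: b3.
Qed.

End taylor.

Section smooth3.
Context {R : realType}.
Implicit Types (g : R -> R) (K y h : R).

(** A bounded function with the bounded data of a second order Taylor expansion
    whose remainder is cubic, uniformly in the base point.  Twice differentiable
    functions with Lipschitz second derivative are of this form; asking for the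
    expansion itself makes the class stable under averaging over a random shift
    without differentiating under the integral sign. *)
Definition smooth3 K g g1 g2 := [/\
  [/\ measurable_fun setT g, measurable_fun setT g1 & measurable_fun setT g2],
  forall y, [/\ `|g y| <= K, `|g1 y| <= K & `|g2 y| <= K] &
  forall y h,
    `|g (y + h) - g y - g1 y * h - g2 y * h ^+ 2 / 2| <= K * `|h| ^+ 3].

(** The size of the second order remainder for bounded test functions: cubic for
    small increments, quadratic for large ones. *)
Definition min23 h : R := Num.min (h ^+ 2) (`|h| ^+ 3).

Lemma min23_ge0 h : 0 <= min23 h.
Proof. by rewrite /min23 le_min sqr_ge0 exprn_ge0. Qed.

Lemma min23_le2 h : min23 h <= h ^+ 2.
Proof. by rewrite /min23 ge_min lexx. Qed.

Lemma min23_le3 h : min23 h <= `|h| ^+ 3.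
Proof. by rewrite /min23 ge_min lexx orbT. Qed.

Lemma measurable_min23 : measurable_fun setT min23.
Proof.
by apply: measurable_minr; apply: measurable_funX.
Qed.

Lemma smooth3_ge0 K g g1 g2 : smooth3 K g g1 g2 -> 0 <= K.
Proof. by case=> _ /(_ 0)[+ _ _] _; exact: le_trans. Qed.

Lemma smooth3_min23 K g g1 g2 y h : smooth3 K g g1 g2 ->
  `|g (y + h) - g y - g1 y * h - g2 y * h ^+ 2 / 2| <= 4 * K * min23 h.
Proof.
move=> gs; have K0 := smooth3_ge0 gs; case: gs => _ bg tg.
have h2E : h ^+ 2 = `|h| ^+ 2 by rewrite real_normK ?num_real.
rewrite /min23 h2E; case: (leP `|h| 1) => h1.
  rewrite -h2E (le_trans (tg _ _))// h2E.
  have -> : Num.min (`|h| ^+ 2) (`|h| ^+ 3) = `|h| ^+ 3.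
    by apply/min_idPr; rewrite ler_wiXn2l.
  by rewrite ler_wpM2r ?exprn_ge0// ler_peMl// ler1n.
have -> : Num.min (`|h| ^+ 2) (`|h| ^+ 3) = h ^+ 2.
  by rewrite h2E; apply/min_idPl; rewrite ler_weXn2l// ltW.
rewrite -h2E.
have [b0 _ _] := bg (y + h); have [b1 b2 b3] := bg y.
have hh : `|h| <= h ^+ 2 by rewrite -real_normK ?num_real// expr2; nra.
rewrite (le_trans (ler_normB _ _))//.
rewrite (le_trans (lerD (ler_normB _ _) (lexx _)))//.
rewrite (le_trans (lerD (lerD (ler_normB _ _) (lexx _)) (lexx _)))//.
have -> : `|g1 y * h| = `|g1 y| * `|h| by rewrite normrM.
have -> : `|g2 y * h ^+ 2 / 2| = `|g2 y| * h ^+ 2 / 2.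
  by rewrite 2!normrM (ger0_norm (sqr_ge0 h)) (@ger0_norm _ 2^-1).
have : `|g1 y| * `|h| <= K * h ^+ 2 by apply: ler_pM.
have : `|g2 y| * h ^+ 2 / 2 <= K * h ^+ 2 / 2.
  by rewrite ler_wpM2r// ler_wpM2r// sqr_ge0.
have : K <= K * h ^+ 2.
  by rewrite ler_peMr// -real_normK ?num_real// exprn_ege1// ltW.
lra.
Qed.

End smooth3.

Section cosine.
Context {R : realType}.
Implicit Types (u y h t e : R).

Lemma cos_taylor2 y h :
  `|cos (y + h) - cos y + sin y * h + cos y * h ^+ 2 / 2| <= `|h| ^+ 3.
Proof.
have -> : cos (y + h) - cos y + sin y * h + cos y * h ^+ 2 / 2 =
  cos (y + h) - cos y - (- sin y) * h - (- cos y) * h ^+ 2 / 2.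
  by rewrite !mulNr !opprK.
rewrite -[leRHS]mul1r.
apply: (@taylor2_bound R cos (fun t => - sin t) (fun t => - cos t) sin 1 `|h|) => //.
- by move=> t; apply: is_derive_eq; rewrite opprK.
- by move=> k _; rewrite ler_norml sin_geN1 sin_le1.
Qed.

End cosine.

Definition relu {R : realType} (u : R) : R := Num.max u 0.

(** The cube of the positive part is of class C^2 with second derivative
    [6 * relu u], which is Lipschitz; the four sign patterns of [u] and [u + h]
    are checked directly. *)
Lemma relu_cube_taylor {R : realType} (u h : R) :
  `|relu (u + h) ^+ 3 - relu u ^+ 3 - 3 * relu u ^+ 2 * h
    - 6 * relu u * h ^+ 2 / 2| <= `|h| ^+ 3.
Proof.
rewrite -normrX /relu.
have [u0|u0] := leP u 0; have [v0|v0] := leP (u + h) 0.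
- by rewrite !expr0n/= !(mulr0, mul0r) !subr0 normr0.
- have h0 : 0 <= h by lra.
  have v0' := ltW v0.
  rewrite !expr0n/= !(mulr0, mul0r) !subr0 !ger0_norm ?exprn_ge0//.
  by rewrite lerXn2r ?nnegrE//; lra.
- have -> : 0 ^+ 3 - u ^+ 3 - 3 * u ^+ 2 * h - 6 * u * h ^+ 2 / 2 =
    - ((- h) ^+ 3 - (- (u + h)) ^+ 3) by field.
  have h0 : 0 <= - h by lra.
  have w0 : 0 <= - (u + h) by lra.
  have hE : `|h ^+ 3| = (- h) ^+ 3 by rewrite normrX -normrN ger0_norm.
  have hw : (- (u + h)) ^+ 3 <= (- h) ^+ 3 by rewrite lerXn2r ?nnegrE//; lra.
  rewrite hE normrN ger0_norm ?subr_ge0// gerBl.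
  exact: exprn_ge0.
- by rewrite le_eqVlt; apply/orP; left; apply/eqP; congr (`| _ |); field.
Qed.

(** A third finite difference of the function [relu u ^+ n] (with [n = 3] this
    is, up to the factor [6], the integral of the quadratic B-spline). *)
Definition relu_sum {R : realType} (n : nat) (u : R) : R :=
  relu u ^+ n - 3 * relu (u - 1) ^+ n + 3 * relu (u - 2) ^+ n - relu (u - 3) ^+ n.

Lemma relu_cases {R : realType} (u : R) : (u <= 0 /\ relu u = 0) \/ (0 < u /\ relu u = u).
Proof. by rewrite /relu; case: (leP u 0); [left|right]. Qed.

(** A smooth version of the indicator of the positive half-line: zero before [0]
    and one after [3].  The functions [step1] and [step2] are its first two
    derivatives. *)
Definition step {R : realType} (u : R) : R := relu_sum 3 u / 6.
Definition step1 {R : realType} (u : R) : R := relu_sum 2 u / 2.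
Definition step2 {R : realType} (u : R) : R := relu_sum 1 u.

Lemma measurable_relu_sum {R : realType} n : measurable_fun setT (@relu_sum R n).
Proof.
have mr (c : R) : measurable_fun setT (fun u : R => relu (u - c) ^+ n).
  apply: measurable_funX; rewrite /relu; apply: measurable_maxr => //.
  exact: measurable_funB.
rewrite /relu_sum; apply: measurable_funB => //; apply: measurable_funD; last first.
  exact: measurable_funM.
apply: measurable_funB; last exact: measurable_funM.
by have := mr 0; under eq_fun do rewrite subr0.
Qed.

Lemma step_eq0 {R : realType} (u : R) : u <= 0 -> step u = 0.
Proof.
move=> u0; have r0 (c : R) : 0 <= c -> relu (u - c) = 0.
  by move=> c0; apply/max_idPr; lra.
rewrite /step /relu_sum !r0// (_ : relu u = 0); last exact/max_idPr.
by rewrite expr0n/= !mulr0 !(subr0, addr0) mul0r.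
Qed.

Lemma step_eq1 {R : realType} (u : R) : 3 <= u -> step u = 1.
Proof.
move=> u0; have r0 (c : R) : c <= 3 -> relu (u - c) = u - c.
  by move=> c0; apply/max_idPl; lra.
rewrite /step /relu_sum (r0 1) ?(r0 2) ?(r0 3); try lra.
rewrite (_ : relu u = u); last by apply/max_idPl; lra.
by field.
Qed.

Lemma step_bounds {R : realType} (u : R) : 0 <= step u <= 1.
Proof.
rewrite /step /relu_sum.
have [[u0 ->]|[u0 ->]] := relu_cases u;
have [[u1 ->]|[u1 ->]] := relu_cases (u - 1);
have [[u2 ->]|[u2 ->]] := relu_cases (u - 2);
have [[u3 ->]|[u3 ->]] := relu_cases (u - 3); try (exfalso; lra).
all: rewrite ?expr0n/= ?mulr0 ?subr0 ?addr0 ?sub0r ?add0r ?oppr0 ?mul0r.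
- by rewrite lexx ler01.
- have u1' : u <= 1 by lra.
  have h0 : 0 <= u ^+ 3 by rewrite exprn_ge0// ltW.
  have h1 : u ^+ 3 <= 1 by rewrite exprn_ile1// ltW.
  lra.
- set v := u - 1 in u1 *.
  have -> : u ^+ 3 - 3 * v ^+ 3 = 1 + 3 * v + 3 * v ^+ 2 - 2 * v ^+ 3.
    by rewrite /v; ring.
  have v1 : v <= 1 by rewrite /v; lra.
  have h0 : 0 <= v ^+ 3 by rewrite exprn_ge0// ltW.
  have h1 : v ^+ 2 <= v by rewrite expr2 ler_piMl// ltW.
  have h2 : v ^+ 3 <= v ^+ 2 by rewrite ler_wiXn2l// ltW.
  have h3 : 0 <= (v - 1) ^+ 2 * (v + 2).
    by rewrite mulr_ge0// ?sqr_ge0//; lra.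
  have h4 : v ^+ 3 - 3 * v + 2 = (v - 1) ^+ 2 * (v + 2) by ring.
  have h5 : 0 <= v ^+ 2 by rewrite sqr_ge0.
  lra.
- set w := 3 - u.
  have -> : u ^+ 3 - 3 * (u - 1) ^+ 3 + 3 * (u - 2) ^+ 3 = 6 - w ^+ 3.
    by rewrite /w; ring.
  have w0 : 0 <= w by rewrite /w; lra.
  have w1 : w <= 1 by rewrite /w; lra.
  have h0 : 0 <= w ^+ 3 by rewrite exprn_ge0.
  have h1 : w ^+ 3 <= 1 by rewrite exprn_ile1.
  lra.
- have -> : u ^+ 3 - 3 * (u - 1) ^+ 3 + 3 * (u - 2) ^+ 3 - (u - 3) ^+ 3 = 6.
    by ring.
  lra.
Qed.

Lemma step1_bound {R : realType} (u : R) : `|step1 u| <= 2.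
Proof.
rewrite /step1 /relu_sum ler_norml.
have [[u0 ->]|[u0 ->]] := relu_cases u;
have [[u1 ->]|[u1 ->]] := relu_cases (u - 1);
have [[u2 ->]|[u2 ->]] := relu_cases (u - 2);
have [[u3 ->]|[u3 ->]] := relu_cases (u - 3); try (exfalso; lra).
all: rewrite ?expr0n/= ?mulr0 ?subr0 ?addr0 ?sub0r ?add0r ?oppr0 ?mul0r.
all: apply/andP; split; nra.
Qed.

Lemma step2_bound {R : realType} (u : R) : `|step2 u| <= 2.
Proof.
rewrite /step2 /relu_sum ler_norml !expr1.
have [[u0 ->]|[u0 ->]] := relu_cases u;
have [[u1 ->]|[u1 ->]] := relu_cases (u - 1);
have [[u2 ->]|[u2 ->]] := relu_cases (u - 2);
have [[u3 ->]|[u3 ->]] := relu_cases (u - 3); try (exfalso; lra).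
all: apply/andP; split; lra.
Qed.

Lemma smooth3_step {R : realType} : smooth3 2 (@step R) step1 step2.
Proof.
split; first by split; [apply: measurable_funM|apply: measurable_funM|];
  rewrite //; exact: measurable_relu_sum.
- move=> y; split; [|exact: step1_bound|exact: step2_bound].
  have /andP[s0 s1] := step_bounds y.
  by rewrite ger0_norm// (le_trans s1)// ler1n.
move=> y h; have t1 := relu_cube_taylor y h.
have t2 := relu_cube_taylor (y - 1) h; have t3 := relu_cube_taylor (y - 2) h.
have t4 := relu_cube_taylor (y - 3) h.
rewrite (addrAC y (- 1)) in t2; rewrite (addrAC y (- 2)) in t3.
rewrite (addrAC y (- 3)) in t4; rewrite -normrX in t1 t2 t3 t4 *.
move: t1 t2 t3 t4; rewrite /step /step1 /step2 /relu_sum !expr1.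
set A := relu (y + h) ^+ 3; set B := relu (y + h - 1) ^+ 3.
set C := relu (y + h - 2) ^+ 3; set D := relu (y + h - 3) ^+ 3.
rewrite !ler_norml; lra.
Qed.

(** Composition with affine maps, used to sharpen and move test functions. *)
Lemma smooth3_affine {R : realType} K (g g1 g2 : R -> R) (al be c b : R) :
  smooth3 K g g1 g2 -> 0 < c ->
  smooth3 (`|al| + `|be| * (K * (1 + c) ^+ 3)) (fun y => al + be * g (c * y + b))
    (fun y => be * (c * g1 (c * y + b))) (fun y => be * (c ^+ 2 * g2 (c * y + b))).
Proof.
move=> gs c0; have K0 := smooth3_ge0 gs; case: gs => -[mg mg1 mg2] bg tg.
have ma : measurable_fun setT (fun y : R => c * y + b).
  by apply: measurable_funD => //; exact: measurable_funM.
have c3 : c ^+ 3 <= (1 + c) ^+ 3.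
  by rewrite lerXn2r ?nnegrE//; lra.
have c20 : 0 <= c ^+ 2 by rewrite sqr_ge0.
have c30 : 0 <= c ^+ 3 by rewrite exprn_ge0// ltW.
have e3 : (1 + c) ^+ 3 = 1 + 3 * c + 3 * c ^+ 2 + c ^+ 3 by ring.
have w k : 0 <= k -> k <= (1 + c) ^+ 3 -> `|be| * (K * k) <= `|be| * (K * (1 + c) ^+ 3).
  by move=> k0 kc; rewrite ler_wpM2l// ler_wpM2l.
split.
- split; [apply: measurable_funD => //|..]; apply: measurable_funM => //.
  + exact: measurableT_comp.
  + by apply: measurable_funM => //; exact: measurableT_comp.
  + by apply: measurable_funM => //; exact: measurableT_comp.
- move=> y; have [b0 b1 b2] := bg (c * y + b); split.
  + rewrite (le_trans (ler_normD _ _))// lerD2l normrM.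
    apply: (le_trans _ (w 1 _ _)) => //; last lra.
    by rewrite mulr1 ler_wpM2l.
  + rewrite ler_wpDl// !normrM (gtr0_norm c0).
    apply: (le_trans _ (w c _ _)); rewrite ?(ltW c0)//; last lra.
    by rewrite ler_wpM2l// mulrC ler_wpM2r// ltW.
  + rewrite ler_wpDl// 2!normrM (ger0_norm c20).
    apply: (le_trans _ (w (c ^+ 2) _ _)) => //; last lra.
    by rewrite ler_wpM2l// mulrC ler_wpM2r.
move=> y h; have := tg (c * y + b) (c * h).
have -> : c * y + b + c * h = c * (y + h) + b by ring.
rewrite normrM (gtr0_norm c0) => t.
rewrite (_ : _ - _ - _ - _ = be * (g (c * (y + h) + b) - g (c * y + b) -
  g1 (c * y + b) * (c * h) - g2 (c * y + b) * (c * h) ^+ 2 / 2)); last by field.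
rewrite normrM (le_trans (ler_wpM2l _ t))// mulrDl ler_wpDl ?mulr_ge0 ?exprn_ge0//.
have -> : `|be| * (K * (c * `|h|) ^+ 3) = `|be| * (K * c ^+ 3) * `|h| ^+ 3 by ring.
by rewrite ler_wpM2r ?exprn_ge0//; apply: w.
Qed.

Lemma smooth3_cos {R : realType} :
  smooth3 1 (@cos R) (fun t => - sin t) (fun t => - cos t).
Proof.
split.
- have mc : measurable_fun setT (@cos R).
    by apply: continuous_measurable_fun; exact: continuous_cos.
  have ms : measurable_fun setT (@sin R).
    by apply: continuous_measurable_fun; exact: continuous_sin.
  by split=> //; exact: measurableT_comp.
- move=> y; rewrite !normrN; split; rewrite ler_norml ?cos_geN1 ?cos_le1//.
  by rewrite sin_geN1 sin_le1.
by move=> y h; rewrite !mulNr !opprK mul1r; exact: cos_taylor2.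
Qed.

(** * Convolution of Gaussian densities *)

(** Completing the square in the exponent of a product of two Gaussian densities
    of variances [S] and [U]. *)
Lemma gauss_square_completion (F : fieldType) (S U V a c : F) :
  S != 0 -> U != 0 -> V != 0 -> V = S + U -> 2 != 0 :> F ->
  - (c - a) ^+ 2 / (U *+ 2) + - a ^+ 2 / (S *+ 2) =
  - c ^+ 2 / (V *+ 2) + - (a - c * S / V) ^+ 2 / (S * U / V *+ 2).
Proof.
rewrite -(mulr_natr U) -(mulr_natr S) -(mulr_natr V) -(mulr_natr (S * U / V)).
move=> S0 U0 V0 VE two; have -> : U = V - S by rewrite VE; ring.
have {}U0 : V - S != 0 by rewrite VE addrAC subrr add0r.
field.
by rewrite V0 S0 two U0.
Qed.

Lemma gauss_peak_conv (R : realType) (S U V p : R) :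
  0 < S -> 0 < U -> 0 < V -> 0 < p ->
  Num.sqrt (U * p *+ 2) * Num.sqrt (S * p *+ 2) =
  Num.sqrt (V * p *+ 2) * Num.sqrt (S * U / V * p *+ 2).
Proof.
rewrite -(mulr_natr (U * p)) -(mulr_natr (S * p)) -(mulr_natr (V * p)).
rewrite -(mulr_natr (S * U / V * p)).
move=> S0 U0 V0 p0; have V0' := lt0r_neq0 V0.
rewrite -!sqrtrM; last 2 first.
- by rewrite ltW// !mulr_gt0.
- by rewrite ltW// !mulr_gt0.
by congr Num.sqrt; field.
Qed.

(** Integration against a measure given by a density, extended from indicators to
    nonnegative simple functions and then by monotone convergence. *)
Section density.
Local Open Scope ereal_scope.
Context d (T : measurableType d) (R : realType).
Variables (mu nu : {measure set T -> \bar R}) (h : T -> R).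
Hypotheses (mh : measurable_fun setT h) (h0 : forall x, (0 <= h x)%R).
Hypothesis nuE : forall A, measurable A -> nu A = \int[mu]_(x in A) (h x)%:E.

Import HBNNSimple.

Let integral_density_indic E : measurable E ->
  \int[nu]_x (\1_E x)%:E = \int[mu]_x ((\1_E x)%:E * (h x)%:E).
Proof.
move=> mE; rewrite integral_indic//= setIT nuE// integral_mkcond/=.
apply: eq_integral => x _; rewrite patchE indicE.
by case: ifPn => xE; rewrite ?mul1e// mul0e.
Qed.

Let integral_density_nnsfun (f : {nnsfun T >-> R}) :
  \int[nu]_x (f x)%:E = \int[mu]_x ((f x)%:E * (h x)%:E).
Proof.
under [LHS]eq_integral do rewrite fimfunE -fsumEFin//.
rewrite [LHS]ge0_integral_fsum//; last 2 first.
  - by move=> r; exact/measurable_EFinP/measurableT_comp.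
  - by move=> n x _; rewrite EFinM nnfun_muleindic_ge0.
under [RHS]eq_integral.
  move=> x xD; rewrite fimfunE -fsumEFin// ge0_mule_fsuml; last first.
    by move=> r; rewrite EFinM nnfun_muleindic_ge0.
  over.
rewrite [RHS]ge0_integral_fsum//; last 2 first.
  - by move=> r; apply/measurable_EFinP; apply: measurable_funM => //; apply/measurableT_comp.
  - move=> n x _; rewrite EFinM mule_ge0 ?lee_fin//.
    by rewrite -lee_fin EFinM nnfun_muleindic_ge0.
apply: eq_fsbigr => r _.
under [RHS]eq_integral do rewrite EFinM -muleA.
rewrite integralZl_indic_nnsfun//= integral_density_indic//.
have [r0|r0] := leP 0%R r.
  rewrite ge0_integralZl//=.
  - by apply/measurable_EFinP; apply: measurable_funM.
  - by move=> x _; rewrite mule_ge0 ?lee_fin.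
rewrite preimage_nnfun0//.
have z : (fun x => r%:E * ((\1_(set0 : set T) x)%:E * (h x)%:E)) = cst 0.
  by apply/funext => x; rewrite indicE in_set0 mul0e mule0.
rewrite [in RHS]z integral0.
rewrite [X in _ * X](_ : _ = 0) ?mule0//.
by apply: integral0_eq => x _; rewrite indicE in_set0 mul0e.
Qed.

Lemma ge0_integral_density (f : T -> \bar R) :
  measurable_fun setT f -> (forall x, 0 <= f x) ->
  \int[nu]_x f x = \int[mu]_x (f x * (h x)%:E).
Proof.
move=> mf f0.
pose f_ := nnsfun_approx measurableT mf.
transitivity (limn (fun n => \int[nu]_x (f_ n x)%:E)).
  rewrite -monotone_convergence//=.
  - apply: eq_integral => ? /[!inE] xD; apply/esym/cvg_lim => //=.
    exact: cvg_nnsfun_approx.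
  - by move=> n; exact/measurable_EFinP/measurable_funTS.
  - by move=> n ? _; rewrite lee_fin.
  - by move=> ? _ ? ? mn; rewrite lee_fin; exact/lefP/nd_nnsfun_approx.
transitivity (limn (fun n => \int[mu]_x ((f_ n x)%:E * (h x)%:E))).
  by apply: congr_lim; apply/funext => n; exact: integral_density_nnsfun.
rewrite -monotone_convergence//=.
- apply: eq_integral => x _; apply/cvg_lim => //=.
  by apply: cvgeZr => //; exact: cvg_nnsfun_approx.
- by move=> n; apply/measurable_EFinP; apply: measurable_funM.
- by move=> n x _; rewrite mule_ge0 ?lee_fin.
- move=> x _ m n mn; rewrite lee_wpmul2r ?lee_fin//.
  exact/lefP/nd_nnsfun_approx.
Qed.

End density.

Section gauss.
Local Open Scope ereal_scope.
Context {R : realType}.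
Local Notation leb := (@lebesgue_measure R).
Implicit Types (f : R -> \bar R) (a s t : R).

Lemma ge0_integral_shift f a : measurable_fun setT f -> (forall x, 0 <= f x) ->
  \int[leb]_x f (x + a)%R = \int[leb]_x f x.
Proof.
move=> mf f0.
have ms : measurable_fun setT (fun x : measurableTypeR R => (x + a)%R : measurableTypeR R).
  exact: measurable_funD.
rewrite -(@ge0_integral_pushforward _ _ _ _ _ _ ms leb setT f)//.
apply: eq_measure_integral => A mA _; apply/esym.
apply: lebesgue_measure_unique => // _ [[u v]] _ <-.
rewrite /= /pushforward (_ : _ @^-1` _ = `]u - a, v - a]%classic)%R; last first.
  by apply/seteqP; split=> x /=; rewrite !in_itv/= ltrBlDr lerBrDr.
rewrite !lebesgue_measure_itv/= !lte_fin ltrD2r.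
by case: ifPn => //; rewrite -!EFinB => _; congr EFin; ring.
Qed.

Lemma ge0_integral_normal s f : measurable_fun setT f -> (forall x, 0 <= f x) ->
  \int[normal_prob 0 s]_x f x = \int[leb]_x (f x * (normal_pdf 0 s x)%:E).
Proof.
move=> mf f0; apply: ge0_integral_density => //.
- exact: measurable_normal_pdf.
- by move=> x; exact: normal_pdf_ge0.
Qed.

(** The exponential [expR (t * x)] shifts the centre of the density to
    [s ^+ 2 * t] and produces the constant. *)
Lemma normal_mgf s t : s != 0%R ->
  \int[normal_prob 0 s]_x (expR (t * x))%:E = (expR (s ^+ 2 * t ^+ 2 / 2))%:E.
Proof.
move=> s0; rewrite ge0_integral_normal; last 2 first.
- by apply/measurable_EFinP; apply: measurableT_comp => //; exact: measurable_funM.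
- by move=> x; rewrite lee_fin expR_ge0.
transitivity (\int[leb]_x ((expR (s ^+ 2 * t ^+ 2 / 2))%:E *
    (normal_pdf (s ^+ 2 * t) s x)%:E)).
  apply: eq_integral => x _; rewrite -!EFinM !normal_pdfE// /normal_fun.
  congr EFin; rewrite mulrCA [RHS]mulrCA -!expRD; congr (_ * expR _)%R.
  by rewrite -mulr_natr; field.
rewrite ge0_integralZl//=.
- by rewrite integral_normal_pdf mule1.
- by apply/measurable_EFinP; exact: measurable_normal_pdf.
- by move=> x _; rewrite lee_fin normal_pdf_ge0.
Qed.

(** As a function of [a], the product is a multiple of a Gaussian density, so
    that integrating over [a] leaves the density of variance
    [s ^+ 2 + t ^+ 2]. *)
Lemma normal_pdf_conv s t a c : s != 0%R -> t != 0%R ->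
  let r := Num.sqrt (s ^+ 2 + t ^+ 2) in
  (normal_pdf 0 t (c - a) * normal_pdf 0 s a =
   normal_pdf 0 r c * normal_pdf (c * s ^+ 2 / r ^+ 2) (s * t / r) a)%R.
Proof.
move=> s0 t0 r.
have s2 : (0 < s ^+ 2)%R by rewrite exprn_even_gt0.
have t2 : (0 < t ^+ 2)%R by rewrite exprn_even_gt0.
have r2 : (r ^+ 2 = s ^+ 2 + t ^+ 2)%R by rewrite sqr_sqrtr// addr_ge0 ?ltW.
have r0 : (0 < r)%R by rewrite sqrtr_gt0 addr_gt0.
have rn0 : r != 0%R by rewrite gt_eqF.
clearbody r.
have st0 : (s * t / r != 0)%R by rewrite !mulf_neq0 ?invr_eq0.
have st2 : ((s * t / r) ^+ 2 = s ^+ 2 * t ^+ 2 / r ^+ 2)%R.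
  by rewrite expr_div_n exprMn.
have rr0 : (0 < r ^+ 2)%R by rewrite exprn_gt0.
rewrite !normal_pdfE// /normal_fun mulrACA [RHS]mulrACA.
rewrite -[in LHS]expRD -[in RHS]expRD st2 !subr0.
congr (_ * expR _)%R.
  rewrite /normal_peak -!invfM st2; congr (_^-1)%R.
  by apply: gauss_peak_conv => //; exact: pi_gt0.
by apply: gauss_square_completion; rewrite ?gt_eqF// ?r2.
Qed.

Lemma normal_prob_conv s t f : s != 0%R -> t != 0%R ->
  measurable_fun setT f -> (forall x, 0 <= f x) ->
  \int[normal_prob 0 s]_a \int[normal_prob 0 t]_b f (a + b)%R =
  \int[normal_prob 0 (Num.sqrt (s ^+ 2 + t ^+ 2))]_c f c.
Proof.
move=> s0 t0 mf f0; set r := Num.sqrt _.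
have mpdf u v : measurable_fun setT (fun x : R => (normal_pdf u v x)%:E).
  by apply/measurable_EFinP; exact: measurable_normal_pdf.
have inner a : \int[normal_prob 0 t]_b f (a + b)%R =
    \int[leb]_c (f c * (normal_pdf 0 t (c - a))%:E).
  have mfa : measurable_fun setT (fun b : R => f (a + b)%R).
    by apply: (measurableT_comp mf); exact: measurable_funD.
  rewrite (ge0_integral_normal t mfa (fun b => f0 (a + b)%R)).
  rewrite -[RHS](@ge0_integral_shift _ a).
  - by apply: eq_integral => b _; rewrite addrK addrC.
  - apply: emeasurable_funM => //; apply: (measurableT_comp (mpdf 0%R t)).
    exact: measurable_funB.
  - by move=> x; rewrite mule_ge0// lee_fin normal_pdf_ge0.
under eq_integral do rewrite inner.
have mF : measurable_fun setT (fun ac : R * R =>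
    f ac.2 * (normal_pdf 0 t (ac.2 - ac.1))%:E * (normal_pdf 0 s ac.1)%:E).
  apply: emeasurable_funM; last exact: measurableT_comp (mpdf 0%R s) _.
  apply: emeasurable_funM; first exact: measurableT_comp mf _.
  apply: (measurableT_comp (mpdf 0%R t)); exact: measurable_funB.
have pp (u v x : R) : 0 <= (normal_pdf u v x)%:E by rewrite lee_fin normal_pdf_ge0.
have F0 (ac : R * R) :
    0 <= f ac.2 * (normal_pdf 0 t (ac.2 - ac.1))%:E * (normal_pdf 0 s ac.1)%:E.
  by rewrite !mule_ge0.
have mG : measurable_fun setT (fun a =>
    \int[leb]_c (f c * (normal_pdf 0 t (c - a))%:E)).
  have mK : measurable_fun setT
      (fun ac : R * R => f ac.2 * (normal_pdf 0 t (ac.2 - ac.1))%:E).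
    apply: emeasurable_funM; first exact: measurableT_comp mf _.
    apply: (measurableT_comp (mpdf 0%R t)); exact: measurable_funB.
  apply: (@measurable_fun_fubini_tonelli_F _ _ _ _ _ leb _ mK) => ac.
  by rewrite mule_ge0.
rewrite (ge0_integral_normal r mf f0) (ge0_integral_normal s mG); last first.
  by move=> x; apply: integral_ge0 => c _; rewrite mule_ge0.
transitivity (\int[leb]_a \int[leb]_c
    (f c * (normal_pdf 0 t (c - a))%:E * (normal_pdf 0 s a)%:E)).
  apply: eq_integral => a _; rewrite ge0_integralZr//.
  - apply: emeasurable_funM => //; apply: (measurableT_comp (mpdf 0%R t)).
    exact: measurable_funB.
  - by move=> c _; rewrite mule_ge0.
rewrite (@fubini_tonelli _ _ _ _ _ leb leb _ mF F0)/=.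
apply: eq_integral => c _.
under eq_integral do rewrite -muleA -EFinM normal_pdf_conv// EFinM muleA.
rewrite ge0_integralZl//= ?mule_ge0//; last exact: mpdf.
by rewrite integral_normal_pdf mule1.
Qed.

End gauss.

(** * Moments of Gaussian laws *)

Section moments_lemmas.
Context {R : realType}.
Implicit Types (s t x u h C dl a e : R).

Lemma cube_le_expR_norm x : `|x| ^+ 3 <= 27 * expR `|x|.
Proof.
have h := expR_ge1Dx (`|x| / 3).
have e : expR `|x| = expR (`|x| / 3) ^+ 3.
  by rewrite -expRM_natr; congr expR; field.
have x0 : 0 <= `|x| by [].
rewrite e; set y := `|x| / 3 in h *.
have -> : `|x| = 3 * y by rewrite /y; field.
rewrite exprMn (_ : 3 ^+ 3 = 27 :> R); last by ring.
rewrite ler_wpM2l// lerXn2r ?nnegrE ?expR_ge0 ?divr_ge0//.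
by rewrite (le_trans _ h)// lerDr.
Qed.

Lemma expR_norm_le x : expR `|x| <= expR x + expR (- x).
Proof. by case: (ger0P x) => x0; [rewrite lerDl|rewrite lerDr]; exact: expR_ge0. Qed.

Lemma expR_taylor2 h : `|expR h - 1 - h - h ^+ 2 / 2| <= `|h| ^+ 3 * expR `|h|.
Proof.
rewrite [leRHS]mulrC.
have -> : expR h - 1 - h - h ^+ 2 / 2 =
  expR (0 + h) - expR 0 - expR 0 * h - expR 0 * h ^+ 2 / 2.
  by rewrite expR0 add0r !mul1r.
apply: (@taylor2_bound R expR expR expR expR (expR `|h|) `|h| 0) => //.
move=> k kh; rewrite add0r ger0_norm ?expR_ge0// ler_expR.
by rewrite (le_trans _ kh)// ler_norm.
Qed.

Lemma expR_taylor1 u : 0 <= u <= 2^-1 -> 0 <= expR u - 1 - u <= 2 * u ^+ 2.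
Proof.
move=> /andP[u0 u1]; have h1 := expR_ge1Dx u; have h2 := expR_ge1Dx (- u).
have e0 : 0 < 1 - u by lra.
have h3 : expR u <= (1 - u)^-1.
  by rewrite -[expR u]invrK -expRN lef_pV2 ?posrE ?expR_gt0.
have h4 : (1 - u)^-1 <= 1 + u + 2 * u ^+ 2.
  rewrite -[leLHS]mul1r ler_pdivrMr// mulrC.
  have -> : (1 - u) * (1 + u + 2 * u ^+ 2) = 1 + u ^+ 2 * (1 - 2 * u) by ring.
  have : 0 <= u ^+ 2 * (1 - 2 * u) by rewrite mulr_ge0 ?sqr_ge0//; lra.
  by rewrite lerDl.
by apply/andP; split; lra.
Qed.

(** Serves to compare the Taylor coefficients of two expansions. *)
Lemma eq0_le_small a C dl : 0 < dl -> 0 <= C ->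
  (forall e, 0 < e -> e <= dl -> `|a| <= C * e) -> a = 0.
Proof.
move=> d0 C0 h; apply/eqP; rewrite -normr_eq0 eq_le normr_ge0 andbT.
apply/ler_addgt0Pr => e e0; rewrite add0r.
have [b0 bd be] : [/\ 0 < Num.min dl (e / (C + 1)), Num.min dl (e / (C + 1)) <= dl &
   Num.min dl (e / (C + 1)) <= e / (C + 1)].
  split; rewrite ?lt_min ?d0 ?divr_gt0 ?ltr_wpDl// ge_min ?lexx ?orbT//.
rewrite (le_trans (h _ b0 bd))// (le_trans (ler_wpM2l C0 be))//.
have c1 : 0 < C + 1 by lra.
by rewrite mulrA ler_pdivrMr//; have := ltW e0; lra.
Qed.

End moments_lemmas.

Section probability_integrals.
Context d (T : measurableType d) (R : realType) (P : probability T R).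

Lemma bounded_integrable (f : T -> R) (K : R) : measurable_fun setT f ->
  (forall x, `|f x| <= K) -> P.-integrable setT (EFin \o f).
Proof.
move=> mf fK; apply: measurable_bounded_integrable => //.
  by rewrite [ltLHS](@probability_setT _ _ _ P) ltry.
by exists K; split; rewrite ?num_real// => M KM x _ /=; rewrite (le_trans (fK x))// ltW.
Qed.

Lemma dominated_integrable (f g : T -> R) : measurable_fun setT f ->
  (forall x, `|f x| <= g x) -> P.-integrable setT (EFin \o g) ->
  P.-integrable setT (EFin \o f).
Proof.
move=> mf fg; apply: le_integrable => //; first exact/measurable_EFinP.
by move=> x _ /=; rewrite lee_fin (le_trans (fg x))// ler_norm.
Qed.

Lemma integrableDr (f g : T -> R) : P.-integrable setT (EFin \o f) ->
  P.-integrable setT (EFin \o g) ->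
  P.-integrable setT (EFin \o (fun x => f x + g x)).
Proof. exact: integrableD. Qed.

Lemma integrableBr (f g : T -> R) : P.-integrable setT (EFin \o f) ->
  P.-integrable setT (EFin \o g) ->
  P.-integrable setT (EFin \o (fun x => f x - g x)).
Proof. exact: integrableB. Qed.

Lemma integrable_scale (f : T -> R) k : P.-integrable setT (EFin \o f) ->
  P.-integrable setT (EFin \o (fun x => k * f x)).
Proof. exact: integrableZl. Qed.

Lemma integrable_cst (k : R) : P.-integrable setT (EFin \o cst k).
Proof. exact: (@bounded_integrable _ `|k|). Qed.

Lemma Rintegral_cst1 (k : R) : \int[P]_x (cst k x) = k.
Proof. by rewrite Rintegral_cst//= probability_setT mulr1. Qed.

End probability_integrals.

Section normal_moments.
Context {R : realType}.
Implicit Types (s t : R).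
Local Notation normal s := (normal_prob (0 : R) s : probability (measurableTypeR R) R).

Lemma integrable_normal_expR s t : s != 0 ->
  (normal s).-integrable setT (EFin \o (fun x : R => expR (t * x))).
Proof.
move=> s0; apply/integrableP; split.
  by apply/measurable_EFinP; apply: measurableT_comp => //; exact: measurable_funM.
under eq_integral do rewrite /= ger0_norm ?expR_ge0//.
by rewrite normal_mgf// ltry.
Qed.

Lemma Rintegral_normal_expR s t : s != 0 ->
  \int[normal s]_x expR (t * x) = expR (s ^+ 2 * t ^+ 2 / 2).
Proof. by move=> s0; rewrite /Rintegral normal_mgf. Qed.

(** All moments are dominated by exponentials, whose integrals are the values of
    the moment generating function. *)
Lemma normal_cube_dom s x : 0 < s ->
  `|x| ^+ 3 <= 27 * s ^+ 3 * (expR (s^-1 * x) + expR (- s^-1 * x)).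
Proof.
move=> s0; have := le_trans (cube_le_expR_norm (s^-1 * x))
  (ler_wpM2l (ler0n _ 27) (expR_norm_le _)).
rewrite normrM exprMn normfV (gtr0_norm s0) exprVn mulNr.
by rewrite ler_pdivrMl ?exprn_gt0// mulrA [s ^+ 3 * 27]mulrC.
Qed.

(** A bound for the third absolute moment of the standard Gaussian law; the value
    comes from [normal_cube_dom], applied with exponents [s^-1] and [- s^-1]. *)
Definition normal_cube_const : R := 54 * expR (2^-1).

Lemma integrable_normal_cube s : 0 < s ->
  (normal s).-integrable setT (EFin \o (fun x : R => `|x| ^+ 3)).
Proof.
move=> s0; have sn0 := lt0r_neq0 s0.
apply: (@dominated_integrable _ _ _ (normal s) _ (fun x : R =>
  27 * s ^+ 3 * (expR (s^-1 * x) + expR (- s^-1 * x)))).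
- by apply: measurable_funX.
- by move=> x; rewrite ger0_norm ?exprn_ge0//; exact: normal_cube_dom.
- by apply: integrable_scale; apply: integrableDr; exact: integrable_normal_expR.
Qed.

Lemma Rintegral_normal_cube s : 0 < s ->
  \int[normal s]_x (`|x| ^+ 3) <= normal_cube_const * s ^+ 3.
Proof.
move=> s0; have sn0 := lt0r_neq0 s0.
have i1 := integrable_normal_expR (s^-1) sn0.
have i2 := integrable_normal_expR (- s^-1) sn0.
apply: (@le_trans _ _ (\int[normal s]_x
  (27 * s ^+ 3 * (expR (s^-1 * x) + expR (- s^-1 * x))))).
  apply: le_Rintegral => //; first exact: integrable_normal_cube.
    by apply: integrable_scale; apply: integrableDr.
  by move=> x _; exact: normal_cube_dom.
rewrite RintegralZl//; last exact: integrableDr.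
rewrite RintegralD// !Rintegral_normal_expR// sqrrN exprVn mulfV ?expf_neq0//.
by rewrite mul1r /normal_cube_const le_eqVlt; apply/orP; left; apply/eqP; ring.
Qed.

Lemma integrable_normal_id s : 0 < s ->
  (normal s).-integrable setT (EFin \o (fun x : R => x)).
Proof.
move=> s0; apply: (@dominated_integrable _ _ _ (normal s) _ (fun x : R => 1 + `|x| ^+ 3)) => //.
- move=> x; case: (leP `|x| 1) => x1; first by rewrite ler_wpDr ?exprn_ge0.
  by rewrite ler_wpDl// -[leLHS]expr1 ler_weXn2l// ltW.
- by apply: integrableDr; [exact: integrable_cst|exact: integrable_normal_cube].
Qed.

Lemma integrable_normal_sqr s : 0 < s ->
  (normal s).-integrable setT (EFin \o (fun x : R => x ^+ 2)).
Proof.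
move=> s0; apply: (@dominated_integrable _ _ _ (normal s) _ (fun x : R => 1 + `|x| ^+ 3)) => //.
- move=> x; rewrite normrX; case: (leP `|x| 1) => x1.
    by rewrite ler_wpDr ?exprn_ge0// exprn_ile1.
  by rewrite ler_wpDl// ler_weXn2l// ltW.
- by apply: integrableDr; [exact: integrable_cst|exact: integrable_normal_cube].
Qed.

(** The first two moments are the first two Taylor coefficients at [0] of the
    moment generating function: both sides are expanded to second order with a
    cubic error and the coefficients compared for small [t]. *)
Lemma normal_moments s : 0 < s ->
  \int[normal s]_x x = 0 /\ \int[normal s]_x (x ^+ 2) = s ^+ 2.
Proof.
move=> s0; have sn0 := lt0r_neq0 s0.
set m := normal s; set mu := \int[m]_x x; set v := \int[m]_x (x ^+ 2).
pose dom (x : R) := 27 * s ^+ 3 * (expR (2 * s^-1 * x) + expR (- (2 * s^-1) * x)).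
have idom : m.-integrable setT (EFin \o dom).
  by apply: integrable_scale; apply: integrableDr; exact: integrable_normal_expR.
set B := \int[m]_x dom x.
have s3 : 0 <= s ^+ 3 by rewrite exprn_ge0// ltW.
have B0 : 0 <= B.
  apply: Rintegral_ge0 => x _; apply: mulr_ge0; first exact: mulr_ge0.
  by rewrite addr_ge0 ?expR_ge0.
have BS0 : 0 <= B + s ^+ 3 by rewrite addr_ge0.
have key t : `|t| <= s^-1 ->
    `|t * mu + t ^+ 2 * (v - s ^+ 2) / 2| <= (B + s ^+ 3) * `|t| ^+ 3.
  move=> ts.
  have iX := integrable_normal_id s0; have iX2 := integrable_normal_sqr s0.
  have ie := integrable_normal_expR t sn0.
  have i1 := integrable_cst (normal s) 1.
  have E : \int[m]_x (expR (t * x) - 1 - t * x - (t ^+ 2 / 2) * x ^+ 2) =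
      expR (s ^+ 2 * t ^+ 2 / 2) - 1 - t * mu - t ^+ 2 / 2 * v.
    rewrite RintegralB//; last exact: integrable_scale.
      rewrite RintegralB//; last exact: integrable_scale.
        rewrite RintegralB// Rintegral_normal_expR// Rintegral_cst1.
        by rewrite !RintegralZl.
      exact: integrableBr.
    by apply: integrableBr; [exact: integrableBr|exact: integrable_scale].
  have iall : m.-integrable setT (EFin \o
      (fun x => expR (t * x) - 1 - t * x - (t ^+ 2 / 2) * x ^+ 2)).
    apply: integrableBr; last exact: integrable_scale.
    by apply: integrableBr; [exact: integrableBr|exact: integrable_scale].
  have L : `|\int[m]_x (expR (t * x) - 1 - t * x - (t ^+ 2 / 2) * x ^+ 2)| <=
      `|t| ^+ 3 * B.
    rewrite (le_trans (le_normr_Rintegral _ iall))//.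
    rewrite -RintegralZl//; apply: le_Rintegral => //.
    - exact: integrable_norm.
    - exact: integrable_scale.
    move=> x _.
    have -> : expR (t * x) - 1 - t * x - t ^+ 2 / 2 * x ^+ 2 =
      expR (t * x) - 1 - t * x - (t * x) ^+ 2 / 2 by ring.
    rewrite (le_trans (expR_taylor2 _))// normrM exprMn -mulrA ler_wpM2l ?exprn_ge0//.
    have zE : `|s^-1 * x| = s^-1 * `|x| by rewrite normrM gtr0_norm ?invr_gt0.
    have h1 : `|x| ^+ 3 <= 27 * s ^+ 3 * expR (s^-1 * `|x|).
      have := cube_le_expR_norm (s^-1 * x).
      rewrite zE exprMn exprVn ler_pdivrMl ?exprn_gt0//.
      by rewrite mulrA [s ^+ 3 * 27]mulrC.
    have h2 : expR (`|t| * `|x|) <= expR (s^-1 * `|x|).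
      by rewrite ler_expR ler_wpM2r.
    rewrite (le_trans (ler_pM _ _ h1 h2))// ?expR_ge0 ?exprn_ge0//.
    rewrite -[leLHS]mulrA -expRD /dom; apply: ler_wpM2l; first exact: mulr_ge0.
    have := expR_norm_le (2 * s^-1 * x).
    have -> : `|2 * s^-1 * x| = s^-1 * `|x| + s^-1 * `|x|.
      by rewrite -mulrA normrM zE ger0_norm//; ring.
    by rewrite mulNr.
  rewrite E in L.
  have st : s * `|t| <= 1 by rewrite mulrC -ler_pdivlMr// mul1r.
  have t0 := normr_ge0 t.
  have st0 : 0 <= s * `|t| by rewrite mulr_ge0// ltW.
  have t2E : t ^+ 2 = `|t| ^+ 2 by rewrite real_normK ?num_real.
  have stE : s ^+ 2 * t ^+ 2 = (s * `|t|) ^+ 2 by rewrite t2E exprMn.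
  have u2 : (s * `|t|) ^+ 2 <= 1 by rewrite exprn_ile1.
  have /andP[l1 l2] : 0 <= expR (s ^+ 2 * t ^+ 2 / 2) - 1 - s ^+ 2 * t ^+ 2 / 2
      <= s ^+ 3 * `|t| ^+ 3.
    have := @expR_taylor1 R (s ^+ 2 * t ^+ 2 / 2).
    rewrite stE => /(_ _) h.
    have /andP[-> h2]/= : 0 <= expR ((s * `|t|) ^+ 2 / 2) - 1 -
      (s * `|t|) ^+ 2 / 2 <= 2 * ((s * `|t|) ^+ 2 / 2) ^+ 2.
      apply: h; apply/andP; split; first by rewrite divr_ge0// sqr_ge0.
      by lra.
    rewrite (le_trans h2)// -exprMn.
    have h4 : (s * `|t|) ^+ 4 <= (s * `|t|) ^+ 3 by rewrite ler_wiXn2l.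
    have h3 : 0 <= (s * `|t|) ^+ 3 by rewrite exprn_ge0.
    have -> : 2 * ((s * `|t|) ^+ 2 / 2) ^+ 2 = (s * `|t|) ^+ 4 / 2 by field.
    lra.
  move: L l1 l2; set W := expR _ => L l1 l2.
  have -> : t * mu + t ^+ 2 * (v - s ^+ 2) / 2 =
    (W - 1 - s ^+ 2 * t ^+ 2 / 2) - (W - 1 - t * mu - t ^+ 2 / 2 * v) by field.
  rewrite (le_trans (ler_normB _ _))// mulrDl addrC [B * _]mulrC.
  by apply: lerD => //; rewrite ger0_norm.
have key1 e : 0 < e -> e <= s^-1 -> `|v - s ^+ 2| <= 2 * (B + s ^+ 3) * e.
  move=> e0 es; have k1 := key e; have k2 := key (- e).
  rewrite normrN (gtr0_norm e0) in k1 k2; move: (k1 es) (k2 es).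
  rewrite sqrrN => {k1 k2}/ler_normlP[a1 a2] /ler_normlP[b1 b2].
  have e2 : 0 < e ^+ 2 by rewrite exprn_gt0.
  rewrite -(ler_pM2l e2) -{1}(gtr0_norm e2) -normrM.
  have -> : e ^+ 2 * (2 * (B + s ^+ 3) * e) = 2 * ((B + s ^+ 3) * e ^+ 3) by ring.
  by rewrite ler_norml; apply/andP; split; lra.
have vE : v - s ^+ 2 = 0.
  apply: (@eq0_le_small _ _ (2 * (B + s ^+ 3)) s^-1); rewrite ?invr_gt0//.
  exact: mulr_ge0.
split; last by apply/eqP; rewrite -subr_eq0 vE.
apply: (@eq0_le_small _ _ ((B + s ^+ 3) * s^-1) s^-1); rewrite ?invr_gt0//.
  by rewrite mulr_ge0 ?invr_ge0 ?(ltW s0).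
move=> e e0 es; have := key e; rewrite (gtr0_norm e0) => /(_ es).
rewrite vE mulr0 mul0r addr0 normrM (gtr0_norm e0) exprS mulrCA ler_pM2l//.
move=> h; rewrite (le_trans h)// -mulrA ler_wpM2l//.
by rewrite ler_wpM2r// ltW.
Qed.

End normal_moments.

(** The degenerate Gaussian law of standard deviation [0] is the Dirac mass, so
    that Gaussian laws form a convolution semigroup. *)
Section gauss_law.
Context {R : realType}.
Implicit Types (s t : R).

Definition gauss s : probability (measurableTypeR R) R :=
  if s == 0 then (@dirac _ (measurableTypeR R) 0 R : probability (measurableTypeR R) R)
  else (normal_prob 0 s : probability (measurableTypeR R) R).

Lemma gauss0 : gauss 0 = @dirac _ (measurableTypeR R) 0 R :> probability (measurableTypeR R) R.
Proof. by rewrite /gauss eqxx. Qed.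

Lemma gaussE s : s != 0 ->
  gauss s = normal_prob 0 s :> probability (measurableTypeR R) R.
Proof. by move=> /negbTE s0; rewrite /gauss s0. Qed.

Lemma Rintegral_gauss0 (f : measurableTypeR R -> R) : measurable_fun setT f ->
  \int[gauss 0]_x f x = f 0.
Proof.
move=> mf; rewrite gauss0 /Rintegral integral_dirac ?diracT ?mul1e//.
exact/measurable_EFinP.
Qed.

Lemma integrable_gauss0 (f : measurableTypeR R -> R) : measurable_fun setT f ->
  (gauss 0).-integrable setT (EFin \o f).
Proof.
move=> mf; rewrite gauss0; apply/integrableP; split; first exact/measurable_EFinP.
rewrite integral_dirac ?diracT ?mul1e ?ltry//.
by apply: measurableT_comp => //; exact/measurable_EFinP.
Qed.

Lemma gauss_moments s : 0 <= s -> [/\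
  \int[gauss s]_x x = 0, \int[gauss s]_x (x ^+ 2) = s ^+ 2 &
  \int[gauss s]_x (`|x| ^+ 3) <= normal_cube_const * s ^+ 3].
Proof.
rewrite le_eqVlt => /predU1P[<-|s0].
  rewrite !Rintegral_gauss0//; last by apply: measurable_funX.
  by rewrite normr0 !expr0n/= mulr0.
rewrite gaussE ?lt0r_neq0//; have [m1 m2] := normal_moments s0.
by split => //; exact: Rintegral_normal_cube.
Qed.

Lemma integrable_gauss_cube s : 0 <= s ->
  (gauss s).-integrable setT (EFin \o (fun x : R => `|x| ^+ 3)).
Proof.
rewrite le_eqVlt => /predU1P[<-|s0].
  by apply: integrable_gauss0; apply: measurable_funX.
by rewrite gaussE ?lt0r_neq0//; exact: integrable_normal_cube.
Qed.

Lemma integrable_gauss_sqr s : 0 <= s ->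
  (gauss s).-integrable setT (EFin \o (fun x : R => x ^+ 2)).
Proof.
rewrite le_eqVlt => /predU1P[<-|s0].
  by apply: integrable_gauss0; exact: measurable_funX.
by rewrite gaussE ?lt0r_neq0//; exact: integrable_normal_sqr.
Qed.

Lemma integrable_gauss_id s : 0 <= s ->
  (gauss s).-integrable setT (EFin \o (fun x : R => x)).
Proof.
rewrite le_eqVlt => /predU1P[<-|s0]; first exact: integrable_gauss0.
by rewrite gaussE ?lt0r_neq0//; exact: integrable_normal_id.
Qed.

Lemma ge0_gauss_conv s t (f : R -> \bar R) : 0 <= s -> 0 <= t ->
  measurable_fun setT f -> (forall x, 0 <= f x)%E ->
  (\int[gauss s]_a \int[gauss t]_b f (a + b)%R =
   \int[gauss (Num.sqrt (s ^+ 2 + t ^+ 2))]_c f c)%E.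
Proof.
move=> s0 t0 mf f0.
have mfa a : measurable_fun setT (fun b : R => f (a + b)).
  by apply: (measurableT_comp mf); exact: measurable_funD.
have mF : measurable_fun setT (fun ac : R * R => f (ac.1 + ac.2)).
  by apply: (measurableT_comp mf); exact: measurable_funD.
have mG := @measurable_fun_fubini_tonelli_F _ _ _ _ _ (gauss t) _ mF (fun ac => f0 _).
have [se|sn0] := eqVneq s 0.
  have -> : Num.sqrt (s ^+ 2 + t ^+ 2) = t.
    by rewrite se expr0n/= add0r sqrtr_sqr ger0_norm.
  have H := @integral_dirac _ (measurableTypeR R) 0 R setT measurableT _ mG.
  rewrite se gauss0; etransitivity; first exact: H.
  by rewrite diracT mul1e; apply: eq_integral => x _ /=; rewrite add0r.
have [te|tn0] := eqVneq t 0.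
  have -> : Num.sqrt (s ^+ 2 + t ^+ 2) = s.
    by rewrite te expr0n/= addr0 sqrtr_sqr ger0_norm.
  rewrite te gauss0; apply: eq_integral => a _.
  have H := @integral_dirac _ (measurableTypeR R) 0 R setT measurableT _ (mfa a).
  by etransitivity; [exact: H|rewrite diracT mul1e addr0].
have r0 : Num.sqrt (s ^+ 2 + t ^+ 2) != 0.
  by rewrite gt_eqF// sqrtr_gt0 ltr_pwDl ?sqr_ge0// exprn_even_gt0.
rewrite (gaussE sn0) (gaussE tn0) (gaussE r0).
exact: (normal_prob_conv sn0 tn0 mf f0).
Qed.

End gauss_law.

(** * Independence of a partial sum and the next term *)

Section independence.
Context d (T : measurableType d) (R : realType) (P : probability T R).
Implicit Types (X Y : T -> R).

Definition independent_pair X Y := forall A B : set R,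
  measurable A -> measurable B ->
  P (X @^-1` A `&` Y @^-1` B) = (P (X @^-1` A) * P (Y @^-1` B))%E.

(** The joint law of an independent pair is the product of the laws, so this is
    Fubini's theorem on the product measure. *)
Lemma independent_pair_integral X Y (f : R * R -> R) :
  measurable_fun setT X -> measurable_fun setT Y -> independent_pair X Y ->
  measurable_fun setT f -> P.-integrable setT (EFin \o (fun w => f (X w, Y w))) ->
  (forall x, P.-integrable setT (EFin \o (fun v => f (x, Y v)))) ->
  \int[P]_w f (X w, Y w) = \int[P]_w \int[P]_v f (X w, Y v).
Proof.
move=> mX mY iXY mf intf intfx.
pose X' : {mfun T >-> R} := HB.pack X (isMeasurableFun.Build _ _ _ _ X mX).
pose Y' : {mfun T >-> R} := HB.pack Y (isMeasurableFun.Build _ _ _ _ Y mY).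
have mXY : measurable_fun setT (fun w => (X w, Y w)) by exact: measurable_fun_pair.
pose XY : {mfun T >-> (R * R)%type} :=
  HB.pack (fun w => (X w, Y w)) (isMeasurableFun.Build _ _ _ _ (fun w => (X w, Y w)) mXY).
pose mu : probability R R := distribution P X'.
pose nu : probability R R := distribution P Y'.
have prodE A : measurable A -> (mu \x nu)%E A = distribution P XY A.
  move=> mA.
  apply: (@product_measure_unique _ _ _ _ R mu nu (distribution P XY)).
  + by move=> B C mB mC; exact: iXY.
  + exact: mA.
have mef : measurable_fun setT (EFin \o f) by exact/measurable_EFinP.
have E1 : (\int[mu \x nu]_z (f z)%:E = \int[P]_w (f (X w, Y w))%:E)%E.
  rewrite (eq_measure_integral (distribution P XY)); last by move=> A mA _; exact: prodE.
  by rewrite (@integral_distribution _ _ _ _ _ P XY).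
have intp : (mu \x nu)%E.-integrable setT (EFin \o f).
  apply/integrableP; split => //.
  rewrite (eq_measure_integral (distribution P XY)); last by move=> A mA _; exact: prodE.
  rewrite ge0_integral_distribution//; last exact: measurableT_comp.
  by move/integrableP : intf => [].
have mefx x : measurable_fun setT (fun y => (f (x, y))%:E).
  exact: (measurableT_comp mef).
have FE x : fubini_F nu (EFin \o f) x = (\int[P]_v f (x, Y v))%:E.
  rewrite /fubini_F (@integral_distribution _ _ _ _ _ P Y')//=; last exact: intfx.
  by rewrite /Rintegral fineK//; exact: (integrable_fin_num _ (intfx x)).
have iF := integrable_fubini_F intp.
have mF := measurable_int _ iF.
rewrite /Rintegral -E1 -(integral12_prod_meas1 intp); congr fine.
rewrite (@integral_distribution _ _ _ _ _ P X')//.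
  by apply: eq_integral => w _; exact: FE.
apply/integrableP; split; first exact: measurableT_comp mF mX.
move/integrableP : iF => [_].
by rewrite ge0_integral_distribution//; exact: measurableT_comp.
Qed.

(** A pi-system that generates the events depending on [xi 1, ..., xi n]. *)
Definition cylinders (xi : nat -> T -> R) (n : nat) : set (set T) :=
  [set U | exists A : nat -> set R, (forall i, measurable (A i)) /\
     U = \bigcap_(i in [set` iota 1 n]) xi i @^-1` A i].

Lemma cylinders_setI_closed xi n : setI_closed (cylinders xi n).
Proof.
move=> _ _ [A [mA ->]] [B [mB ->]]; exists (fun i => A i `&` B i); split.
  by move=> i; exact: measurableI.
by rewrite -bigcapI.
Qed.

(** Independence is assumed for finitely many preimages of Borel sets only.  The
    two finite measures that send [U] to the probability of [U] intersected with
    an event of [xi n.+1], and to the product of the two probabilities, agree on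
    cylinders and therefore on the generated sigma-algebra, with respect to which
    the partial sum is measurable. *)
Lemma mutually_independent_partial_sum (xi : nat -> {RV P >-> R}) (a : nat -> R)
    (n : nat) : mutually_independent [set i | (0 < i)%N] xi ->
  independent_pair (fun w => \sum_(1 <= j < n.+1) a j * xi j w) (xi n.+1).
Proof.
move=> xi_indep A B mA mB.
set S := fun w => _; pose C := cylinders xi n.
have mxi i D : measurable D -> measurable (xi i @^-1` D).
  by move=> mD; exact: measurable_funPTI.
have sCm : C `<=` measurable.
  by move=> _ [F [mF ->]]; apply: bigcap_measurableType => i _; exact: mxi.
have mV : measurable (xi n.+1 @^-1` B) by exact: mxi.
have mS : measurable_fun setT (S : g_sigma_algebraType C -> R).
  pose h j := if j \in iota 1 n then xi j : T -> R else cst 0.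
  have -> : S = fun w => \sum_(1 <= j < n.+1) a j * h j w.
    apply/funext => w; apply: eq_big_seq => j; rewrite /index_iota subSS subn0 /h.
    by move=> ->.
  apply: measurable_sum => j; apply: measurable_funM => //.
  rewrite /h; case: ifPn => [jn|_]; last exact: measurable_cst.
  move=> _ D mD; rewrite setTI; apply: sub_sigma_algebra.
  exists (fun i => if i == j then D else setT); split=> [i|]; first by case: ifP.
  apply/seteqP; split => [w Dw i _ /=|w /(_ j jn)/=]; last by rewrite eqxx.
  by case: ifPn => // /eqP ->.
have CS : <<s C >> (S @^-1` A).
  by have := mS measurableT A mA; rewrite setTI; exact.
pose m1 := mrestr P mV.
pose c : {nonneg R} := NngNum (fine_ge0 (measure_ge0 P (xi n.+1 @^-1` B))).
pose m2 := mscale c P.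
have pfin D : measurable D -> P D \is a fin_num.
  by move=> mD; exact: fin_num_measure.
have m12 U : C U -> P (U `&` xi n.+1 @^-1` B) =
    ((fine (P (xi n.+1 @^-1` B)))%:E * P U)%E.
  move=> [F [mF ->]]; rewrite fineK; last exact: pfin.
  have nin : n.+1 \notin iota 1 n by rewrite mem_iota addnC addn1 ltnn andbF.
  pose F' i := if i == n.+1 then B else F i.
  have mF' i : measurable (F' i) by rewrite /F'; case: ifP.
  have FF' i : i \in iota 1 n -> F' i = F i.
    by rewrite /F'; case: eqP => // -> h; rewrite h in nin.
  have FE : \bigcap_(i in [set` iota 1 n]) xi i @^-1` F i =
      \bigcap_(i in [set` iota 1 n]) xi i @^-1` F' i.
    by apply: eq_bigcapr => i /= /FF' ->.
  have pos i : i \in iota 1 n -> (0 < i)%N by rewrite mem_iota => /andP[].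
  have e1 := xi_indep _ F' (iota_uniq 1 n) pos mF'.
  have e2 := xi_indep (n.+1 :: iota 1 n) F'.
  rewrite FE e1; move: e2; rewrite /= nin iota_uniq big_cons => /(_ isT) e2.
  rewrite /F' eqxx -/F' in e2.
  rewrite -e2 //; last by move=> i; rewrite inE => /predU1P[->|/pos].
  congr (P _); apply/seteqP; split => [w [h1 h2] i|w h].
    rewrite /= inE => /predU1P[->|ii]; first by rewrite /F' eqxx.
    exact: h1.
  split; first by move=> i ii; apply: h; rewrite /= inE ii orbT.
  by have := h n.+1 (mem_head _ _); rewrite /= eqxx.
suff : m1 (S @^-1` A) = m2 (S @^-1` A).
  by rewrite /m1 /m2 /mrestr /mscale/= fineK ?pfin// muleC.
apply: (@g_sigma_algebra_measure_unique _ _ _ C sCm (fun=> setT)) => //.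
- move=> _; exists (fun=> setT); split => //.
  by apply/seteqP; split.
- by rewrite bigcup_const//; exists 0%N.
- exact: cylinders_setI_closed.
- move=> _; rewrite [ltLHS]/(P (setT `&` xi n.+1 @^-1` B)) setTI.
  exact: (le_lt_trans (probability_le1 P mV) (ltry 1)).
Qed.

End independence.

(** * Averaging a test function over a random shift *)

Section averaging.
Context d (T : measurableType d) (R : realType) (P : probability T R) (X : T -> R).
Implicit Types (g : R -> R) (K y h : R).

Definition smear g y : R := \int[P]_w g (y + X w).

Hypothesis mX : measurable_fun setT X.

Lemma measurable_shift g y : measurable_fun setT g ->
  measurable_fun setT (fun w => g (y + X w)).
Proof. by move=> mg; apply: (measurableT_comp mg); exact: measurable_funD. Qed.

Lemma smear_integrable g K y : measurable_fun setT g -> (forall x, `|g x| <= K) ->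
  P.-integrable setT (EFin \o (fun w => g (y + X w))).
Proof.
move=> mg gK; apply: (@bounded_integrable _ _ _ P _ K) => //.
exact: (measurable_shift y mg).
Qed.

Lemma smear_bounded g K y : measurable_fun setT g -> (forall x, `|g x| <= K) ->
  `|smear g y| <= K.
Proof.
move=> mg gK; have ig := smear_integrable y mg gK.
rewrite (le_trans (le_normr_Rintegral _ ig))//.
rewrite -[leRHS](Rintegral_cst1 P K); apply: le_Rintegral => //.
- exact: integrable_norm.
- exact: integrable_cst.
Qed.

(** Adding the bound [K] makes the integrand nonnegative, so that the results on
    nonnegative integrals (measurability in a parameter, convolution) apply to
    bounded functions of any sign. *)
Lemma integral_addr_smear g K y : measurable_fun setT g -> (forall x, `|g x| <= K) ->
  (\int[P]_w (g (y + X w) + K)%:E = (smear g y + K)%:E)%E.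
Proof.
move=> mg gK; have ig := smear_integrable y mg gK; have ik := integrable_cst P K.
have I : P.-integrable setT (EFin \o (fun w => g (y + X w) + K)).
  exact: (integrableDr ig ik).
have H := RintegralD measurableT ig ik.
rewrite Rintegral_cst1 in H; rewrite -[_ + K]H /Rintegral fineK//.
exact: (integrable_fin_num _ I).
Qed.

Lemma measurable_smear g K : measurable_fun setT g -> (forall x, `|g x| <= K) ->
  measurable_fun setT (smear g).
Proof.
move=> mg gK.
have mF : measurable_fun setT (fun yw : R * T => (g (yw.1 + X yw.2) + K)%:E).
  apply/measurable_EFinP; apply: measurable_funD => //.
  by apply: (measurableT_comp mg); apply: measurable_funD => //; exact: measurableT_comp.
have F0 (yw : R * T) : (0 <= (g (yw.1 + X yw.2) + K)%:E)%E.
  by rewrite lee_fin; have := gK (yw.1 + X yw.2); rewrite ler_norml => /andP[]; lra.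
have mG := @measurable_fun_fubini_tonelli_F _ _ _ _ _ P _ mF F0.
have -> : smear g = fun y =>
    fine (fubini_F P (fun yw : R * T => (g (yw.1 + X yw.2) + K)%:E) y) - K.
  apply/funext => y; rewrite /fubini_F/=.
  by have := integral_addr_smear y mg gK => ->; rewrite /= addrK.
by apply: measurable_funB => //; exact: measurableT_comp.
Qed.

(** The expansion of the average is the average of the expansions; the constant
    is unchanged, which is what allows an induction on the number of terms. *)
Lemma smooth3_smear K g g1 g2 : smooth3 K g g1 g2 ->
  smooth3 K (smear g) (smear g1) (smear g2).
Proof.
case=> -[mg mg1 mg2] bg tg.
have b0 x : `|g x| <= K by have [] := bg x.
have b1 x : `|g1 x| <= K by have [] := bg x.
have b2 x : `|g2 x| <= K by have [] := bg x.
split.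
- by split; [apply: measurable_smear b0|apply: measurable_smear b1|apply: measurable_smear b2].
- by move=> y; split; exact: smear_bounded.
move=> y h.
have i0 z := smear_integrable z mg b0; have i1 z := smear_integrable z mg1 b1.
have i2 z := smear_integrable z mg2 b2.
pose rem w := g (y + h + X w) - g (y + X w) - h * g1 (y + X w) - (h ^+ 2 / 2) * g2 (y + X w).
have I1 : P.-integrable setT (EFin \o (fun w => g (y + h + X w) - g (y + X w))).
  exact: integrableBr.
have I2 : P.-integrable setT (EFin \o (fun w => g (y + h + X w) - g (y + X w) - h * g1 (y + X w))).
  by apply: integrableBr => //; exact: integrable_scale.
have I : P.-integrable setT (EFin \o rem).
  by apply: integrableBr => //; exact: integrable_scale.
have E : \int[P]_w rem w =
    smear g (y + h) - smear g y - smear g1 y * h - smear g2 y * h ^+ 2 / 2.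
  rewrite RintegralB//; last exact: integrable_scale.
  rewrite RintegralB//; last exact: integrable_scale.
  by rewrite RintegralB// !RintegralZl// /smear; ring.
rewrite -E (le_trans (le_normr_Rintegral _ I))//.
rewrite -[leRHS](Rintegral_cst1 P); apply: le_Rintegral => //.
- exact: integrable_norm.
- exact: integrable_cst.
move=> x _; apply: le_trans (tg (y + X x) h); rewrite /rem (addrAC y h)  le_eqVlt; apply/orP; left.
by apply/eqP; congr (`| _ |); ring.
Qed.

End averaging.

Lemma smear_gauss_conv (R : realType) (g : R -> R) (K s t y : R) : 0 <= s -> 0 <= t ->
  measurable_fun setT g -> (forall x, `|g x| <= K) ->
  smear (gauss s) id (smear (gauss t) id g) y =
  smear (gauss (Num.sqrt (s ^+ 2 + t ^+ 2))) id g y.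
Proof.
move=> s0 t0 mg gK.
have mid : measurable_fun [set: measurableTypeR R] (@id R) by exact: measurable_id.
have mf : measurable_fun setT (fun x : R => (g (y + x) + K)%:E).
  apply/measurable_EFinP; apply: measurable_funD => //; exact: (measurable_shift mid).
have f0 x : (0 <= (g (y + x) + K)%:E)%E.
  by rewrite lee_fin; have := gK (y + x); rewrite ler_norml => /andP[]; lra.
have := ge0_gauss_conv s0 t0 mf f0.
move: (gauss (Num.sqrt _)) (gauss s) (gauss t) => rho mu nu H.
have bg x : `|smear nu id g x| <= K by exact: smear_bounded.
have mtg := measurable_smear nu mid mg gK.
apply: (@addIr _ K); apply: EFin_inj.
rewrite -(integral_addr_smear mu mid y mtg bg).
rewrite -(integral_addr_smear rho mid y mg gK) -H.
apply: eq_integral => a _; rewrite -(integral_addr_smear nu mid (y + a) mg gK).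
by apply: eq_integral => b _; rewrite addrA.
Qed.

(** * Lindeberg's replacement of the terms by Gaussian variables *)

Section lindeberg.
Context d (T : measurableType d) (R : realType) (P : probability T R).
Implicit Types (X : T -> R) (g : R -> R) (K y s : R).

Lemma integrable_min23 X : measurable_fun setT X ->
  P.-integrable setT (EFin \o (fun w => X w ^+ 2)) ->
  P.-integrable setT (EFin \o (fun w => min23 (X w))).
Proof.
move=> mX; apply: dominated_integrable.
  exact: (measurableT_comp measurable_min23).
by move=> x; rewrite ger0_norm ?min23_ge0// min23_le2.
Qed.

(** For a centred variable, the average of [g] depends on the law only through
    the second moment, up to the remainder. *)
Lemma second_order_expansion X K g g1 g2 y : measurable_fun setT X ->
  P.-integrable setT (EFin \o X) ->
  P.-integrable setT (EFin \o (fun w => X w ^+ 2)) ->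
  \int[P]_w X w = 0 -> smooth3 K g g1 g2 ->
  `|smear P X g y - g y - (\int[P]_w (X w ^+ 2)) / 2 * g2 y| <=
  4 * K * \int[P]_w min23 (X w).
Proof.
move=> mX iX iX2 X0 gs; have [[mg _ _] bg _] := gs.
have ig : P.-integrable setT (EFin \o (fun w => g (y + X w))).
  apply: (@bounded_integrable _ _ _ P _ K); last by move=> w; have [] := bg (y + X w).
  exact: measurable_shift.
have ic := integrable_cst P (g y).
have i1 : P.-integrable setT (EFin \o (fun w => g (y + X w) - cst (g y) w)).
  exact: integrableBr.
have i2 : P.-integrable setT (EFin \o
    (fun w => g (y + X w) - cst (g y) w - g1 y * X w)).
  by apply: integrableBr => //; exact: integrable_scale.
have i3 : P.-integrable setT (EFin \o
    (fun w => g (y + X w) - cst (g y) w - g1 y * X w - (g2 y / 2) * X w ^+ 2)).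
  by apply: integrableBr => //; exact: integrable_scale.
have im := integrable_min23 mX iX2.
have E : \int[P]_w (g (y + X w) - cst (g y) w - g1 y * X w - (g2 y / 2) * X w ^+ 2) =
    smear P X g y - g y - (\int[P]_w (X w ^+ 2)) / 2 * g2 y.
  rewrite RintegralB//; last exact: integrable_scale.
  rewrite RintegralB//; last exact: integrable_scale.
  by rewrite RintegralB// !RintegralZl// Rintegral_cst1 X0 /smear; ring.
rewrite -E (le_trans (le_normr_Rintegral _ i3))// -RintegralZl//.
apply: le_Rintegral => //.
- exact: integrable_norm.
- exact: integrable_scale.
move=> w _; apply: le_trans (smooth3_min23 y (X w) gs).
rewrite le_eqVlt; apply/orP; left; apply/eqP; congr (`| _ |); rewrite /cst.
by ring.
Qed.

End lindeberg.

Section gauss_min23.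
Context {R : realType}.
Implicit Types (s : R).

Lemma normal_cube_const_ge1 : 1 <= @normal_cube_const R.
Proof.
rewrite /normal_cube_const; have := @expR_ge1Dx R 2^-1; lra.
Qed.

Lemma gauss_min23 s : 0 <= s ->
  \int[gauss s]_x min23 x <= normal_cube_const * min23 s.
Proof.
move=> s0; have [_ m2 m3] := gauss_moments s0.
have i2 := integrable_gauss_sqr s0; have i3 := integrable_gauss_cube s0.
have im : (gauss s).-integrable setT (EFin \o (@min23 R)).
  exact: (@integrable_min23 _ _ _ (gauss s) id).
have h2 : \int[gauss s]_x min23 x <= normal_cube_const * s ^+ 2.
  apply: (@le_trans _ _ (s ^+ 2)).
    by rewrite -m2; apply: le_Rintegral => // x _; exact: min23_le2.
  by rewrite ler_peMl ?sqr_ge0// normal_cube_const_ge1.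
have h3 : \int[gauss s]_x min23 x <= normal_cube_const * s ^+ 3.
  by apply: le_trans m3; apply: le_Rintegral => // x _; exact: min23_le3.
by rewrite {2}/min23 ger0_norm//; case: (leP (s ^+ 2) (s ^+ 3)).
Qed.

End gauss_min23.

Section lindeberg_sum.
Context d (T : measurableType d) (R : realType) (P : probability T R).
Variable xi : nat -> {RV P >-> R}.
Hypothesis xi_indep : mutually_independent [set n | (0 < n)%N] xi.
Hypothesis xi_int : forall j, (0 < j)%N -> P.-integrable setT (EFin \o xi j).
Hypothesis xi_sqr : forall j, (0 < j)%N ->
  P.-integrable setT (EFin \o (fun w => xi j w ^+ 2)).
Hypothesis xi_mean : forall j, (0 < j)%N -> \int[P]_w xi j w = 0.
Variable a : nat -> R.

Definition weighted_sum (n : nat) (w : T) : R := \sum_(1 <= j < n.+1) a j * xi j w.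
Definition second_moment (j : nat) : R := \int[P]_w (xi j w ^+ 2).
Definition weighted_variance (n : nat) : R :=
  \sum_(1 <= j < n.+1) a j ^+ 2 * second_moment j.

Lemma second_moment_ge0 j : 0 <= second_moment j.
Proof. by apply: Rintegral_ge0 => w _; exact: sqr_ge0. Qed.

Lemma weighted_variance_ge0 n : 0 <= weighted_variance n.
Proof.
by apply: sumr_ge0 => j _; rewrite mulr_ge0 ?sqr_ge0 ?second_moment_ge0.
Qed.

Lemma measurable_weighted_sum n : measurable_fun setT (weighted_sum n).
Proof. by apply: measurable_sum => j; exact: measurable_funM. Qed.

Lemma weighted_sumS n w : weighted_sum n.+1 w = weighted_sum n w + a n.+1 * xi n.+1 w.
Proof. by rewrite /weighted_sum big_nat_recr. Qed.

Let term_sd j := `|a j| * Num.sqrt (second_moment j).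

(** Induction on [n], the last term being replaced first.  By independence the
    average over the last term is a smear of [g]; it differs from the smear by
    the Gaussian law of the same variance by two remainders of
    [second_order_expansion].  The smeared function is again a test function with
    the same constant, so the induction hypothesis treats the other terms, and the
    Gaussian smears compose by [smear_gauss_conv]. *)
Lemma lindeberg_swapping n K g g1 g2 y : smooth3 K g g1 g2 ->
  `|\int[P]_w g (y + weighted_sum n w)
    - smear (gauss (Num.sqrt (weighted_variance n))) id g y| <=
  4 * K * \sum_(1 <= j < n.+1)
    (\int[P]_w min23 (a j * xi j w) + normal_cube_const * min23 (term_sd j)).
Proof.
elim: n => [|n IH] in K g g1 g2 y *.
  move=> gs; rewrite /weighted_sum /weighted_variance !big_geq// sqrtr0 mulr0.
  have [[mg _ _] _ _] := gs.
  have mid : measurable_fun [set: measurableTypeR R] (@id R) by exact: measurable_id.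
  under eq_Rintegral do rewrite big_geq//.
  rewrite /smear Rintegral_gauss0; last exact: (measurable_shift mid).
  by rewrite (Rintegral_cst1 P (g (y + 0))) subrr normr0.
move=> gs; have [[mg mg1 mg2] bg tg] := gs.
have bg0 x : `|g x| <= K by have [] := bg x.
set s := term_sd n.+1; have s0 : 0 <= s by rewrite mulr_ge0 ?sqrtr_ge0.
have mid : measurable_fun [set: measurableTypeR R] (@id R) by exact: measurable_id.
have gs' := smooth3_smear (gauss s) mid gs.
set X := fun w => a n.+1 * xi n.+1 w.
have mX : measurable_fun setT X by exact: measurable_funM.
have iX : P.-integrable setT (EFin \o X) by apply: integrable_scale; exact: xi_int.
have XE : (fun w => X w ^+ 2) = (fun w => a n.+1 ^+ 2 * xi n.+1 w ^+ 2).
  by apply/funext => w; rewrite exprMn.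
have iX2 : P.-integrable setT (EFin \o (fun w => X w ^+ 2)).
  by rewrite XE; apply: integrable_scale; exact: xi_sqr.
have X0 : \int[P]_w X w = 0 by rewrite RintegralZl ?xi_int// xi_mean// mulr0.
have X2 : \int[P]_w (X w ^+ 2) = s ^+ 2.
  rewrite XE RintegralZl ?xi_sqr// /s /term_sd exprMn sqr_sqrtr ?second_moment_ge0//.
  by rewrite real_normK ?num_real.
have [G1 G2 _] := gauss_moments s0.
set D := \int[P]_w min23 (X w) + normal_cube_const * min23 s.
have K0 := smooth3_ge0 gs.
have swap z : `|smear P X g z - smear (gauss s) id g z| <= 4 * K * D.
  have e1 := second_order_expansion z mX iX iX2 X0 gs.
  have e2 := @second_order_expansion _ _ _ (gauss s) id _ _ _ _ z mid
    (integrable_gauss_id s0) (integrable_gauss_sqr s0) G1 gs.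
  have e3 : 4 * K * \int[gauss s]_x min23 x <= 4 * K * (normal_cube_const * min23 s).
    by rewrite ler_wpM2l ?mulr_ge0// gauss_min23.
  move: e1 e2; rewrite X2 /= G2 => e1 e2.
  rewrite /D mulrDr; set u := smear P X g z in e1 *; set v := smear (gauss s) _ _ _ in e2 *.
  have -> : u - v = (u - g z - s ^+ 2 / 2 * g2 z) - (v - g z - s ^+ 2 / 2 * g2 z).
    by ring.
  rewrite (le_trans (ler_normB _ _))// lerD//.
  by apply: le_trans e3.
rewrite big_nat_recr//= -/D mulrDr.
have vS : Num.sqrt (weighted_variance n.+1) =
    Num.sqrt (Num.sqrt (weighted_variance n) ^+ 2 + s ^+ 2).
  rewrite sqr_sqrtr ?weighted_variance_ge0// /weighted_variance big_nat_recr//=.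
  rewrite /s /term_sd exprMn sqr_sqrtr ?second_moment_ge0//.
  by rewrite real_normK ?num_real.
rewrite vS -(smear_gauss_conv y _ s0 mg bg0) ?sqrtr_ge0//.
have indep := mutually_independent_partial_sum a n xi_indep.
pose F (sv : R * R) := g (y + sv.1 + a n.+1 * sv.2).
have mF : measurable_fun setT F.
  apply: (measurableT_comp mg); apply: measurable_funD; last exact: measurable_funM.
  exact: measurable_funD.
have mSn := measurable_weighted_sum n.
have iF : P.-integrable setT (EFin \o (fun w => F (weighted_sum n w, xi n.+1 w))).
  apply: (@bounded_integrable _ _ _ P _ K); last by move=> w; exact: bg0.
  by apply: (measurableT_comp mF); exact: measurable_fun_pair.
have iFx x : P.-integrable setT (EFin \o (fun v => F (x, xi n.+1 v))).
  apply: (@bounded_integrable _ _ _ P _ K); last by move=> w; exact: bg0.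
  by apply: (measurableT_comp mF); exact: measurable_fun_pair.
have mxi : measurable_fun setT (xi n.+1) by [].
have EF := independent_pair_integral mSn mxi indep mF iF iFx.
have -> : \int[P]_w g (y + weighted_sum n.+1 w) =
    \int[P]_w F (weighted_sum n w, xi n.+1 w).
  by apply: eq_Rintegral => w _; rewrite weighted_sumS addrA.
rewrite EF.
have {}IH := IH _ _ _ _ y gs'.
pose U := smear P X g; pose V := smear (gauss s) id g.
have mU : measurable_fun setT U by exact: (measurable_smear P mX mg bg0).
have mV : measurable_fun setT V by exact: (measurable_smear _ mid mg bg0).
have mz : measurable_fun setT (fun w => y + weighted_sum n w).
  exact: measurable_funD.
have iU : P.-integrable setT (EFin \o (fun w => U (y + weighted_sum n w))).
  apply: (@bounded_integrable _ _ _ P _ K); first exact: (measurableT_comp mU).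
  by move=> w; exact: (smear_bounded P mX).
have iV : P.-integrable setT (EFin \o (fun w => V (y + weighted_sum n w))).
  apply: (@bounded_integrable _ _ _ P _ K); first exact: (measurableT_comp mV).
  by move=> w; exact: (smear_bounded _ mid).
have iUV : P.-integrable setT (EFin \o
    (fun w => U (y + weighted_sum n w) - V (y + weighted_sum n w))).
  exact: integrableBr.
have d1 : `|\int[P]_w U (y + weighted_sum n w) - \int[P]_w V (y + weighted_sum n w)|
    <= 4 * K * D.
  rewrite -RintegralB// (le_trans (le_normr_Rintegral _ iUV))//.
  rewrite -[leRHS](Rintegral_cst1 P); apply: le_Rintegral => //.
  - exact: integrable_norm.
  - exact: integrable_cst.
rewrite -(subrKA (\int[P]_w V (y + weighted_sum n w))) [leRHS]addrC.
by rewrite (le_trans (ler_normD _ _))// lerD.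
Qed.

(** The cross terms vanish by independence and centring. *)
Lemma weighted_sum_moments n : [/\
  P.-integrable setT (EFin \o weighted_sum n),
  P.-integrable setT (EFin \o (fun w => weighted_sum n w ^+ 2)),
  \int[P]_w weighted_sum n w = 0 &
  \int[P]_w (weighted_sum n w ^+ 2) = weighted_variance n].
Proof.
elim: n => [|n [i1 i2 m1 m2]].
  have -> : weighted_sum 0 = cst 0.
    by apply/funext => w; rewrite /weighted_sum big_geq.
  have sq : (fun w : T => cst (0 : R) w ^+ 2) = cst 0.
    by apply/funext => w; rewrite /cst expr0n.
  split; rewrite ?sq ?Rintegral_cst1//; [exact: integrable_cst|exact: integrable_cst|].
  by rewrite /weighted_variance big_geq.
have ix := xi_int (ltn0Sn n); have ix2 := xi_sqr (ltn0Sn n).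
have mS := measurable_weighted_sum n.
have mx : measurable_fun setT (xi n.+1) by [].
have iax : P.-integrable setT (EFin \o (fun w => a n.+1 * xi n.+1 w)).
  exact: integrable_scale.
have iax2 : P.-integrable setT (EFin \o (fun w => a n.+1 ^+ 2 * xi n.+1 w ^+ 2)).
  exact: integrable_scale.
have isx : P.-integrable setT (EFin \o (fun w => weighted_sum n w * xi n.+1 w)).
  apply: (@dominated_integrable _ _ _ P _
      (fun w => weighted_sum n w ^+ 2 + xi n.+1 w ^+ 2)).
  - exact: measurable_funM.
  - move=> w; rewrite normrM -(real_normK (num_real (weighted_sum n w))).
    rewrite -(real_normK (num_real (xi n.+1 w))).
    have := sqr_ge0 (`|weighted_sum n w| - `|xi n.+1 w|).
    have := sqr_ge0 `|weighted_sum n w|; have := sqr_ge0 `|xi n.+1 w|.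
    by rewrite sqrrB; lra.
  - exact: integrableDr.
have cross : \int[P]_w (weighted_sum n w * xi n.+1 w) = 0.
  have indep := mutually_independent_partial_sum a n xi_indep.
  rewrite (@independent_pair_integral _ _ _ P _ _ (fun sx => sx.1 * sx.2) mS mx indep)//.
  - under eq_Rintegral do rewrite RintegralZl// xi_mean// mulr0.
    exact: (Rintegral_cst1 P 0).
  - exact: measurable_funM.
  - by move=> x /=; exact: integrable_scale.
have i2ax : P.-integrable setT
    (EFin \o (fun w => 2 * a n.+1 * (weighted_sum n w * xi n.+1 w))).
  exact: integrable_scale.
have sqE : (fun w => weighted_sum n.+1 w ^+ 2) = (fun w => weighted_sum n w ^+ 2 +
    2 * a n.+1 * (weighted_sum n w * xi n.+1 w) + a n.+1 ^+ 2 * xi n.+1 w ^+ 2).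
  by apply/funext => w; rewrite weighted_sumS; ring.
have SE : weighted_sum n.+1 = (fun w => weighted_sum n w + a n.+1 * xi n.+1 w).
  by apply/funext => w; rewrite weighted_sumS.
have i3 : P.-integrable setT (EFin \o (fun w => weighted_sum n w ^+ 2 +
    2 * a n.+1 * (weighted_sum n w * xi n.+1 w))).
  exact: integrableDr.
split.
- by rewrite SE; exact: integrableDr.
- by rewrite sqE; exact: integrableDr.
- by rewrite SE RintegralD// RintegralZl// xi_mean// mulr0 addr0.
rewrite sqE RintegralD// RintegralD// !RintegralZl// cross mulr0 addr0 m2.
by rewrite [in RHS]/weighted_variance big_nat_recr.
Qed.

End lindeberg_sum.

(** Use the cubic bound for [`|h| <= e] and the quadratic one, improved by the
    factor [(`|h| / e) `^ (p - 2)], otherwise. *)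
Lemma min23_le_powR (R : realType) (p e h : R) : 2 < p -> 0 < e ->
  min23 h <= e * h ^+ 2 + e `^ (2 - p) * `|h| `^ p.
Proof.
move=> p2 e0; have [he|he] := leP `|h| e.
  rewrite (le_trans (min23_le3 h))// -[leLHS]addr0 lerD//.
    by rewrite exprS real_normK ?num_real// ler_wpM2r// sqr_ge0.
  by rewrite mulr_ge0// powR_ge0.
have h0 : 0 < `|h| by exact: lt_trans he.
rewrite (le_trans (min23_le2 h))// -[leLHS]add0r lerD//.
  by rewrite mulr_ge0 ?sqr_ge0// ltW.
have -> : `|h| `^ p = h ^+ 2 * `|h| `^ (p - 2).
  have pE : p = (p - 2) + 2 by rewrite subrK.
  rewrite [in LHS]pE (@powRD _ _ (p - 2) 2); last by rewrite (lt0r_neq0 h0) implybT.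
  by rewrite mulrC powR_mulrn// real_normK ?num_real.
rewrite mulrCA ler_peMr ?sqr_ge0//.
have -> : 2 - p = - (p - 2) by ring.
rewrite powRN mulrC ler_pdivlMr ?powR_gt0// mul1r.
by apply: ge0_ler_powR; rewrite ?nnegrE ?ltW// subr_gt0.
Qed.

(** * Central limit theorem under Lyapunov's condition *)

Section cosine_truncation.
Context {R : realType}.
Implicit Types (u y L : R).

Lemma normr_sin_le u : `|sin u| <= `|u|.
Proof.
rewrite -[leRHS]mul1r -[X in _ <= _ * X]expr1.
apply: (@bound_of_derive_bound R sin cos 1 0%N `|u|) => //.
- exact: sin0.
- by move=> t _; rewrite expr0 mulr1 ler_norml cos_geN1 cos_le1.
Qed.

Lemma one_sub_cos_le u : 1 - cos u <= u ^+ 2 / 2.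
Proof.
have -> : 1 - cos u = 2 * sin (u / 2) ^+ 2.
  have {1}-> : u = (u / 2) *+ 2 by rewrite -mulr_natr; field.
  rewrite cos_mulr2n; have := cos2Dsin2 (u / 2).
  by move=> h; rewrite -mulr_natr; lra.
have h : sin (u / 2) ^+ 2 <= (u / 2) ^+ 2.
  rewrite -(real_normK (num_real (sin _))) -(real_normK (num_real (u / 2))).
  by rewrite lerXn2r ?nnegrE//; exact: normr_sin_le.
by rewrite exprMn in h; lra.
Qed.

(** A bounded minorant of the square function, close to it near the origin. *)
Definition cos_square L y : R := 2 * L ^+ 2 - 2 * L ^+ 2 * cos (L^-1 * y).

Lemma cos_square_le L y : cos_square L y <= 4 * L ^+ 2.
Proof.
have := cos_geN1 (L^-1 * y); have := sqr_ge0 L; rewrite /cos_square; nra.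
Qed.

Lemma cos_square_le_sqr L y : 0 < L -> cos_square L y <= y ^+ 2.
Proof.
move=> L0; have := one_sub_cos_le (L^-1 * y).
have L2 : 0 < 2 * L ^+ 2 by rewrite mulr_gt0 ?exprn_gt0.
rewrite -(ler_pM2l L2) mulrBr mulr1 -/(cos_square L y) => h.
rewrite (le_trans h)// le_eqVlt; apply/orP; left; apply/eqP.
by field; rewrite gt_eqF.
Qed.

Lemma cos_square_ge L y : 0 < L -> y ^+ 2 - 2 / L * `|y| ^+ 3 <= cos_square L y.
Proof.
move=> L0; have := cos_taylor2 0 (L^-1 * y).
rewrite add0r cos0 sin0 mul0r addr0 mul1r normrM normfV (gtr0_norm L0).
move=> /ler_normlP[_ h].
have L2 : 0 < 2 * L ^+ 2 by rewrite mulr_gt0 ?exprn_gt0.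
rewrite -(ler_pM2l L2) in h; rewrite /cos_square.
have e1 : 2 * L ^+ 2 * (L^-1 * `|y|) ^+ 3 = 2 / L * `|y| ^+ 3.
  by field; rewrite gt_eqF.
have e2 : 2 * L ^+ 2 * (cos (L^-1 * y) - 1 + (L^-1 * y) ^+ 2 / 2) =
    2 * L ^+ 2 * cos (L^-1 * y) - 2 * L ^+ 2 + y ^+ 2.
  by field; rewrite gt_eqF.
by rewrite e1 e2 in h; lra.
Qed.

Lemma smooth3_cos_square L : 0 < L ->
  exists K g1 g2, smooth3 K (cos_square L) g1 g2.
Proof.
move=> L0; have Li : 0 < L^-1 by rewrite invr_gt0.
have := @smooth3_affine R _ _ _ _ (2 * L ^+ 2) (- (2 * L ^+ 2)) L^-1 0 smooth3_cos Li.
rewrite (_ : (fun y => _) = cos_square L); last first.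
  by apply/funext => y; rewrite addr0 mulNr.
by move=> h; do 3 eexists; exact: h.
Qed.

End cosine_truncation.

Section clt.
Context d (T : measurableType d) (R : realType) (P : probability T R).
Variable xi : nat -> {RV P >-> R}.
Hypothesis xi_indep : mutually_independent [set n | (0 < n)%N] xi.
Hypothesis xi_int : forall j, (0 < j)%N -> P.-integrable setT (EFin \o xi j).
Hypothesis xi_sqr : forall j, (0 < j)%N ->
  P.-integrable setT (EFin \o (fun w => xi j w ^+ 2)).
Hypothesis xi_mean : forall j, (0 < j)%N -> \int[P]_w xi j w = 0.
Variables (p C : R).
Hypothesis p_gt2 : 2 < p.
Hypothesis C_ge0 : 0 <= C.
Hypothesis xi_powp : forall j, (0 < j)%N ->
  P.-integrable setT (EFin \o (fun w => `|xi j w| `^ p)).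
Hypothesis xi_normp : forall j, (0 < j)%N -> \int[P]_w (`|xi j w| `^ p) <= C `^ p.
Hypothesis xi_norm2 : forall j, (0 < j)%N -> second_moment xi j <= C ^+ 2.

(** Each remainder of the replacement is split by [min23_le_powR]: the quadratic
    parts sum to [e] times the total variance, and the other parts to a multiple of
    Lyapunov's sum. *)
Lemma lyapunov_bound (a : nat -> R) n K g g1 g2 (e : R) :
  smooth3 K g g1 g2 -> 0 < e -> weighted_variance xi a n = 1 ->
  `|\int[P]_w g (weighted_sum xi a n w) - \int[gauss 1]_x g x| <=
  4 * K * ((1 + normal_cube_const) *
    (e + e `^ (2 - p) * C `^ p * \sum_(1 <= j < n.+1) `|a j| `^ p)).
Proof.
move=> gs e0 v1.
have := lindeberg_swapping xi_indep xi_int xi_sqr xi_mean a n 0 gs.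
rewrite v1 sqrtr1.
have -> : \int[P]_w g (0 + weighted_sum xi a n w) = \int[P]_w g (weighted_sum xi a n w).
  by apply: eq_Rintegral => w _; rewrite add0r.
have -> : smear (gauss 1) id g 0 = \int[gauss 1]_x g x.
  by apply: eq_Rintegral => w _; rewrite add0r.
move=> h; apply: (le_trans h); have K0 := smooth3_ge0 gs.
rewrite ler_wpM2l ?mulr_ge0//.
pose b j := e * (a j ^+ 2 * second_moment xi j) + e `^ (2 - p) * C `^ p * `|a j| `^ p.
have -> : (1 + normal_cube_const) *
    (e + e `^ (2 - p) * C `^ p * \sum_(1 <= j < n.+1) `|a j| `^ p) =
    \sum_(1 <= j < n.+1) (b j + normal_cube_const * b j).
  have bE : \sum_(1 <= j < n.+1) b j =
      e + e `^ (2 - p) * C `^ p * \sum_(1 <= j < n.+1) `|a j| `^ p.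
    by rewrite /b big_split/= -!mulr_sumr -/(weighted_variance xi a n) v1 mulr1.
  by rewrite big_split/= -mulr_sumr bE; ring.
have pM x y : 0 <= x -> 0 <= y -> (x * y) `^ p = x `^ p * y `^ p by exact: powRM.
have ep0 : 0 <= e `^ (2 - p) by exact: powR_ge0.
rewrite big_nat [leRHS]big_nat; apply: ler_sum => j /andP[j0 _].
apply: lerD.
  have ix2 : P.-integrable setT (EFin \o (fun w => (a j * xi j w) ^+ 2)).
    have -> : (fun w => (a j * xi j w) ^+ 2) = (fun w => a j ^+ 2 * xi j w ^+ 2).
      by apply/funext => w; rewrite exprMn.
    by apply: integrable_scale; exact: xi_sqr.
  have E1 : \int[P]_w (e * a j ^+ 2 * (xi j w ^+ 2) +
      e `^ (2 - p) * `|a j| `^ p * (`|xi j w| `^ p)) <= b j.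
    rewrite RintegralD//; last 2 first.
    - by apply: integrable_scale; exact: xi_sqr.
    - by apply: integrable_scale; exact: xi_powp.
    rewrite !RintegralZl ?xi_sqr ?xi_powp// /b -mulrA lerD2l.
    rewrite -!mulrA ler_wpM2l// mulrC ler_wpM2r ?powR_ge0//.
    exact: xi_normp.
  apply: le_trans E1; apply: le_Rintegral => //.
  - by apply: integrable_min23 => //; exact: measurable_funM.
  - by apply: integrableDr; apply: integrable_scale; [exact: xi_sqr|exact: xi_powp].
  move=> w _; have := min23_le_powR (a j * xi j w) p_gt2 e0.
  by rewrite exprMn normrM pM// !mulrA.
rewrite ler_wpM2l ?(le_trans ler01 normal_cube_const_ge1)//.
have m0 := second_moment_ge0 xi j.
apply: (le_trans (min23_le_powR _ p_gt2 e0)).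
rewrite normrM normr_id pM// (ger0_norm (sqrtr_ge0 _)) exprMn sqr_sqrtr//.
rewrite real_normK ?num_real// /b lerD2l -mulrA ler_wpM2l// mulrC.
rewrite ler_wpM2r ?powR_ge0//; apply: ge0_ler_powR; rewrite ?nnegrE ?sqrtr_ge0//.
  by rewrite (le_trans _ (ltW p_gt2)).
rewrite -(ger0_norm C_ge0) -sqrtr_sqr ler_sqrt ?sqr_ge0//.
exact: xi_norm2.
Qed.

Lemma lyapunov_clt (a : nat -> nat -> R) (n : nat -> nat) K g g1 g2 :
  (forall k, weighted_variance xi (a k) (n k) = 1) ->
  \sum_(1 <= j < (n k).+1) `|a k j| `^ p @[k --> \oo] --> (0 : R) ->
  smooth3 K g g1 g2 ->
  \int[P]_w g (weighted_sum xi (a k) (n k) w) @[k --> \oo] --> \int[gauss 1]_x g x.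
Proof.
move=> v1 rho0 gs; have K0 := smooth3_ge0 gs.
have A1 := @normal_cube_const_ge1 R; pose A := @normal_cube_const R.
rewrite -/A in A1.
apply/cvgrPdist_le => e e0.
pose e' := e / (8 * (K + 1) * (1 + A)).
have D0 : 0 < 8 * (K + 1) * (1 + A) by rewrite !mulr_gt0//; lra.
have e'0 : 0 < e' by rewrite divr_gt0.
have cv : e' `^ (2 - p) * C `^ p * (\sum_(1 <= j < (n k).+1) `|a k j| `^ p)
    @[k --> \oo] --> (0 : R).
  by rewrite -[X in _ --> X](mulr0 (e' `^ (2 - p) * C `^ p)); apply: cvgM => //; exact: cvg_cst.
move/cvgrPdist_le : cv => /(_ _ e'0); apply: filterS => k.
rewrite sub0r normrN => h; rewrite distrC.
apply: (le_trans (lyapunov_bound gs e'0 (v1 k))).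
have h' := le_trans (ler_norm _) h.
have -> : e = 4 * (K + 1) * ((1 + A) * (e' + e')).
  by rewrite /e'; field; rewrite !gt_eqF//; lra.
rewrite -/A; apply: ler_pM; rewrite ?mulr_ge0//.
- lra.
- by rewrite addr_ge0 ?(ltW e'0)// !mulr_ge0 ?powR_ge0// sumr_ge0// => j _; exact: powR_ge0.
- by rewrite ler_wpM2l// lerDl.
- by rewrite ler_wpM2l// ?lerD2l//; lra.
Qed.

End clt.

(** Convergence of the laws together with the equality of the second moments gives
    uniform integrability of the squares: the bounded test function [cos_square L]
    captures almost all of the second moment of the Gaussian law, hence of [W k],
    so what remains of [W k ^+ 2] is small in mean. *)
Section uniform_integrability.
Context d (T : measurableType d) (R : realType) (P : probability T R).
Variable W : nat -> T -> R.
Hypothesis mW : forall k, measurable_fun setT (W k).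
Hypothesis iW2 : forall k, P.-integrable setT (EFin \o (fun w => W k w ^+ 2)).
Hypothesis W2 : forall k, \int[P]_w (W k w ^+ 2) = 1.
Hypothesis clt : forall K g g1 g2, smooth3 K g g1 g2 ->
  \int[P]_w g (W k w) @[k --> \oo] --> \int[gauss 1]_x g x.

Lemma uniform_integrability (e : R) : 0 < e -> exists2 eta : R, 0 < eta &
  \forall k \near \oo, forall A, measurable A -> \int[P]_w \1_A w <= eta ->
    \int[P]_w (W k w ^+ 2 * \1_A w) <= e.
Proof.
move=> e0; set c := @normal_cube_const R.
have c1 : 1 <= c := normal_cube_const_ge1.
(* this [L] makes the part of the Gaussian second moment missed by [psi], at
   most [2 * c / L], smaller than [e / 2] with room for the convergence *)
pose L := 6 * c / e; have L0 : 0 < L by rewrite divr_gt0// mulr_gt0//; lra.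
pose psi := @cos_square R L.
exists (e / (8 * L ^+ 2)); first by rewrite divr_gt0// mulr_gt0// exprn_gt0.
have [K [g1 [g2 gs]]] := smooth3_cos_square L0.
have [[mpsi _ _] bpsi _] := gs.
have [_ m2 m3] := @gauss_moments R 1 ler01.
have i2 := @integrable_gauss_sqr R 1 ler01; have i3 := @integrable_gauss_cube R 1 ler01.
have Z : 1 - 2 * c / L <= \int[gauss 1]_x psi x.
  have ipsi : (gauss 1).-integrable setT (EFin \o psi).
    by apply: (@bounded_integrable _ _ _ (gauss 1) _ K) => // y; have [] := bpsi y.
  have i23 : (gauss 1).-integrable setT
      (EFin \o (fun x : R => x ^+ 2 - 2 / L * `|x| ^+ 3)).
    by apply: integrableBr => //; exact: integrable_scale.
  apply: (@le_trans _ _ (\int[gauss 1]_x (x ^+ 2 - 2 / L * `|x| ^+ 3))).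
    rewrite RintegralB//; last exact: integrable_scale.
    rewrite RintegralZl// m2 expr1n lerD2l lerN2 mulrAC.
    rewrite expr1n mulr1 in m3.
    by rewrite ler_wpM2r ?invr_ge0 ?(ltW L0)// ler_wpM2l.
  by apply: le_Rintegral => // x _; exact: cos_square_ge.
have cL : 3 * c / L = e / 2.
  by rewrite /L; field; rewrite !gt_eqF//; lra.
have cL0 : 0 < c / L by rewrite divr_gt0//; lra.
have near1 : \forall k \near \oo, 1 - 3 * c / L <= \int[P]_w psi (W k w).
  have /cvgrPdist_le/(_ _ cL0) := clt gs.
  apply: filterS => k /ler_normlP[_]; rewrite -/psi.
  by move: Z; rewrite -!mulrA; lra.
move: near1; apply: filterS => k hk A mA PA.
have mpW : measurable_fun setT (fun w => psi (W k w)).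
  exact: (measurableT_comp mpsi).
have ipW : P.-integrable setT (EFin \o (fun w => psi (W k w))).
  by apply: (@bounded_integrable _ _ _ P _ K) => // w; have [] := bpsi (W k w).
have iA : P.-integrable setT (EFin \o (\1_A : T -> R)).
  apply: (@bounded_integrable _ _ _ P _ 1) => // w.
  by rewrite indicE; case: (_ \in _); rewrite ?normr1 ?normr0.
have i4 : P.-integrable setT (EFin \o (fun w => 4 * L ^+ 2 * \1_A w)).
  exact: integrable_scale.
have i5 : P.-integrable setT (EFin \o (fun w => W k w ^+ 2 - psi (W k w))).
  exact: integrableBr.
apply: (@le_trans _ _ (\int[P]_w (4 * L ^+ 2 * \1_A w + (W k w ^+ 2 - psi (W k w))))).
  apply: le_Rintegral => //.
  - apply: (@dominated_integrable _ _ _ P _ (fun w => W k w ^+ 2)) => //.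
      by apply: measurable_funM => //; exact: measurable_funX.
    move=> w; rewrite indicE; case: (_ \in _); rewrite ?mulr1 ?mulr0 ?normr0 ?sqr_ge0//.
    by rewrite ger0_norm// sqr_ge0.
  - exact: integrableDr.
  move=> w _; have h1 := cos_square_le L (W k w); have h2 := cos_square_le_sqr (W k w) L0.
  rewrite indicE; case: (_ \in _); rewrite ?mulr1 ?mulr0 ?add0r ?subr_ge0// -/psi.
  by rewrite /psi; lra.
rewrite RintegralD// RintegralZl// RintegralB// W2.
have : 4 * L ^+ 2 * \int[P]_w \1_A w <= e / 2.
  have L2 : 0 < L ^+ 2 by rewrite exprn_gt0.
  apply: (@le_trans _ _ (4 * L ^+ 2 * (e / (8 * L ^+ 2)))).
    by rewrite ler_wpM2l// mulr_ge0// ltW.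
  by rewrite le_eqVlt; apply/orP; left; apply/eqP; field; rewrite gt_eqF.
lra.
Qed.

End uniform_integrability.

(** * Convergence of distribution functions *)

Section ramp.
Context {R : realType}.
Implicit Types (u dl y : R).

(** A test function between the indicators of the half-lines ending at [u] and at
    [u + 3 * dl]. *)
Definition ramp u dl y : R := 1 - step (dl^-1 * (y - u)).

Lemma ramp_bounds u dl y : 0 <= ramp u dl y <= 1.
Proof.
rewrite /ramp; have /andP[h1 h2] := step_bounds (dl^-1 * (y - u)).
by apply/andP; split; lra.
Qed.

Lemma indic_le_ramp u dl y : 0 < dl ->
  \1_[set z | z <= u] y <= ramp u dl y.
Proof.
move=> d0; rewrite indicE; case: (boolP (_ \in _)) => [|_]; last by case/andP: (ramp_bounds u dl y).
rewrite inE/= => yu; rewrite /ramp step_eq0 ?subr0//.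
by rewrite pmulr_rle0 ?invr_gt0// subr_le0.
Qed.

Lemma ramp_le_indic u dl y : 0 < dl ->
  ramp u dl y <= \1_[set z | z <= u + 3 * dl] y.
Proof.
move=> d0; rewrite indicE; case: (boolP (_ \in _)) => [_|]; first by case/andP: (ramp_bounds u dl y).
rewrite notin_setE/= => /negP; rewrite -ltNge => yu; rewrite /ramp step_eq1 ?subrr//.
by rewrite mulrC ler_pdivlMr//; lra.
Qed.

Lemma smooth3_ramp u dl : 0 < dl -> exists K g1 g2, smooth3 K (ramp u dl) g1 g2.
Proof.
move=> d0; have Li : 0 < dl^-1 by rewrite invr_gt0.
have := @smooth3_affine R _ _ _ _ 1 (-1) dl^-1 (- (dl^-1 * u)) smooth3_step Li.
rewrite (_ : (fun y => _) = ramp u dl); last first.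
  by apply/funext => y; rewrite /ramp mulN1r mulrBr.
by move=> h; do 3 eexists; exact: h.
Qed.

End ramp.

Section real_probability.
Context d (T : measurableType d) (R : realType) (P : probability T R).
Implicit Types (A B : set T).

Definition pr A : R := fine (P A).

Lemma prE A : measurable A -> P A = (pr A)%:E.
Proof. by move=> mA; rewrite /pr fineK// fin_num_measure. Qed.

Lemma pr_ge0 A : 0 <= pr A.
Proof. by rewrite fine_ge0. Qed.

Lemma prT : pr setT = 1.
Proof. by rewrite /pr probability_setT. Qed.

Lemma le_pr A B : measurable A -> measurable B -> A `<=` B -> pr A <= pr B.
Proof.
move=> mA mB AB; rewrite /pr fine_le ?fin_num_measure//.
by apply: le_measure; rewrite ?inE.
Qed.

Lemma pr_le1 A : measurable A -> pr A <= 1.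
Proof. by move=> mA; rewrite -prT le_pr. Qed.

Lemma prU_le A B : measurable A -> measurable B -> pr (A `|` B) <= pr A + pr B.
Proof.
move=> mA mB; rewrite -lee_fin EFinD -!prE//; last exact: measurableU.
exact: measureU2.
Qed.

Lemma prC A : measurable A -> pr (~` A) = 1 - pr A.
Proof.
move=> mA; apply: EFin_inj; rewrite EFinB -!prE//; last exact: measurableC.
exact: probability_setC.
Qed.

Lemma Rintegral_indic_pr A : measurable A -> \int[P]_w \1_A w = pr A.
Proof. by move=> mA; rewrite /Rintegral integral_indic// setIT. Qed.

Lemma integrable_indic_pr A : measurable A -> P.-integrable setT (EFin \o (\1_A : T -> R)).
Proof.
move=> mA; apply: (@bounded_integrable _ _ _ P _ 1) => // w.
by rewrite indicE; case: (_ \in _); rewrite ?normr1 ?normr0.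
Qed.

Lemma measurable_le_cst (X : T -> R) (t : R) : measurable_fun setT X ->
  measurable [set w | X w <= t].
Proof. by move=> mX; rewrite -[X in measurable X]setTI; exact: measurable_fun_le. Qed.

Lemma measurable_gt_cst (X : T -> R) (t : R) : measurable_fun setT X ->
  measurable [set w | t < X w].
Proof.
move=> mX; have -> : [set w | t < X w] = ~` [set w | X w <= t].
  by apply/seteqP; split => w /=; rewrite ltNge => /negP.
by apply: measurableC; exact: measurable_le_cst.
Qed.

End real_probability.

Section slutsky.
Context d (T : measurableType d) (R : realType) (P : probability T R).
Variable W : nat -> T -> R.
Hypothesis mW : forall k, measurable_fun setT (W k).
Hypothesis clt : forall K g g1 g2, smooth3 K g g1 g2 ->
  \int[P]_w g (W k w) @[k --> \oo] --> \int[gauss 1]_x g x.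

Let F (t : R) := pr (gauss 1) [set x : measurableTypeR R | x <= t].

Let mF t : measurable [set x : measurableTypeR R | x <= t].
Proof. exact: (@measurable_le_cst _ _ _ id t). Qed.

Lemma clt_cdf_ub (u dl e : R) : 0 < dl -> 0 < e ->
  \forall k \near \oo, pr P [set w | W k w <= u] <= F (u + 3 * dl) + e.
Proof.
move=> d0 e0; have [K [g1 [g2 gs]]] := smooth3_ramp u d0.
have [[mg _ _] bg _] := gs.
have h1 : \int[gauss 1]_x ramp u dl x <= F (u + 3 * dl).
  rewrite /F -Rintegral_indic_pr//; apply: le_Rintegral => //.
  - by apply: (@bounded_integrable _ _ _ (gauss 1) _ K) => // y; have [] := bg y.
  - exact: (@integrable_indic_pr _ _ _ (gauss 1)).
  - by move=> x _; exact: ramp_le_indic.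
have /cvgrPdist_le/(_ _ e0) := clt gs; apply: filterS => k /ler_normlP[h2 _].
have mle := measurable_le_cst u (mW k).
have h3 : pr P [set w | W k w <= u] <= \int[P]_w ramp u dl (W k w).
  rewrite -Rintegral_indic_pr//; apply: le_Rintegral => //.
  - exact: integrable_indic_pr.
  - apply: (@bounded_integrable _ _ _ P _ K); first exact: (measurableT_comp mg).
    by move=> w; have [] := bg (W k w).
  - by move=> w _; exact: (indic_le_ramp u (W k w) d0).
by move: h1 h2 h3; lra.
Qed.

Lemma clt_cdf_lb (u dl e : R) : 0 < dl -> 0 < e ->
  \forall k \near \oo, F u - e <= pr P [set w | W k w <= u + 3 * dl].
Proof.
move=> d0 e0; have [K [g1 [g2 gs]]] := smooth3_ramp u d0.
have [[mg _ _] bg _] := gs.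
have h1 : F u <= \int[gauss 1]_x ramp u dl x.
  rewrite /F -Rintegral_indic_pr//; apply: le_Rintegral => //.
  - exact: (@integrable_indic_pr _ _ _ (gauss 1)).
  - by apply: (@bounded_integrable _ _ _ (gauss 1) _ K) => // y; have [] := bg y.
  - by move=> x _; exact: indic_le_ramp.
have /cvgrPdist_le/(_ _ e0) := clt gs; apply: filterS => k /ler_normlP[_ h2].
have mle := measurable_le_cst (u + 3 * dl) (mW k).
have h3 : \int[P]_w ramp u dl (W k w) <= pr P [set w | W k w <= u + 3 * dl].
  rewrite -Rintegral_indic_pr//; apply: le_Rintegral => //.
  - apply: (@bounded_integrable _ _ _ P _ K); first exact: (measurableT_comp mg).
    by move=> w; have [] := bg (W k w).
  - exact: integrable_indic_pr.
  - by move=> w _; exact: (ramp_le_indic u (W k w) d0).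
by move: h1 h2 h3; lra.
Qed.

(** Slutsky's argument with a moving threshold [t_]: outside of an event of small
    probability, [X k] and [W k] differ by at most [dl], so the distribution
    function of [X k] at [t_ k] is squeezed between those of [W k] at points close
    to [t], which are controlled through ramps. *)
Lemma slutsky_cdf (X : nat -> T -> R) (t_ : nat -> R) (t : R) :
  (forall k, measurable_fun setT (X k)) ->
  (forall e : R, 0 < e ->
    pr P [set w | e < `|X k w - W k w|] @[k --> \oo] --> (0 : R)) ->
  t_ @ \oo --> t -> {for t, continuous F} ->
  pr P [set w | X k w <= t_ k] @[k --> \oo] --> F t.
Proof.
move=> mX XW tt cF; apply/cvgrPdist_le => e e0.
have e3 : 0 < e / 3 by rewrite divr_gt0.
have [dl d0 Fd] : exists2 dl : R, 0 < dl &
    forall s, `|t - s| <= 5 * dl -> `|F t - F s| <= e / 3.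
  have /cvgrPdist_le/(_ _ e3) := cF.
  move=> /nbhs_ballP[r /= r0 h]; exists (r / 10); first by rewrite divr_gt0.
  move=> s ts; apply: h; rewrite /ball/= (le_lt_trans ts)//; lra.
have ub := @clt_cdf_ub (t + 2 * dl) dl (e / 3) d0 e3.
have lb := @clt_cdf_lb (t - 5 * dl) dl (e / 3) d0 e3.
have ncl : \forall k \near \oo, pr P [set w | dl < `|X k w - W k w|] <= e / 3.
  have /cvgrPdist_le/(_ _ e3) := XW _ d0; apply: filterS => k.
  by rewrite sub0r normrN; exact: le_trans (ler_norm _).
have /cvgrPdist_le/(_ _ d0) ntt := tt.
near=> k.
have hub : pr P [set w | W k w <= t + 2 * dl] <= F (t + 2 * dl + 3 * dl) + e / 3.
  by near: k; exact: ub.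
have hlb : F (t - 5 * dl) - e / 3 <= pr P [set w | W k w <= t - 5 * dl + 3 * dl].
  by near: k; exact: lb.
have cl : pr P [set w | dl < `|X k w - W k w|] <= e / 3 by near: k; exact: ncl.
have /ler_normlP[t1 t2] : `|t - t_ k| <= dl by near: k; exact: ntt.
have mD : measurable_fun setT (fun w => `|X k w - W k w|).
  by apply: measurableT_comp => //; exact: measurable_funB.
have mC := measurable_gt_cst dl mD.
have mXt := measurable_le_cst (t_ k) (mX k).
have mWu := measurable_le_cst (t + 2 * dl) (mW k).
have mWl := measurable_le_cst (t - 5 * dl + 3 * dl) (mW k).
have F1 := Fd (t + 2 * dl + 3 * dl); have F2 := Fd (t - 5 * dl).
have {}F1 : F (t + 2 * dl + 3 * dl) <= F t + e / 3.
  have : `|t - (t + 2 * dl + 3 * dl)| <= 5 * dl.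
    by rewrite ler_norml; apply/andP; split; lra.
  by move=> /F1/ler_normlP[]; lra.
have {}F2 : F t - e / 3 <= F (t - 5 * dl).
  have : `|t - (t - 5 * dl)| <= 5 * dl.
    by rewrite ler_norml; apply/andP; split; lra.
  by move=> /F2/ler_normlP[]; lra.
have U : pr P [set w | X k w <= t_ k] <=
    pr P [set w | W k w <= t + 2 * dl] + pr P [set w | dl < `|X k w - W k w|].
  apply: le_trans (prU_le P mWu mC); apply: le_pr => //; first exact: measurableU.
  move=> w /= Xt; have [h|h] := leP `|X k w - W k w| dl; last by right.
  by left; move/ler_normlP : h => [h1 h2]; lra.
have L : pr P [set w | W k w <= t - 5 * dl + 3 * dl] <=
    pr P [set w | X k w <= t_ k] + pr P [set w | dl < `|X k w - W k w|].
  apply: le_trans (prU_le P mXt mC); apply: le_pr => //; first exact: measurableU.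
  move=> w /= Wt; have [h|h] := leP `|X k w - W k w| dl; last by right.
  by left; move/ler_normlP : h => [h1 h2]; lra.
by rewrite ler_norml; apply/andP; split; lra.
Unshelve. all: by end_near. Qed.

End slutsky.

(** * Conditioned approximations of asymptotically Gaussian variables *)

Lemma integral_density d (T : measurableType d) (R : realType)
    (mu nu : {measure set T -> \bar R}) (h f : T -> R) :
  measurable_fun setT h -> (forall x, 0 <= h x) ->
  (forall A, measurable A -> nu A = \int[mu]_(x in A) (h x)%:E)%E ->
  measurable_fun setT f ->
  (\int[nu]_x (f x)%:E = \int[mu]_x (f x * h x)%:E)%E.
Proof.
move=> mh h0 nuE mf; rewrite integralE [RHS]integralE.
have mfe : measurable_fun setT (EFin \o f) by exact/measurable_EFinP.
congr (_ - _)%E.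
- rewrite (ge0_integral_density mh h0 nuE)//; last exact: measurable_funepos.
  apply: eq_integral => x _; rewrite !funeposE -!EFin_max -EFinM.
  by rewrite maxr_pMl// mul0r.
- rewrite (ge0_integral_density mh h0 nuE)//; last exact: measurable_funeneg.
  apply: eq_integral => x _; rewrite !funenegE -!EFinN -!EFin_max -EFinM.
  by rewrite maxr_pMl// mul0r mulNr.
Qed.

Section conditioning.
Context d (T : measurableType d) (R : realType) (P : probability T R).
Variables (G : set T) (mG : measurable G).
Hypothesis G0 : 0 < pr P G.
Local Notation Q := (cond_prob P mG).

Lemma cond_probE A : measurable A -> Q A = (pr P (A `&` G) / pr P G)%:E.
Proof.
move=> mA; rewrite -[LHS]/(mnormalize (mrestr P mG) P A) /mnormalize.
have PG : mrestr P mG setT = (pr P G)%:E by rewrite /mrestr setTI prE.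
set e := (X in if (X == 0%E) || _ then _ else _).
have -> : e = (pr P G)%:E by exact: PG.
rewrite eqe (gt_eqF G0)/= /mrestr setTI (prE P mG)/=.
rewrite (_ : P (A `&` G) = (pr P (A `&` G))%:E) ?EFinM//.
by apply: prE; exact: measurableI.
Qed.

Let h w : R := \1_G w / pr P G.

Let mh : measurable_fun setT h.
Proof. by apply: measurable_funM => //; exact: measurable_indic. Qed.

Let h0 w : 0 <= h w.
Proof. by rewrite divr_ge0 ?(ltW G0)// indicE. Qed.

Let QE A : measurable A -> (Q A = \int[P]_(w in A) (h w)%:E)%E.
Proof.
move=> mA; rewrite cond_probE//.
under eq_integral do rewrite /h mulrC EFinM.
rewrite ge0_integralZl//=; last 2 first.
- by apply/measurable_EFinP/measurable_funTS; exact: measurable_indic.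
- by rewrite lee_fin invr_ge0 ltW.
rewrite integral_indic// mulrC EFinM setIC; congr (_ * _)%E.
exact: (esym (prE P (measurableI G A mG mA))).
Qed.

Lemma Rintegral_cond (f : T -> R) : P.-integrable setT (EFin \o f) ->
  (forall w, ~ G w -> f w = 0) -> \int[Q]_w f w = \int[P]_w f w / pr P G.
Proof.
move=> iF fG; have /measurable_EFinP mf := measurable_int _ iF.
rewrite -RintegralZr//; rewrite /Rintegral (integral_density mh h0 QE mf).
congr fine; apply: eq_integral => w _; rewrite /h indicE.
case: (boolP (w \in G)) => [_|]; first by rewrite div1r.
by rewrite notin_setE => /fG ->; rewrite !mul0r.
Qed.

Lemma integrable_cond (f : T -> R) : P.-integrable setT (EFin \o f) ->
  Q.-integrable setT (EFin \o f).
Proof.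
move=> /integrableP[/measurable_EFinP mf lf]; apply/integrableP; split.
  exact/measurable_EFinP.
have mnf : measurable_fun setT (fun w => `|f w|) by exact: measurableT_comp.
rewrite (_ : (fun x => _) = (fun x => (`|f x|)%:E))//.
rewrite (integral_density mh h0 QE mnf).
apply: (@le_lt_trans _ _ (\int[P]_w ((pr P G)^-1%:E * `|(f w)%:E|))%E).
  apply: ge0_le_integral => //.
  - by move=> w _; rewrite lee_fin mulr_ge0.
  - by apply/measurable_EFinP; exact: measurable_funM.
  - by apply/measurable_EFinP; exact: measurable_funM.
  move=> w _; rewrite -EFinM lee_fin mulrC ler_wpM2r// /h.
  by rewrite ler_pdivrMr// mulVf ?gt_eqF// indicE.
rewrite ge0_integralZl//; last 2 first.
- by apply/measurable_EFinP.
- by rewrite lee_fin invr_ge0 ltW.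
by apply: lte_mul_pinfty => //; rewrite ?lee_fin ?invr_ge0 ?(ltW G0).
Qed.

End conditioning.

Section variance.
Context d (T : measurableType d) (R : realType) (Q : probability T R).

Lemma integrable_of_sqr (X : T -> R) : measurable_fun setT X ->
  Q.-integrable setT (EFin \o (fun w => X w ^+ 2)) ->
  Q.-integrable setT (EFin \o X).
Proof.
move=> mX iX2.
apply: (@dominated_integrable _ _ _ Q _ (fun w => cst 1 w + X w ^+ 2)) => //.
  move=> w; rewrite ler_norml /cst; have := sqr_ge0 (X w - 1).
  by have := sqr_ge0 (X w + 1); move=> h1 h2; apply/andP; split; lra.
by apply: integrableDr => //; exact: integrable_cst.
Qed.

Lemma fine_varianceE (X : T -> R) : measurable_fun setT X ->
  Q.-integrable setT (EFin \o X) ->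
  Q.-integrable setT (EFin \o (fun w => X w ^+ 2)) ->
  fine 'V_Q[X] = \int[Q]_w (X w ^+ 2) - (\int[Q]_w X w) ^+ 2.
Proof.
move=> mX iX iX2; rewrite /variance unlock.
set m := \int[Q]_w X w.
have EX : fine 'E_Q[X] = m by rewrite unlock.
rewrite EX unlock.
transitivity (\int[Q]_w (X w ^+ 2 - 2 * m * X w + cst (m ^+ 2) w)).
  by apply: eq_Rintegral => w _; rewrite -[LHS]/((X w - m) * (X w - m)) /cst; ring.
have i1 : Q.-integrable setT (EFin \o (fun w => 2 * m * X w)) by exact: integrable_scale.
have i2 : Q.-integrable setT (EFin \o (fun w => X w ^+ 2 - 2 * m * X w)).
  exact: integrableBr.
have i3 := integrable_cst Q (m ^+ 2).
by rewrite RintegralD// RintegralB// RintegralZl// Rintegral_cst1 -/m; ring.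
Qed.

Lemma ae_variance (X Y : T -> R) : measurable_fun setT X -> measurable_fun setT Y ->
  {ae Q, forall w, X w = Y w} -> 'V_Q[X] = 'V_Q[Y].
Proof.
move=> mX mY XY; rewrite /variance unlock.
have E : ('E_Q[X] = 'E_Q[Y])%E.
  rewrite unlock; apply: ae_eq_integral => //; try exact/measurable_EFinP.
  by apply: filterS XY => w -> _.
rewrite E unlock; apply: ae_eq_integral => //.
- by apply/measurable_EFinP; apply: measurable_funM; exact: measurable_funB.
- by apply/measurable_EFinP; apply: measurable_funM; exact: measurable_funB.
apply: filterS XY => w XYw _; set m := fine _.
by rewrite -[LHS]/(((X w - m) * (X w - m))%:E) XYw.
Qed.

End variance.

(** The variables [W] are the normalized linear functionals of the noise and [Y]
    the normalized deviations, close to [W] on events [E] of probability tending to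
    one and known only on the events [G] on which one conditions.  The truncation
    events [B] agree with [E] up to null sets: they are [E] itself, or the whole
    space when [E] has full probability. *)
Section gaussian_approximation.
Context d (T : measurableType d) (R : realType) (P : probability T R).
Variable W : nat -> T -> R.
Hypothesis mW : forall k, measurable_fun setT (W k).
Hypothesis iW : forall k, P.-integrable setT (EFin \o W k).
Hypothesis iW2 : forall k, P.-integrable setT (EFin \o (fun w => W k w ^+ 2)).
Hypothesis W1 : forall k, \int[P]_w W k w = 0.
Hypothesis W2 : forall k, \int[P]_w (W k w ^+ 2) = 1.
Hypothesis clt : forall K g g1 g2, smooth3 K g g1 g2 ->
  \int[P]_w g (W k w) @[k --> \oo] --> \int[gauss 1]_x g x.
Variables (G E B : nat -> set T).
Hypothesis mG : forall k, measurable (G k).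
Hypothesis mE : forall k, measurable (E k).
Hypothesis mB : forall k, measurable (B k).
Hypothesis EB : forall k, E k `<=` B k.
Hypothesis BE0 : forall k, P (B k `\` E k) = 0%E.
Hypothesis PE1 : pr P (E k) @[k --> \oo] --> (1 : R).
Hypothesis PG1 : pr P (G k) @[k --> \oo] --> (1 : R).
Variables (Y : nat -> T -> R) (dl : nat -> R).
Hypothesis mY : forall k, measurable_fun setT (Y k).
Hypothesis YG : forall k w, ~ G k w -> Y k w = 0.
Hypothesis dl0 : dl @ \oo --> (0 : R).
Hypothesis YW : \forall k \near \oo, forall w, E k w -> `|Y k w - W k w| <= dl k.

Let near_G : \forall k \near \oo, 0 < pr P (G k).
Proof.
have := cvgr_gt _ PG1; apply; exact: ltr01.
Qed.

Let near_dl (e : R) : 0 < e -> \forall k \near \oo, dl k <= e.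
Proof. by move=> e0; apply: (cvgr_le _ dl0). Qed.

(* closeness in probability, as needed for [slutsky_cdf] *)
Let closeness (X : nat -> T -> R) : (forall k, measurable_fun setT (X k)) ->
  (forall k w, E k w -> X k w = Y k w) ->
  forall e : R, 0 < e ->
    pr P [set w | e < `|X k w - W k w|] @[k --> \oo] --> (0 : R).
Proof.
move=> mX XY e e0.
have cE : 1 - pr P (E k) @[k --> \oo] --> (0 : R).
  by rewrite -(subrr (1 : R)); apply: cvgB => //; exact: cvg_cst.
apply: (squeeze_cvgr _ (cvg_cst 0) cE).
near=> k; rewrite pr_ge0/= -prC//.
have hdl : dl k <= e by near: k; exact: near_dl.
have hYW : forall w, E k w -> `|Y k w - W k w| <= dl k by near: k.
apply: le_pr.
- apply: measurable_gt_cst; apply: measurableT_comp => //; exact: measurable_funB.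
- exact: measurableC.
move=> w /= h Ew; move: h; rewrite XY// ltNge => /negP; apply.
exact: le_trans (hYW w Ew) hdl.
Unshelve. all: by end_near. Qed.

Let cond_cdf (X : nat -> T -> R) (t_ : nat -> R) (l : R) :
  (forall k, measurable_fun setT (X k)) ->
  pr P [set w | X k w <= t_ k] @[k --> \oo] --> l ->
  cond_prob P (mG k) [set w | X k w <= t_ k] @[k --> \oo] --> l%:E.
Proof.
move=> mX cX.
have mA k := measurable_le_cst (t_ k) (mX k).
have cAG : pr P ([set w | X k w <= t_ k] `&` G k) @[k --> \oo] --> l.
  have cl : pr P [set w | X k w <= t_ k] - (1 - pr P (G k)) @[k --> \oo] --> l.
    have := cvgB cX (cvgB (cvg_cst (1 : R)) PG1).
    by rewrite subrr subr0; exact.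
  apply: (squeeze_cvgr _ cl cX); apply: nearW => k.
  rewrite le_pr//; last exact: measurableI.
  rewrite andbT lerBlDr -prC//.
  have mI := measurableI _ _ (mA k) (mG k).
  apply: le_trans (prU_le P mI (measurableC (mG k))); apply: le_pr => //.
    by apply: measurableU => //; exact: measurableC.
  by move=> w /= h; have [Gw|Gw] := pselect (G k w); [left|right].
have cq : pr P ([set w | X k w <= t_ k] `&` G k) / pr P (G k) @[k --> \oo] --> l.
  rewrite -[X in _ --> X]divr1; apply: cvgM => //.
  by apply: cvgV => //; rewrite oner_eq0.
apply: cvg_EFin.
  by apply: nearW => k; exact: fin_num_measure.
apply: cvg_trans cq; apply: near_eq_cvg; near=> k.
by rewrite /= cond_probE//; near: k.
Unshelve. all: by end_near. Qed.

(* the truncated variables, which converge to [W] in mean square: the error is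
   uniformly small on [E] and equal to [- W] outside, where the mass of the squares
   is small by uniform integrability *)
Let X k w := Y k w * \1_(E k) w.

Let mX k : measurable_fun setT (X k).
Proof. by apply: measurable_funM => //; exact: measurable_indic. Qed.

Let X_truncated (e : R) : 0 < e -> \forall k \near \oo,
  [/\ P.-integrable setT (EFin \o X k),
      P.-integrable setT (EFin \o (fun w => X k w ^+ 2)),
      P.-integrable setT (EFin \o (fun w => (X k w - W k w) ^+ 2)) &
      \int[P]_w ((X k w - W k w) ^+ 2) <= e].
Proof.
move=> e0; have e2 : 0 < e / 2 by rewrite divr_gt0.
have [eta eta0 UI] := uniform_integrability mW iW2 W2 clt e2.
have cE : \forall k \near \oo, 1 - pr P (E k) <= eta.
  have : 1 - pr P (E k) @[k --> \oo] --> (0 : R).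
    by rewrite -(subrr (1 : R)); apply: cvgB => //; exact: cvg_cst.
  by move=> h; apply: (cvgr_le _ h).
have mn : 0 < Num.min 1 (e / 2) by rewrite lt_min ltr01.
near=> k.
have hYW : forall w, E k w -> `|Y k w - W k w| <= dl k by near: k.
have hdl : dl k <= Num.min 1 (e / 2) by near: k; exact: near_dl.
have hE : 1 - pr P (E k) <= eta by near: k.
have hUI : forall A, measurable A -> \int[P]_w \1_A w <= eta ->
  \int[P]_w (W k w ^+ 2 * \1_A w) <= e / 2 by near: k.
have /andP[dl1 dle] : (dl k <= 1) && (dl k <= e / 2) by move: hdl; rewrite le_min.
pose U w := W k w ^+ 2 * \1_(~` E k) w.
have mC := measurableC (mE k).
have mU : measurable_fun setT U.
  apply: measurable_funM; first exact: measurable_funX.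
  exact: measurable_indic.
have iU : P.-integrable setT (EFin \o U).
  apply: (dominated_integrable mU _ (iW2 k)) => w.
  rewrite normrM ger0_norm ?sqr_ge0// ler_piMr ?sqr_ge0//.
  by rewrite indicE; case: (_ \in _); rewrite ?normr1 ?normr0.
have bd w : (X k w - W k w) ^+ 2 <= e / 2 + U w.
  rewrite /X /U !indicE in_setC; case: (boolP (w \in E k)) => /= [|_].
    rewrite inE => /hYW h; rewrite !mulr1 mulr0 addr0 -real_normK ?num_real//.
    apply: le_trans (_ : `|Y k w - W k w| * 1 <= _).
      by rewrite expr2 ler_wpM2l// (le_trans h).
    by rewrite mulr1 (le_trans h).
  by rewrite mulr0 mulr1 sub0r sqrrN lerDr ltW.
have mD : measurable_fun setT (fun w => (X k w - W k w) ^+ 2).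
  by apply: measurable_funX; exact: measurable_funB.
have ib : P.-integrable setT (EFin \o (fun w => cst (e / 2) w + U w)).
  by apply: integrableDr => //; exact: integrable_cst.
have iD : P.-integrable setT (EFin \o (fun w => (X k w - W k w) ^+ 2)).
  apply: (dominated_integrable mD _ ib) => w.
  by rewrite ger0_norm ?sqr_ge0//; exact: bd.
have iX2 : P.-integrable setT (EFin \o (fun w => X k w ^+ 2)).
  apply: (@dominated_integrable _ _ _ P _
    (fun w => 2 * (X k w - W k w) ^+ 2 + 2 * W k w ^+ 2)).
  - exact: measurable_funX.
  - move=> w; rewrite ger0_norm ?sqr_ge0//.
    have := sqr_ge0 (X k w - 2 * W k w); lra.
  - by apply: integrableDr; exact: integrable_scale.
split=> //.
  exact: integrable_of_sqr.
apply: (@le_trans _ _ (\int[P]_w (cst (e / 2) w + U w))).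
  by apply: le_Rintegral => // w _; exact: bd.
rewrite RintegralD//; last exact: integrable_cst.
rewrite Rintegral_cst1 [leRHS](splitr e) lerD2l; apply: hUI => //.
by rewrite Rintegral_indic_pr// prC.
Unshelve. all: by end_near. Qed.

(* the elementary bounds `|z| <= e + z ^+ 2 / e and
   `|x ^+ 2 - y ^+ 2| <= (1 + 1 / e) * (x - y) ^+ 2 + e * y ^+ 2
   turn mean square convergence into convergence of the two moments *)
Let X_moments (e : R) : 0 < e -> \forall k \near \oo,
  `|\int[P]_w X k w| <= 2 * e /\ `|\int[P]_w (X k w ^+ 2) - 1| <= 2 * e.
Proof.
move=> e0; have f0 : 0 < e ^+ 2 / (1 + e) by rewrite divr_gt0 ?exprn_gt0//; lra.
apply: filterS (X_truncated f0) => k [iX iX2 iD De].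
set D := fun w => (X k w - W k w) ^+ 2 in iD De.
have e1 : (1 + e^-1) * (e ^+ 2 / (1 + e)) = e.
  by field; rewrite !gt_eqF//; lra.
have D0 : 0 <= \int[P]_w D w by apply: Rintegral_ge0 => // w _; exact: sqr_ge0.
have ie : 0 < e^-1 by rewrite invr_gt0.
have De' : (1 + e^-1) * \int[P]_w D w <= e.
  by rewrite -[leRHS]e1 ler_wpM2l//; lra.
split.
  rewrite -[X in `|X|]subr0 -(W1 k) -RintegralB//.
  have iDf := integrableBr iX (iW k).
  apply: le_trans (le_normr_Rintegral _ iDf) _ => //.
  apply: (@le_trans _ _ (\int[P]_w (cst e w + e^-1 * D w))).
    apply: le_Rintegral => //.
    - exact: integrable_norm iDf.
    - by apply: integrableDr; [exact: integrable_cst|exact: integrable_scale].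
    move=> w _ /=; set z := X k w - W k w; rewrite /D -/z -[z ^+ 2]real_normK ?num_real//.
    have z0 := normr_ge0 z.
    have : 0 <= e^-1 * (`|z| - e) ^+ 2 by rewrite mulr_ge0 ?sqr_ge0 ?ltW.
    rewrite (_ : e^-1 * _ = e^-1 * `|z| ^+ 2 - 2 * `|z| + e); first by lra.
    by field; rewrite gt_eqF.
  rewrite RintegralD//; last exact: integrable_scale; last exact: integrable_cst.
  by rewrite Rintegral_cst1 RintegralZl//; lra.
rewrite -{1}(W2 k) -RintegralB//.
have iDf := integrableBr iX2 (iW2 k).
apply: le_trans (le_normr_Rintegral _ iDf) _ => //.
apply: (@le_trans _ _ (\int[P]_w ((1 + e^-1) * D w + e * W k w ^+ 2))).
  apply: le_Rintegral => //.
  - exact: integrable_norm iDf.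
  - by apply: integrableDr; exact: integrable_scale.
  move=> w _ /=; rewrite /D; set x := X k w; set y := W k w.
  have : 0 <= e^-1 * (`|x - y| - e * `|y|) ^+ 2 by rewrite mulr_ge0 ?sqr_ge0 ?ltW.
  rewrite (_ : e^-1 * _ = e^-1 * `|x - y| ^+ 2 - 2 * (`|x - y| * `|y|) + e * `|y| ^+ 2); last first.
    by field; rewrite gt_eqF.
  have -> : x ^+ 2 - y ^+ 2 = (x - y) * ((x - y) + 2 * y) by ring.
  rewrite normrM => h.
  have h2 : `|x - y| * `|x - y + 2 * y| <= `|x - y| ^+ 2 + 2 * (`|x - y| * `|y|).
    rewrite (_ : _ + _ = `|x - y| * (`|x - y| + 2 * `|y|)); last by ring.
    by rewrite ler_wpM2l// (le_trans (ler_normD _ _))// normrM ger0_norm.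
  apply: le_trans h2 _; move: h; rewrite !real_normK ?num_real//; lra.
rewrite RintegralD//; last exact: integrable_scale; last exact: integrable_scale.
by rewrite !RintegralZl// W2; lra.
Unshelve. all: by end_near. Qed.

Let slutsky (Z : nat -> T -> R) (t_ : nat -> R) (t : R) :
  (forall k, measurable_fun setT (Z k)) ->
  (forall k w, E k w -> Z k w = Y k w) -> t_ @ \oo --> t ->
  {for t, continuous (fun r => fine (@normal_prob R 0 1 `]-oo, r]%classic))} ->
  cond_prob P (mG k) [set w | Z k w <= t_ k] @[k --> \oo] -->
    @normal_prob R 0 1 `]-oo, t]%classic.
Proof.
move=> mZ ZY tt ct; have mle r : measurable (`]-oo, r]%classic : set R) by [].
rewrite -[X in _ --> X]fineK; last exact: fin_num_measure.
have gE r : fine (@normal_prob R 0 1 `]-oo, r]%classic) =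
    pr (gauss 1) [set x : measurableTypeR R | x <= r].
  rewrite /pr (gaussE (oner_neq0 R)) (_ : `]-oo, r]%classic = [set x | x <= r])//.
rewrite gE; apply: cond_cdf => //; have cl := closeness mZ ZY.
apply: (slutsky_cdf mW clt mZ cl tt).
by rewrite (_ : (fun t => _) = (fun r => fine (@normal_prob R 0 1 `]-oo, r]%classic)))//; apply/funext => r; rewrite gE.
Qed.

Lemma cvg_normalized :
  cvg_in_distribution (fun k => cond_prob P (mG k)) Y (normal_prob 0 1).
Proof.
split=> // t ct; exact: (slutsky mY (fun _ _ _ => erefl) (cvg_cst t) ct).
Qed.

Variable c : nat -> R.
Hypothesis c_gt0 : forall k, 0 < c k.
Let Z k w := c k * Y k w * \1_(B k) w.

Let mZ k : measurable_fun setT (Z k).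
Proof.
apply: measurable_funM; last exact: measurable_indic.
exact: measurable_funM.
Qed.

(* conditioning divides both moments by a probability tending to one, and passing
   from [B] to [E] changes the variables on a null set only *)
Let variance_Z :
  fine 'V_(cond_prob P (mG k))[Z k] / c k ^+ 2 @[k --> \oo] --> (1 : R).
Proof.
have m1 : \int[P]_w X k w @[k --> \oo] --> (0 : R).
  apply/cvgrPdist_le => e e0; have e2 : 0 < e / 2 by rewrite divr_gt0.
  by apply: filterS (X_moments e2) => k []; rewrite sub0r normrN; lra.
have m2 : \int[P]_w (X k w ^+ 2) @[k --> \oo] --> (1 : R).
  apply/cvgrPdist_le => e e0; have e2 : 0 < e / 2 by rewrite divr_gt0.
  by apply: filterS (X_moments e2) => k [_]; rewrite distrC; lra.
have iG : (pr P (G k))^-1 @[k --> \oo] --> (1 : R).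
  by rewrite -[X in _ --> X]invr1; apply: cvgV => //; rewrite oner_eq0.
have : \int[P]_w (X k w ^+ 2) / pr P (G k) -
    (\int[P]_w X k w / pr P (G k)) ^+ 2 @[k --> \oo] --> (1 : R).
  rewrite (_ : 1 = 1 * 1 - (0 * 1) * (0 * 1) :> R); last by ring.
  by apply: cvgB; [exact: cvgM|apply: cvgM; exact: cvgM].
apply: cvg_trans; apply: near_eq_cvg; near=> k.
have hG : 0 < pr P (G k) by near: k; exact: near_G.
have [iX iX2 _ _] : [/\ P.-integrable setT (EFin \o X k),
      P.-integrable setT (EFin \o (fun w => X k w ^+ 2)),
      P.-integrable setT (EFin \o (fun w => (X k w - W k w) ^+ 2)) &
      \int[P]_w ((X k w - W k w) ^+ 2) <= 1] by near: k; exact: X_truncated.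
have XG w : ~ G k w -> X k w = 0 by move=> /YG; rewrite /X => ->; rewrite mul0r.
pose X' w := c k * X k w.
have mX' : measurable_fun setT X' by exact: measurable_funM.
have -> : 'V_(cond_prob P (mG k))[Z k] = 'V_(cond_prob P (mG k))[X'].
  apply: ae_variance => //.
  have mBE := measurableD (mB k) (mE k).
  exists (B k `\` E k); split=> //.
    rewrite cond_probE// (_ : pr P _ = 0) ?mul0r//.
    apply/eqP; rewrite eq_le pr_ge0 andbT.
    have -> : 0 = pr P (B k `\` E k) by rewrite /pr BE0.
    by apply: le_pr => //; exact: measurableI.
  move=> w /= ZX; have [Ew|Ew] := pselect (E k w).
    exfalso; apply: ZX; rewrite /Z /X' /X !indicE !mem_set//; last exact: EB.
    by rewrite !mulr1.
  split=> //; apply: contrapT => Bw; apply: ZX.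
  by rewrite /Z /X' /X !indicE !memNset// !mulr0.
have iX' : P.-integrable setT (EFin \o X') by exact: integrable_scale.
have X'2 w : X' w ^+ 2 = c k ^+ 2 * X k w ^+ 2 by rewrite exprMn.
have iX'2 : P.-integrable setT (EFin \o (fun w => X' w ^+ 2)).
  by under eq_fun do rewrite X'2; exact: integrable_scale.
rewrite fine_varianceE//; last 2 first.
- exact: (integrable_cond (mG k) hG iX').
- exact: (integrable_cond (mG k) hG iX'2).
rewrite !(Rintegral_cond (mG k) hG)//; last 2 first.
- by move=> w /XG h; rewrite /X' h mulr0.
- by move=> w /XG h; rewrite X'2 h expr0n mulr0.
under [in RHS]eq_Rintegral do rewrite X'2.
rewrite !RintegralZl//; field.
by rewrite !gt_eqF.
Unshelve. all: by end_near. Qed.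

(** Dividing by the standard deviation of the truncated variable amounts to moving
    the threshold [t] by a factor tending to one, by [variance_Z]. *)
Lemma cvg_self_normalized :
  cvg_in_distribution (fun k => cond_prob P (mG k))
    (fun k w => Z k w / Num.sqrt (fine 'V_(cond_prob P (mG k))[Z k]))
    (normal_prob 0 1).
Proof.
split=> [k|t ct]; first by apply: measurable_funM.
pose v k := fine 'V_(cond_prob P (mG k))[Z k].
have v1 : v k / c k ^+ 2 @[k --> \oo] --> (1 : R) by exact: variance_Z.
have s1 : t * Num.sqrt (v k / c k ^+ 2) @[k --> \oo] --> t.
  rewrite -[X in _ --> X]mulr1; apply: cvgM; first exact: cvg_cst.
  rewrite -[X in _ --> X]sqrtr1.
  by apply: continuous_cvg => //; exact: sqrt_continuous.
pose Y' k w := Y k w * \1_(B k) w.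
have mY' k : measurable_fun setT (Y' k).
  by apply: measurable_funM => //; exact: measurable_indic.
have YY' k w : E k w -> Y' k w = Y k w.
  by move=> /EB Bw; rewrite /Y' indicE mem_set// mulr1.
apply: cvg_trans (slutsky mY' YY' s1 ct); apply: near_eq_cvg.
have : \forall k \near \oo, 0 < v k / c k ^+ 2 by apply: (cvgr_gt _ v1); exact: ltr01.
apply: filterS => k v0; congr (cond_prob _ _ _); apply/seteqP.
have c0 := c_gt0 k; have c20 : 0 < c k ^+ 2 by rewrite exprn_gt0.
have vk0 : 0 < v k by move: v0; rewrite pmulr_lgt0// invr_gt0.
have E1 w : (Z k w / Num.sqrt (v k) <= t) = (Y' k w <= t * Num.sqrt (v k / c k ^+ 2)).
  have -> : Num.sqrt (v k / c k ^+ 2) = Num.sqrt (v k) / c k.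
    rewrite sqrtrM ?ltW//; congr (_ * _).
    by rewrite -exprVn sqrtr_sqr gtr0_norm ?invr_gt0.
  have sv : 0 < Num.sqrt (v k) by rewrite sqrtr_gt0.
  rewrite mulrA (ler_pdivrMr _ _ sv) (ler_pdivlMr _ _ c0); congr (_ <= _).
  by rewrite -[Z k w]/(c k * Y k w * \1_(B k) w) /Y'; ring.
by split => w /= h; [rewrite -/(v k) E1|rewrite -E1].
Qed.
End gaussian_approximation.

(** * Propagation of errors along an orbit *)

Section error_propagation.
Context {R : realType}.
Variables (f f1 : R -> R) (x : R).
Hypothesis f_f1 : forall m, is_derive (iter m f x) (1 : R) f (f1 (iter m f x)).

Lemma is_derive_iter m j : is_derive (iter j f x) (1 : R) (iter m f)
  (\prod_(j <= i < j + m) f1 (iter i f x)).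
Proof.
elim: m => [|m IH]; first by rewrite addn0 big_geq//; exact: is_derive_id.
rewrite addnS big_nat_recr ?leq_addr//= mulrC.
apply: (@is_derive1_comp _ f (iter m f) _ _ _ _ IH).
by rewrite -iterD addnC; exact: f_f1.
Qed.

(** The chain rule along the orbit. *)
Lemma transferE n j : (j <= n)%N ->
  transfer f x n j = \prod_(j <= i < n) f1 (iter i f x).
Proof.
move=> jn; rewrite /transfer derive1E.
have h := is_derive_iter (n - j) j; rewrite subnKC// in h.
exact: derive_val.
Qed.

Lemma transfer_nn n : transfer f x n n = 1.
Proof. by rewrite transferE// big_geq. Qed.

Lemma transferS n j : (j <= n)%N ->
  transfer f x n.+1 j = f1 (iter n f x) * transfer f x n j.
Proof. by move=> jn; rewrite !transferE ?leqW// big_nat_recr//= mulrC. Qed.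

Lemma transfer_sum_le_Lambda_hat N n : (n <= N)%N ->
  \sum_(1 <= j < n.+1) `|transfer f x n j| <= Lambda_hat f x N.
Proof.
move=> nN; apply: (@le_trans _ _ (\sum_(0 <= j < n.+1) `|transfer f x n j|)).
  by rewrite (@big_ltn _ _ _ 0)// lerDr.
rewrite /Lambda_hat.
apply: (le_bigmax_seq 0 n xpredT
  (fun i => \sum_(0 <= j < i.+1) `|transfer f x i j|)) => //.
by rewrite mem_index_iota.
Qed.

Lemma Lambda_hat_ge1 N : 1 <= Lambda_hat f x N.
Proof.
have : \sum_(0 <= j < 1) `|transfer f x 0 j| <= Lambda_hat f x N.
  apply: (le_bigmax_seq 0 0%N xpredT
    (fun i => \sum_(0 <= j < i.+1) `|transfer f x i j|)) => //.
by rewrite big_nat1 transfer_nn normr1.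
Qed.

Lemma Lambda_ge1 s n : (0 < n)%N -> 1 <= Lambda f s x n.
Proof.
move=> n0; rewrite /Lambda big_nat_recr//= transfer_nn normr1 powR1 lerDr.
by apply: sumr_ge0 => j _; exact: powR_ge0.
Qed.

Lemma Lambda2E n : Lambda f 2 x n = \sum_(1 <= j < n.+1) transfer f x n j ^+ 2.
Proof.
by apply: eq_bigr => j _; rewrite powR_mulrn// real_normK ?num_real.
Qed.

Lemma sum_sqr_le (r : seq nat) (b : nat -> R) :
  \sum_(j <- r) b j ^+ 2 <= (\sum_(j <- r) `|b j|) ^+ 2.
Proof.
elim: r => [|j r IH]; first by rewrite !big_nil expr0n.
rewrite !big_cons sqrrD real_normK ?num_real// addrAC -addrA lerD2l.
by rewrite (le_trans IH)// lerDl mulrn_wge0// mulr_ge0// sumr_ge0.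
Qed.

Lemma sqrt_Lambda2_le n : Num.sqrt (Lambda f 2 x n) <= Lambda_hat f x n.
Proof.
have H1 := Lambda_hat_ge1 n.
rewrite -(@ger0_norm _ (Lambda_hat f x n)) -?sqrtr_sqr ?ler_wsqrtr ?(le_trans _ H1)//.
rewrite Lambda2E (le_trans (sum_sqr_le _ _))// ler_sqr ?nnegrE ?sumr_ge0//.
- exact: transfer_sum_le_Lambda_hat.
- exact: le_trans H1.
Qed.

Variables (K mu : R) (N : nat) (z u : nat -> R).
Hypothesis K_ge0 : 0 <= K.
Hypothesis mu_ge0 : 0 <= mu.
Hypothesis z0 : z 0%N = x.
Hypothesis zS : forall n, (n < N)%N -> z n.+1 = f (z n) + u n.+1.
Hypothesis u_mu : forall n, (0 < n <= N)%N -> `|u n| <= mu.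
Hypothesis quadratic : forall n, (n < N)%N ->
  `|f (z n) - f (iter n f x) - f1 (iter n f x) * (z n - iter n f x)|
    <= K * (z n - iter n f x) ^+ 2.

Let e n := z n - iter n f x.
Let r n := f (z n.-1) - f (iter n.-1 f x) - f1 (iter n.-1 f x) * e n.-1.

(** The error solves a linear recursion with coefficients [f1 (iter n f x)] and
    inhomogeneity [u + r], whose fundamental solution is [transfer]. *)
Lemma error_variation_of_constants n : (n <= N)%N ->
  e n = \sum_(1 <= j < n.+1) transfer f x n j * (u j + r j).
Proof.
elim: n => [_|n IH nN]; first by rewrite big_geq// /e z0 subrr.
rewrite big_nat_recr//= transfer_nn mul1r.
rewrite (_ : \sum_(_ <= j < _) _ =
  f1 (iter n f x) * \sum_(1 <= j < n.+1) transfer f x n j * (u j + r j)).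
  rewrite -IH ?(ltnW nN)// /e zS// iterS /r/= /e; ring.
rewrite mulr_sumr; apply: eq_big_nat => j /andP[_ jn].
by rewrite transferS// mulrA.
Qed.

Let H := Lambda_hat f x N.
Hypothesis small : 4 * K * mu * H ^+ 2 <= 1.

(** A bootstrap: if all previous errors are at most [2 * mu * H], the quadratic
    remainders are at most [4 * K * mu ^+ 2 * H ^+ 2 <= mu], so perturbations and
    remainders together are at most [2 * mu], and the transfer coefficients sum to
    at most [H]. *)
Lemma error_le n : (n <= N)%N -> `|e n| <= 2 * mu * H.
Proof.
have H1 : 1 <= H := Lambda_hat_ge1 N.
elim/ltn_ind: n => n IH nN.
rewrite error_variation_of_constants//.
apply: le_trans (ler_norm_sum _ _ _) _.
apply: (@le_trans _ _ (\sum_(1 <= j < n.+1) `|transfer f x n j| * (2 * mu))).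
  apply: ler_sum_nat => j /andP[j0 jn]; rewrite normrM ler_wpM2l//.
  rewrite (le_trans (ler_normD _ _))// mulr2n mulrDl mul1r lerD//.
    by apply: u_mu; rewrite j0 (leq_trans _ nN).
  have jN : (j.-1 < N)%N by rewrite prednK// (leq_trans _ nN).
  have ej : `|e j.-1| <= 2 * mu * H by apply: IH; rewrite ?prednK// ltnW.
  rewrite (le_trans (quadratic jN))// -/(e j.-1) -real_normK ?num_real//.
  apply: (@le_trans _ _ (K * (2 * mu * H) ^+ 2)).
    by rewrite ler_wpM2l// ler_sqr ?nnegrE// (le_trans _ ej).
  rewrite (_ : K * _ = mu * (4 * K * mu * H ^+ 2)); last by ring.
  by rewrite ler_piMr.
rewrite -mulr_suml mulrC ler_wpM2l ?mulr_ge0//.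
exact: transfer_sum_le_Lambda_hat.
Qed.

Lemma linearization_error :
  `|e N - \sum_(1 <= j < N.+1) transfer f x N j * u j|
    <= 4 * K * mu ^+ 2 * H ^+ 3.
Proof.
have H1 : 1 <= H := Lambda_hat_ge1 N.
rewrite error_variation_of_constants// -sumrB.
apply: le_trans (ler_norm_sum _ _ _) _.
apply: (@le_trans _ _ (\sum_(1 <= j < N.+1) `|transfer f x N j| * (4 * K * mu ^+ 2 * H ^+ 2))).
  apply: ler_sum_nat => j /andP[j0 jn].
  rewrite -mulrBr addrC addKr normrM ler_wpM2l//.
  have jN : (j.-1 < N)%N by rewrite prednK// (leq_trans _ nN).
  have ej : `|e j.-1| <= 2 * mu * H by apply: error_le; exact: ltnW.
  rewrite (le_trans (quadratic jN))// -/(e j.-1) -real_normK ?num_real//.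
  apply: (@le_trans _ _ (K * (2 * mu * H) ^+ 2)).
    by rewrite ler_wpM2l// ler_sqr ?nnegrE// (le_trans _ ej).
  by rewrite le_eqVlt; apply/orP; left; apply/eqP; ring.
rewrite -mulr_suml (_ : 4 * _ * _ * H ^+ 3 = H * (4 * K * mu ^+ 2 * H ^+ 2)); last by ring.
rewrite ler_wpM2r; [by []| |exact: transfer_sum_le_Lambda_hat].
by rewrite !mulr_ge0 ?exprn_ge0// (le_trans ler01).
Qed.

End error_propagation.
Section taylor.
Context {R : realType}.
Implicit Types (f : R -> R) (D : set R).

Lemma itv_interior D (y z : R) : is_interval D -> D y -> D z ->
  `]y, z[%classic `<=` D°.
Proof.
move=> iD Dy Dz; rewrite -open_subsetE; last exact: interval_open.
by move=> t; rewrite /= in_itv/= => /andP[h1 h2]; apply: (iD y z) => //; rewrite !ltW.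
Qed.

Lemma mean_value_between D f (f1 : R -> R) (y z : R) : is_interval D ->
  {within D, continuous f} -> (forall t, D° t -> is_derive t (1 : R) f (f1 t)) ->
  D y -> D z ->
  exists2 c, D c /\ `|c - y| <= `|z - y| & f z - f y = f1 c * (z - y).
Proof.
move=> iD cf df Dy Dz; have [yz|zy] := leP y z.
- have [|c] := MVT_segment yz (fun t (h : t \in `]y, z[) => df t (itv_interior iD Dy Dz h)).
    apply: continuous_subspaceW cf => t; rewrite /= in_itv/=.
    by move=> h; apply: (iD y z).
  rewrite in_itv/= => /andP[h1 h2] h3; exists c => //; split.
    by apply: (iD y z) => //; rewrite h1.
  by rewrite !ger0_norm ?subr_ge0//; lra.
- have [|c] := MVT_segment (ltW zy) (fun t (h : t \in `]z, y[) => df t (itv_interior iD Dz Dy h)).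
    apply: continuous_subspaceW cf => t; rewrite /= in_itv/=.
    by move=> h; apply: (iD z y).
  rewrite in_itv/= => /andP[h1 h2] h3; exists c.
    split; first by apply: (iD z y) => //; rewrite h1.
    by rewrite !ler0_norm ?subr_le0 ?(ltW zy)//; lra.
  have -> : f z - f y = - (f y - f z) by ring.
  by rewrite h3; ring.
Qed.

(** The mean value theorem is applied to [f] and then to [f1], the intermediate
    point of the first application being no further from [y] than [z]. *)
Lemma quadratic_remainder D f (f1 f2 : R -> R) (K y z : R) : is_interval D ->
  {within D, continuous f} -> {within D, continuous f1} ->
  (forall t, D° t -> is_derive t (1 : R) f (f1 t)) ->
  (forall t, D° t -> is_derive t (1 : R) f1 (f2 t)) ->
  (forall t, D t -> `|f2 t| <= K) -> D y -> D z ->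
  `|f z - f y - f1 y * (z - y)| <= K * (z - y) ^+ 2.
Proof.
move=> iD cf cf1 df df1 f2K Dy Dz.
have [c [Dc cy] ->] := mean_value_between iD cf df Dy Dz.
have [e [De _] Ee] := mean_value_between iD cf1 df1 Dy Dc.
rewrite -mulrBl Ee !normrM -real_normK ?num_real// expr2 mulrA.
by rewrite ler_wpM2r// ler_pM// f2K.
Qed.

End taylor.
(** * Phase spaces *)

Section phase_spaces.
Context {R : realType}.
Implicit Types (M : phase_space) (f h : R -> R) (a x y : R).

(** The region visited by the noisy orbits on the good events. *)
Definition noise_domain M a : set R :=
  if M is Defs.Interval then `[-1 - a, 1 + a]%classic else setT.

Lemma carrier_setT M : M <> Defs.Interval -> carrier M = setT :> set R.
Proof. by case: M. Qed.

Lemma noise_domain_interval M a : is_interval (noise_domain M a).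
Proof. by case: M => //=; exact: interval_is_interval. Qed.

Lemma carrier_sub_interior M a f : A2 M a f ->
  carrier M `<=` (noise_domain M a)°.
Proof.
case: M => A2f y; rewrite ?interiorT//.
have [a0 _ _] := A2f erefl.
rewrite /noise_domain interior_itv_bnd /= !in_itv/= => /andP[h1 h2].
by apply/andP; split; lra.
Qed.

Lemma C2_noise_domain M a f : A1 M f -> A2 M a f -> C2_on (noise_domain M a) f.
Proof. by case: M => -[_ C2f _] A2f //; have [] := A2f erefl. Qed.

Lemma noise_domain_image M a f y : A2 M a f -> noise_domain M a y ->
  carrier M (f y).
Proof. by case: M => // A2f Dy; have [_ _] := A2f erefl; apply; exists y. Qed.

Lemma iter_carrier M f x m : A1 M f -> carrier M x -> carrier M (iter m f x).
Proof.
by move=> [fM _ _] Mx; elim: m => //= m IH; apply: fM; exists (iter m f x).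
Qed.

Lemma derive1_eq_on_open (U : set R) f (f1 : R -> R) y : open U ->
  (forall t, U t -> is_derive t (1 : R) f (f1 t)) -> U y -> derive1 f y = f1 y.
Proof. by move=> oU df Uy; rewrite derive1E; have ? := df _ Uy; exact: derive_val. Qed.

Lemma derive2_eq_on_open (U : set R) f (f1 f2 : R -> R) y : open U ->
  (forall t, U t -> is_derive t (1 : R) f (f1 t)) ->
  (forall t, U t -> is_derive t (1 : R) f1 (f2 t)) -> U y ->
  derive1 (derive1 f) y = f2 y.
Proof.
move=> oU df df1 Uy; rewrite derive1E.
rewrite (@near_eq_derive _ _ _ _ f1); first by have ? := df1 _ Uy; exact: derive_val.
have : \forall t \near y, U t by exact: open_nbhs_nbhs.
by apply: filterS => t; exact: derive1_eq_on_open.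
Qed.

Lemma C0_norm_ge0 M h : (0 <= C0_norm M h)%E.
Proof.
apply: (@le_trans _ _ `|h 0|%:E); first by rewrite lee_fin.
apply: ereal_sup_ubound; exists 0 => //.
by case: M => //=; rewrite in_itv/=; apply/andP; split; lra.
Qed.

Lemma le_C0_norm M h y : (C0_norm M h < +oo)%E -> carrier M y ->
  `|h y| <= fine (C0_norm M h).
Proof.
move=> hoo My; rewrite -lee_fin fineK; last by rewrite ge0_fin_numE// C0_norm_ge0.
by apply: ereal_sup_ubound; exists y.
Qed.

(** A map that is affine on [[-1, 1]], with slope of absolute value at least [1],
    and sends this interval to itself takes the value [1] at an endpoint.  As the values on the larger interval do
    not exceed [1], this endpoint is an interior maximum, where the derivative
    vanishes: a contradiction. *)
Lemma affine_contraction a f (f1 : R -> R) : 0 < a ->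
  (forall t : R, `]-1 - a, 1 + a[%classic t -> is_derive t (1 : R) f (f1 t)) ->
  (forall t : R, `[-1 - a, 1 + a]%classic t -> -1 <= f t <= 1) ->
  (forall t : R, -1 <= t <= 1 -> f1 t = f1 1) ->
  `|f1 1| < 1.
Proof.
move=> a0 df fb f1c.
have inO (t : R) : -1 <= t <= 1 -> `]-1 - a, 1 + a[%classic t.
  by move=> /andP[h1 h2]; rewrite /= in_itv/=; apply/andP; split; lra.
have inC (t : R) : `]-1 - a, 1 + a[%classic t -> `[-1 - a, 1 + a]%classic t.
  by rewrite /= !in_itv/= => /andP[h1 h2]; apply/andP; split; lra.
have Dx (t : R) : t \in `]-1 - a, 1 + a[ -> derivable f t 1 by move=> /df [].
have Ec : f 1 - f (-1) = f1 1 * 2.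

  have N11 : -1 <= 1 :> R. by lra.
  have dI : forall t : R, t \in `]-1, 1[ -> is_derive t (1 : R) f (f1 t).
    move=> t; rewrite in_itv/= => /andP[h1 h2]; apply: df; apply: inO.
    by rewrite !ltW.
  have cI : {within `[-1, 1], continuous f}.
    apply: derivable_within_continuous => t; rewrite in_itv/= => ht.
    exact: Dx (inO _ ht).
  have [c hc ->] := @MVT_segment R f f1 (-1) 1 N11 dI cI.
  rewrite f1c//. congr (_ * _); ring.
have e1 : -1 <= (1 : R) <= 1 by apply/andP; split; lra.
have eN1 : -1 <= (-1 : R) <= 1 by apply/andP; split; lra.
have max (s : R) : -1 <= s <= 1 -> f s = 1 -> f1 s = 0.
  move=> hs fs; have h := inO _ hs.
  have [|t ht|_ Ed] := @derive1_at_max _ f (-1 - a) (1 + a) s _ Dx h.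
  - by lra.
  - by rewrite fs; have /andP[] := fb _ (inC _ ht).
  by have [_ <-] := df _ h.
have /andP[g1 g2] := fb _ (inC _ (inO _ e1)).
have /andP[g3 g4] := fb _ (inC _ (inO _ eN1)).
rewrite ltr_norml; apply/andP; split; rewrite ltNge; apply/negP => h.
- have : f1 (-1) = 0 by apply: max => //; lra.
  by rewrite f1c//; lra.
- have : f1 1 = 0 by apply: max => //; lra.
  by lra.
Qed.

End phase_spaces.
(** Along a uniformly contracting orbit the influence of the past is summable, so
    [Lambda f 2] stays bounded while [Lambda f p] is at least [1]: Lyapunov's
    condition fails. *)
Section contraction.
Context {R : realType}.
Variables (f f1 : R -> R) (x q : R).
Hypothesis f_f1 : forall m, is_derive (iter m f x) (1 : R) f (f1 (iter m f x)).
Hypothesis q_lt1 : q < 1.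
Hypothesis f1q : forall m, `|f1 (iter m f x)| <= q.

Let q_ge0 : 0 <= q. Proof. exact: le_trans (f1q 0). Qed.

Let q2 : 0 < 1 - q ^+ 2.
Proof. by rewrite subr_gt0 expr_lt1. Qed.

Lemma contraction_Lambda2_le n : Lambda f 2 x n <= (1 - q ^+ 2)^-1.
Proof.
elim: n => [|n IH]; first by rewrite /Lambda big_geq// invr_ge0 ltW.
rewrite (Lambda2E f x) big_nat_recr//= (transfer_nn f_f1) expr1n.
have -> : \sum_(1 <= j < n.+1) transfer f x n.+1 j ^+ 2 =
    f1 (iter n f x) ^+ 2 * Lambda f 2 x n.
  rewrite (Lambda2E f x) mulr_sumr; apply: eq_big_nat => j /andP[_ jn].
  by rewrite (transferS f_f1)// exprMn.
have L0 : 0 <= Lambda f 2 x n by apply: sumr_ge0 => j _; exact: powR_ge0.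
have f2q : f1 (iter n f x) ^+ 2 <= q ^+ 2.
  by rewrite -real_normK ?num_real// ler_sqr ?nnegrE.
apply: (@le_trans _ _ (q ^+ 2 * (1 - q ^+ 2)^-1 + 1)).
  by rewrite lerD2r ler_pM// sqr_ge0.
by rewrite le_eqVlt; apply/orP; left; apply/eqP; field; rewrite gt_eqF.
Qed.

Lemma contraction_not_lyapunov p (n_ : nat -> nat) : 0 <= p ->
  (forall k, (0 < n_ k)%N) ->
  ~ (Lambda f p x (n_ k) / Lambda f 2 x (n_ k) `^ (p / 2) @[k --> \oo] --> (0 : R)).
Proof.
move=> p0 n0 h; set b := ((1 - q ^+ 2)^-1) `^ (p / 2).
have b0 : 0 < b by rewrite powR_gt0// invr_gt0.
have bV : 0 < b^-1 by rewrite invr_gt0.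
have [k] := filter_ex (cvgr_lt _ h _ bV); apply/negP; rewrite -leNgt.
have L1 := Lambda_ge1 f_f1.
rewrite -[leLHS]mul1r ler_pM ?invr_ge0 ?(ltW b0) ?L1//.
have Lp : 0 < Lambda f 2 x (n_ k) by apply: lt_le_trans (L1 _ _ (n0 k)).
rewrite lef_pV2 ?posrE ?powR_gt0 ?invr_gt0//.
apply: ge0_ler_powR; rewrite ?nnegrE ?divr_ge0 ?invr_ge0 ?(ltW Lp) ?(ltW q2)//.
exact: contraction_Lambda2_le.
Qed.

End contraction.

Section regularity.
Context {R : realType}.
Implicit Types (M : phase_space) (f : R -> R) (a x y : R).

(** The second derivative must be controlled on the whole noise domain, whereas
    [F] is its supremum on the phase space.  Nothing is to be done on the line and
    on the circle.  On the interval the second derivative is bounded on the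
    compact domain, and it suffices to know that [F] is positive in order to write
    this bound as [kappa * F]; if [F] were zero the map would be affine, hence a
    contraction by [affine_contraction], against Lyapunov's condition. *)
Lemma quadratic_control M a f p x (n_ : nat -> nat) :
  A1 M f -> A2 M a f -> carrier M x -> 0 <= p -> (forall k, (0 < n_ k)%N) ->
  Lambda f p x (n_ k) / Lambda f 2 x (n_ k) `^ (p / 2) @[k --> \oo] --> (0 : R) ->
  (C0_norm M (derive1 (derive1 f)) < +oo)%E ->
  let F := fine (C0_norm M (derive1 (derive1 f))) in
  exists (f1 : R -> R) (kappa : R),
  [/\ 0 < kappa,
      forall y, carrier M y -> is_derive y (1 : R) f (f1 y),
      forall y z, carrier M y -> noise_domain M a z ->
        `|f z - f y - f1 y * (z - y)| <= kappa * F * (z - y) ^+ 2 &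
      M = Defs.Interval -> 0 < F].
Proof.
move=> fA1 fA2 Mx p0 n0 lyap Foo F.
have [f1 [f2 [cf cf1 cf2 df df1]]] := C2_noise_domain fA1 fA2.
have MD := carrier_sub_interior fA2.
have iD := @noise_domain_interval R M a.
have MD' y : carrier M y -> noise_domain M a y by move=> /MD; exact: interior_subset.
have dfM y : carrier M y -> is_derive y (1 : R) f (f1 y) by move=> /MD/df.
have F0 : 0 <= F by rewrite fine_ge0// C0_norm_ge0.
have f2F y : carrier M y -> `|f2 y| <= F.
  move=> My; rewrite -(derive2_eq_on_open (open_interior _) df df1 (MD _ My)).
  exact: (le_C0_norm Foo My).
have [MI|MI] := pselect (M = Defs.Interval); last first.
  exists f1, 1; split=> // y z My Dz; rewrite mul1r.
  apply: (quadratic_remainder iD cf cf1 df df1) => //; last exact: MD'.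
  by move=> t _; apply: f2F; rewrite carrier_setT.
subst M; have [a0 _ fD] := fA2 erefl.
have [K K0 f2K] : exists2 K, 0 < K & forall t, noise_domain Defs.Interval a t -> `|f2 t| <= K.
  have cD : compact (noise_domain Defs.Interval a) by exact: segment_compact.
  have /compact_bounded[B [_ hB]] := continuous_compact cf2 cD.
  exists (`|B| + 1); first by rewrite ltr_wpDl.
  move=> t Dt; apply: (hB (`|B| + 1)); last by exists t.
  by rewrite (le_lt_trans (ler_norm _))// ltrDl.
have Fgt0 : 0 < F.
  rewrite lt_neqAle F0 andbT; apply/negP => /eqP F00.
  have inM (t : R) : -1 <= t <= 1 -> carrier Defs.Interval t by rewrite /= in_itv.
  have f1c (t : R) : -1 <= t <= 1 -> f1 t = f1 1.
    move=> ht.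
    have iI : is_interval (`[-1, 1]%classic : set R) by exact: interval_is_interval.
    have cI : {within `[-1, 1], continuous f1}.
      by apply: continuous_subspaceW cf1 => s /MD'.
    have dI s : (`[-1, 1]%classic : set R)° s -> is_derive s (1 : R) f1 (f2 s).
      by move=> /interior_subset/MD/df1.
    have I1 : -1 <= (1 : R) <= 1 by apply/andP; split; lra.
    have [c [Mc _]] := mean_value_between iI cI dI (inM _ I1) (inM _ ht).
    have -> : f2 c = 0 by apply/eqP; rewrite -normr_le0 F00 f2F.
    by rewrite mul0r => /eqP; rewrite subr_eq0 => /eqP.
  have q1 : `|f1 1| < 1.
    have dfo (t : R) : `]-1 - a, 1 + a[%classic t -> is_derive t (1 : R) f (f1 t).
      by move=> ht; apply: df; rewrite /noise_domain interior_itv_bnd.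
    have fb (t : R) : `[-1 - a, 1 + a]%classic t -> -1 <= f t <= 1.
      by move=> ht; have := fD (f t); rewrite /= in_itv/=; apply; exists t.
    exact: (affine_contraction a0 dfo fb f1c).
  apply: (contraction_not_lyapunov (x := x) _ q1 _ p0 n0 lyap) => m.
    exact/dfM/iter_carrier.
  by rewrite f1c//; have := iter_carrier m fA1 Mx; rewrite /= in_itv.
exists f1, (K / F); split=> //; first by rewrite divr_gt0.
move=> y z My Dz; rewrite divfK ?gt_eqF//.
by apply: (quadratic_remainder iD cf cf1 df df1) => //; exact: MD'.
Qed.

End regularity.

(** * Noisy orbits *)

Section noisy_orbits.
Context {R : realType} d {T : measurableType d} {P : probability T R}.
Variables (M : phase_space) (a : R) (f : R -> R) (xi : nat -> {RV P >-> R}).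
Hypotheses (fA1 : A1 M f) (fA2 : A2 M a f).

Lemma le_max_noise n j w : (0 < j <= n)%N -> `|xi j w| <= max_noise xi n w.
Proof.
move=> jn; apply: (le_bigmax_seq 0 j xpredT (fun j => `|xi j w|)) => //.
by rewrite mem_index_iota.
Qed.

Lemma max_noise_ge0 n w : 0 <= max_noise xi n w.
Proof. by rewrite /max_noise; elim/big_rec: _ => // i y _ y0; rewrite le_max y0 orbT. Qed.

Lemma max_noise_le n w (b : R) : 0 <= b ->
  (forall j, (0 < j <= n)%N -> `|xi j w| <= b) -> max_noise xi n w <= b.
Proof.
move=> b0 h; rewrite /max_noise big_nat; exact: bigmax_le.
Qed.

Variables (x sigma : R).
Hypotheses (Mx : carrier M x) (sigma0 : 0 < sigma).

Lemma noisy_orbit_domain n m w : good_event M a xi sigma n w -> (m <= n)%N ->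
  noise_domain M a (noisy_orbit f xi x sigma m w).
Proof.
move=> Gw; elim: m => [_|m IH mn].
  exact: interior_subset (carrier_sub_interior fA2 Mx).
have := noise_domain_image fA2 (IH (ltnW mn)).
case: M Gw => //= Gw; rewrite !in_itv/= => /andP[h1 h2].
have : `|sigma * xi m.+1 w| <= a.
  rewrite normrM gtr0_norm// (le_trans _ Gw)// ler_wpM2l ?(ltW sigma0)//.
  exact: le_max_noise.
by move=> /ler_normlP[h3 h4]; apply/andP; split; lra.
Qed.

(* on the good event the noisy orbit only sees the values of [f] on the noise
   domain, where [f] is continuous; elsewhere [f] need not be measurable *)
Let g := f \_ (noise_domain M a).

Let mD : measurable (noise_domain M a : set R).
Proof. by rewrite /noise_domain; case: M. Qed.

Let mg : measurable_fun setT g.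
Proof.
apply/(measurable_restrictT _ mD); apply: subspace_continuous_measurable_fun => //.
by have [f1 [f2 []]] := C2_noise_domain fA1 fA2.
Qed.

Let noisy_orbit_g n m w : good_event M a xi sigma n w -> (m <= n)%N ->
  noisy_orbit f xi x sigma m w = noisy_orbit g xi x sigma m w.
Proof.
move=> Gw; elim: m => //= m IH mn; rewrite -IH ?(ltnW mn)// /g patchE mem_set//.
by apply: noisy_orbit_domain Gw _; exact: ltnW.
Qed.

Lemma measurable_deviation n : measurable_fun setT (deviation M a f xi x sigma n).
Proof.
have mo m : measurable_fun setT (noisy_orbit g xi x sigma m).
  elim: m => [|m IH]; first exact: measurable_cst.
  apply: measurable_funD; first exact: measurableT_comp.
  exact: measurable_funM.
have mG := measurable_good_event M a xi sigma n.
apply: (@eq_measurable_fun _ _ _ _ _ (fun w =>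
    (noisy_orbit g xi x sigma n w - iter n f x) *
      \1_(good_event M a xi sigma n) w)); last first.
  apply: measurable_funM; first exact: measurable_funB.
  exact: measurable_indic.
move=> w _; rewrite /deviation indicE; case: (boolP (w \in _)) => [|_].
  by rewrite inE => Gw; rewrite (noisy_orbit_g Gw).
by rewrite !mulr0.
Qed.

Lemma deviation_linearization (f1 : R -> R) (K tau : R) n w : 0 <= K -> 0 <= tau ->
  (forall y, carrier M y -> is_derive y (1 : R) f (f1 y)) ->
  (forall y z, carrier M y -> noise_domain M a z ->
    `|f z - f y - f1 y * (z - y)| <= K * (z - y) ^+ 2) ->
  4 * K * (sigma * tau) * Lambda_hat f x n ^+ 2 <= 1 ->
  good_event M a xi sigma n w -> max_noise xi n w <= tau ->
  `|deviation M a f xi x sigma n w - sigma * linear_noise f xi x n w|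
    <= 4 * K * (sigma * tau) ^+ 2 * Lambda_hat f x n ^+ 3.
Proof.
move=> K0 tau0 df qK small Gw wtau.
have -> : sigma * linear_noise f xi x n w =
    \sum_(1 <= j < n.+1) transfer f x n j * (sigma * xi j w).
  by rewrite /linear_noise mulr_sumr; apply: eq_bigr => j _; rewrite mulrCA.
have Mi m := iter_carrier m fA1 Mx.
rewrite /deviation indicE mem_set// mulr1.
apply: (@linearization_error _ f f1 x _ K (sigma * tau) n
  (fun m => noisy_orbit f xi x sigma m w) (fun j => sigma * xi j w)) => //.
- by move=> m; exact: df.
- by rewrite mulr_ge0// ltW.
- move=> m mn; rewrite normrM gtr0_norm// ler_wpM2l ?(ltW sigma0)//.
  exact: le_trans (le_max_noise _ mn) wtau.
- by move=> m mn; apply: qK => //; apply: noisy_orbit_domain Gw _; exact: ltnW.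
Qed.

End noisy_orbits.

(** * Moments of the noise *)

Section noise_moments.
Context d (T : measurableType d) (R : realType) (P : probability T R).

Lemma measurable_normr_powR (X : T -> R) (p : R) : measurable_fun setT X ->
  measurable_fun setT (fun w => `|X w| `^ p).
Proof.
move=> mX; apply: (@measurableT_comp _ _ _ _ _ _ (fun y : R => y `^ p)) => //.
exact: measurableT_comp.
Qed.

Lemma Lnorm_moment (X : T -> R) (p : R) : measurable_fun setT X -> 0 < p ->
  ('N[P]_p%:E[EFin \o X] < +oo)%E ->
  P.-integrable setT (EFin \o (fun w => `|X w| `^ p)) /\
  \int[P]_w (`|X w| `^ p) = fine 'N[P]_p%:E[EFin \o X]%E `^ p.
Proof.
move=> mX p0 Noo; have mXp := measurable_normr_powR p mX.
have N0 : (0 <= 'N[P]_p%:E[EFin \o X])%E by exact: Lnorm_ge0.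
have Nf : 'N[P]_p%:E[EFin \o X]%E = (fine 'N[P]_p%:E[EFin \o X]%E)%:E.
  by rewrite fineK// ge0_fin_numE.
have E : (\int[P]_w (`|X w| `^ p)%:E)%E = (fine 'N[P]_p%:E[EFin \o X]%E `^ p)%:E.
  by rewrite -poweR_EFin -Nf poweR_Lnorm ?gt_eqF.
split; last by rewrite /Rintegral E.
apply/integrableP; split; first exact/measurable_EFinP.
under eq_integral do rewrite /= ger0_norm ?powR_ge0//.
by rewrite E ltry.
Qed.

Lemma Lnorm_lty (X : T -> R) (p : R) : 0 < p ->
  P.-integrable setT (EFin \o (fun w => `|X w| `^ p)) ->
  ('N[P]_p%:E[EFin \o X] < +oo)%E.
Proof.
move=> p0 /integrableP[_]; under eq_integral do rewrite /= ger0_norm ?powR_ge0//.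
move=> h; have pn : p != 0 by rewrite gt_eqF.
by apply: (lty_poweRy pn); rewrite poweR_Lnorm.
Qed.

(** Markov's inequality for the [p]-th moment gives [theta `^ p], which is at
    most [theta]. *)
Lemma markov_powR (X : T -> R) (p tau theta : R) : measurable_fun setT X ->
  1 <= p -> 0 < tau -> 0 < theta <= 1 ->
  P.-integrable setT (EFin \o (fun w => `|X w| `^ p)) ->
  \int[P]_w (`|X w| `^ p) <= (tau * theta) `^ p ->
  pr P [set w | tau < `|X w|] <= theta.
Proof.
move=> mX p1 t0 th iX Xle; have /andP[th0 th1] := th.
have mA : measurable [set w | tau < `|X w|].
  by apply: measurable_gt_cst; exact: measurableT_comp.
have p0 : 0 <= p by lra.
apply: (@le_trans _ _ (theta `^ p)); last first.
  by apply: le_trans (ger_powR th p1) _; rewrite powRr1 ?(ltW th0).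
have tp : 0 < tau `^ p by rewrite powR_gt0.
rewrite -(ler_pM2l tp) -powRM ?(ltW t0) ?(ltW th0)//; apply: le_trans Xle.
rewrite -Rintegral_indic_pr// -RintegralZl//; last exact: integrable_indic_pr.
apply: le_Rintegral => //.
- by apply: integrable_scale; exact: integrable_indic_pr.
- move=> w _; rewrite indicE; case: (boolP (_ \in _)) => [|_].
    rewrite inE/= mulr1 => h.
    by apply: ge0_ler_powR; rewrite ?nnegrE ?(ltW t0) ?(ltW h).
  by rewrite mulr0 powR_ge0.
Qed.

End noise_moments.

Section noise_hypotheses.
Context d (T : measurableType d) (R : realType) (P : probability T R).
Variables (xi : nat -> {RV P >-> R}) (p : R).
Hypothesis p_gt2 : 2 < p.

Lemma A3_moments : A3 xi p -> exists c C : R, [/\ 0 < c, 0 < C,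
  forall j, (0 < j)%N -> [/\ P.-integrable setT (EFin \o xi j),
    P.-integrable setT (EFin \o (fun w => xi j w ^+ 2)),
    \int[P]_w xi j w = 0, c ^+ 2 <= second_moment xi j &
    second_moment xi j <= C ^+ 2] &
  forall j, (0 < j)%N -> [/\
    P.-integrable setT (EFin \o (fun w => `|xi j w| `^ p)),
    \int[P]_w (`|xi j w| `^ p) <= C `^ p & c `^ p <= \int[P]_w (`|xi j w| `^ p)]].
Proof.
move=> [xi0 [c [C [c0 C0 xiN]]]]; exists c, C.
have p0 : 0 < p by exact: lt_trans p_gt2.
have N j r : (0 <= 'N[P]_r%:E[EFin \o xi j])%E by exact: Lnorm_ge0.
split=> // j j0; have [cN2 N2p NpC] := xiN _ j0.
- have N2oo : ('N[P]_2%:E[EFin \o xi j] < +oo)%E.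
    by apply: le_lt_trans (le_trans N2p NpC) _; rewrite ltry.
  have [||i2 E2] := Lnorm_moment _ _ N2oo => //.
  have sqrE : (fun w => `|xi j w| `^ 2) = (fun w => xi j w ^+ 2).
    by apply/funext => w; rewrite powR_mulrn// real_normK ?num_real.
  rewrite sqrE in i2 E2.
  have i1 := integrable_of_sqr (@measurable_funPT _ _ _ _ (xi j)) i2.
  have fE : (fine 'N[P]_2%:E[EFin \o xi j]%E)%:E = 'N[P]_2%:E[EFin \o xi j]%E.
    by rewrite fineK// ge0_fin_numE.
  have E2' : second_moment xi j = fine 'N[P]_2%:E[EFin \o xi j]%E ^+ 2.
    by rewrite /second_moment E2 powR_mulrn// fine_ge0.
  split=> //.
  + by have := xi0 _ j0; rewrite unlock /Rintegral => ->.
  + by rewrite E2' ler_sqr ?nnegrE ?fine_ge0 ?(ltW c0)// -lee_fin fE.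
  + rewrite E2' ler_sqr ?nnegrE ?fine_ge0 ?(ltW C0)// -lee_fin fE.
    exact: le_trans N2p NpC.
- have Npoo : ('N[P]_p%:E[EFin \o xi j] < +oo)%E.
    by apply: le_lt_trans NpC _; rewrite ltry.
  have [||ip ->] := Lnorm_moment _ _ Npoo => //.
  have fE : (fine 'N[P]_p%:E[EFin \o xi j]%E)%:E = 'N[P]_p%:E[EFin \o xi j]%E.
    by rewrite fineK// ge0_fin_numE.
  split=> //; apply: ge0_ler_powR; rewrite ?nnegrE ?fine_ge0 ?(ltW c0) ?(ltW C0) ?(ltW p0)//.
  + by rewrite -lee_fin fE.
  + by rewrite -lee_fin fE (le_trans cN2).
Qed.

Let p_gt0 : 0 < p. Proof. exact: lt_trans p_gt2. Qed.

Lemma max_noise_powR_le n w :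
  max_noise xi n w `^ p <= \sum_(1 <= j < n.+1) `|xi j w| `^ p.
Proof.
rewrite /max_noise; elim: (index_iota 1 n.+1) => [|j s IH].
  by rewrite !big_nil powR0// gt_eqF.
rewrite !big_cons; case: (leP `|xi j w| (\big[Num.max/0]_(j <- s) `|xi j w|)) => _; first by rewrite (le_trans IH)// lerDr powR_ge0.
by rewrite lerDl sumr_ge0// => i _; exact: powR_ge0.
Qed.

(** Finite because the power of a maximum is at most the sum of the powers, and
    bounded below by the norm of a single term. *)
Lemma max_noise_Lnorm (c : R) n : 0 < c ->
  (forall j, (0 < j)%N -> P.-integrable setT (EFin \o (fun w => `|xi j w| `^ p))) ->
  c `^ p <= \int[P]_w (`|xi n w| `^ p) -> (0 < n)%N ->
  let N := fine 'N[P]_p%:E[EFin \o max_noise xi n]%E in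
  [/\ 'N[P]_p%:E[EFin \o max_noise xi n]%E = N%:E,
      P.-integrable setT (EFin \o (fun w => `|max_noise xi n w| `^ p)),
      \int[P]_w (`|max_noise xi n w| `^ p) = N `^ p & c <= N].
Proof.
move=> c0 ip cp n0 N.
have mm := measurable_max_noise xi n.
have N0 : (0 <= 'N[P]_p%:E[EFin \o max_noise xi n])%E by exact: Lnorm_ge0.
have iS m : P.-integrable setT (EFin \o (fun w => \sum_(1 <= j < m.+1) `|xi j w| `^ p)).
  elim: m => [|m IH]; first by under eq_fun do rewrite big_nil; exact: integrable_cst.
  by under eq_fun do rewrite big_nat_recr//=; apply: integrableDr => //; exact: ip.
have iM : P.-integrable setT (EFin \o (fun w => `|max_noise xi n w| `^ p)).
  apply: (dominated_integrable _ _ (iS n)); first exact: measurable_normr_powR.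
  move=> w; rewrite ger0_norm ?powR_ge0// ger0_norm ?max_noise_ge0//.
  exact: max_noise_powR_le.
have Noo := Lnorm_lty p_gt0 iM.
have [_ E] := Lnorm_moment mm p_gt0 Noo.
have NE : 'N[P]_p%:E[EFin \o max_noise xi n]%E = N%:E by rewrite fineK// ge0_fin_numE.
split=> //; rewrite leNgt; apply/negP => Nc.
have : N `^ p < c `^ p by apply: gt0_ltr_powR; rewrite ?nnegrE ?fine_ge0 ?(ltW c0).
rewrite ltNge => /negP; apply; apply: le_trans cp _; rewrite -E.
apply: le_Rintegral => //; first exact: ip.
move=> w _; apply: ge0_ler_powR; rewrite ?nnegrE ?(ltW p_gt0)//.
rewrite [leRHS]ger0_norm ?max_noise_ge0//; apply: le_max_noise.
by rewrite n0 leqnn.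
Qed.

End noise_hypotheses.

(** * Linearized noise and scaling limit *)

Section linearized_noise.
Context d (T : measurableType d) (R : realType) (P : probability T R).
Variables (xi : nat -> {RV P >-> R}) (p c C : R).
Hypothesis xi_indep : mutually_independent [set n | (0 < n)%N] xi.
Hypothesis p_gt2 : 2 < p.
Hypotheses (c_gt0 : 0 < c) (C_gt0 : 0 < C).
Hypothesis xi2 : forall j, (0 < j)%N -> [/\ P.-integrable setT (EFin \o xi j),
  P.-integrable setT (EFin \o (fun w => xi j w ^+ 2)),
  \int[P]_w xi j w = 0, c ^+ 2 <= second_moment xi j &
  second_moment xi j <= C ^+ 2].
Hypothesis xip : forall j, (0 < j)%N -> [/\
  P.-integrable setT (EFin \o (fun w => `|xi j w| `^ p)),
  \int[P]_w (`|xi j w| `^ p) <= C `^ p &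
  c `^ p <= \int[P]_w (`|xi j w| `^ p)].
Variables (f f1 : R -> R) (x : R).
Hypothesis f_f1 : forall m, is_derive (iter m f x) (1 : R) f (f1 (iter m f x)).

Let xi_int j : (0 < j)%N -> P.-integrable setT (EFin \o xi j).
Proof. by move=> /xi2[]. Qed.
Let xi_sqr j : (0 < j)%N -> P.-integrable setT (EFin \o (fun w => xi j w ^+ 2)).
Proof. by move=> /xi2[]. Qed.
Let xi_mean j : (0 < j)%N -> \int[P]_w xi j w = 0.
Proof. by move=> /xi2[]. Qed.

Let moments := weighted_sum_moments xi_indep xi_int xi_sqr xi_mean.

Lemma variance_linear_noise n : fine 'V_P[linear_noise f xi x n] =
  weighted_variance xi (transfer f x n) n.
Proof.
have [i1 i2 E1 E2] := moments (transfer f x n) n.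
rewrite fine_varianceE//; last exact: measurable_weighted_sum.
by rewrite -[linear_noise f xi x n]/(weighted_sum xi (transfer f x n) n) E1 E2 expr0n subr0.
Qed.

Local Notation s n := (Num.sqrt (fine 'V_P[linear_noise f xi x n])).

Lemma sqrt_variance_ge n : c * Num.sqrt (Lambda f 2 x n) <= s n.
Proof.
rewrite -(gtr0_norm c_gt0) -sqrtr_sqr -sqrtrM ?sqr_ge0//.
rewrite ler_wsqrtr// variance_linear_noise (Lambda2E f x) mulr_sumr.
apply: ler_sum_nat => j /andP[j0 _]; rewrite mulrC ler_wpM2l ?sqr_ge0//.
by have [] := xi2 j0.
Qed.

Variable n_ : nat -> nat.
Hypothesis n_gt0 : forall k, (0 < n_ k)%N.

Lemma sqrt_variance_gt0 k : 0 < s (n_ k).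
Proof.
apply: lt_le_trans (sqrt_variance_ge _); rewrite mulr_gt0// sqrtr_gt0.
exact: lt_le_trans ltr01 (Lambda_ge1 f_f1 _ (n_gt0 k)).
Qed.

Hypothesis lyapunov :
  Lambda f p x (n_ k) / Lambda f 2 x (n_ k) `^ (p / 2) @[k --> \oo] --> (0 : R).

Let W k w := linear_noise f xi x (n_ k) w / s (n_ k).
Let b k j := transfer f x (n_ k) j / s (n_ k).

Let WE k : W k = weighted_sum xi (b k) (n_ k).
Proof.
apply/funext => w; rewrite /W /linear_noise /weighted_sum mulr_suml.
by apply: eq_bigr => j _; rewrite mulrAC.
Qed.

Let b_variance k : weighted_variance xi (b k) (n_ k) = 1.
Proof.
have s0 := sqrt_variance_gt0 k.
rewrite /weighted_variance /b.
under eq_bigr do rewrite exprMn mulrAC.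
rewrite -mulr_suml -/(weighted_variance _ _ _) -variance_linear_noise.
rewrite exprVn sqr_sqrtr ?mulfV//; move: s0; rewrite sqrtr_gt0.
  by move=> ?; rewrite gt_eqF.
exact: ltW.
Qed.

Let b_powR : \sum_(1 <= j < (n_ k).+1) `|b k j| `^ p @[k --> \oo] --> (0 : R).
Proof.
have p0 : 0 < p by exact: lt_trans p_gt2.
have cp : 0 < c `^ p by rewrite powR_gt0.
have h : (c `^ p)^-1 * (Lambda f p x (n_ k) / Lambda f 2 x (n_ k) `^ (p / 2))
    @[k --> \oo] --> (0 : R).
  by rewrite -(mulr0 (c `^ p)^-1); apply: cvgM => //; exact: cvg_cst.
apply: (squeeze_cvgr _ (cvg_cst 0) h); apply: nearW => k.
have s0 := sqrt_variance_gt0 k.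
have L0 : 0 < Lambda f 2 x (n_ k).
  exact: lt_le_trans ltr01 (Lambda_ge1 f_f1 _ (n_gt0 k)).
apply/andP; split; first by apply: sumr_ge0 => j _; exact: powR_ge0.
have -> : \sum_(1 <= j < (n_ k).+1) `|b k j| `^ p = Lambda f p x (n_ k) / s (n_ k) `^ p.
  rewrite mulr_suml; apply: eq_bigr => j _.
  rewrite normrM powRM// normfV (gtr0_norm s0) -(powR_inv1 (ltW s0)) -powRrM.
  by rewrite mulN1r powRN.
rewrite mulrCA ler_wpM2l//; first by apply: sumr_ge0 => j _; exact: powR_ge0.
rewrite -invfM lef_pV2 ?posrE ?powR_gt0 ?mulr_gt0//; last by rewrite powR_gt0.
have -> : Lambda f 2 x (n_ k) `^ (p / 2) = Num.sqrt (Lambda f 2 x (n_ k)) `^ p.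
  by rewrite -powR12_sqrt ?(ltW L0)// -powRrM mulrC.
rewrite mulrC -powRM ?(ltW c_gt0)//; apply: ge0_ler_powR; rewrite ?nnegrE ?(ltW p0)//.
- by rewrite mulr_ge0// ltW.
- by rewrite mulrC sqrt_variance_ge.
Qed.

Lemma normalized_linear_noise k : [/\ measurable_fun setT (W k),
  P.-integrable setT (EFin \o W k),
  P.-integrable setT (EFin \o (fun w => W k w ^+ 2)),
  \int[P]_w W k w = 0 & \int[P]_w (W k w ^+ 2) = 1].
Proof.
have [i1 i2 E1 E2] := moments (b k) (n_ k).
by rewrite WE; split=> //; [exact: measurable_weighted_sum|rewrite E2 b_variance].
Qed.

Lemma linear_noise_clt K g g1 g2 : smooth3 K g g1 g2 ->
  \int[P]_w g (W k w) @[k --> \oo] --> \int[gauss 1]_y g y.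
Proof.
move=> gs.
have xi_powp j (j0 : (0 < j)%N) : P.-integrable setT (EFin \o (fun w => `|xi j w| `^ p)).
  by have [] := xip j0.
have xi_normp j (j0 : (0 < j)%N) : \int[P]_w (`|xi j w| `^ p) <= C `^ p.
  by have [] := xip j0.
have xi_norm2 j (j0 : (0 < j)%N) : second_moment xi j <= C ^+ 2.
  by have [] := xi2 j0.
under eq_fun do rewrite WE.
exact: (lyapunov_clt xi_indep xi_int xi_sqr xi_mean p_gt2 (ltW C_gt0)
  xi_powp xi_normp xi_norm2 b_variance b_powR gs).
Qed.

End linearized_noise.

Section scaling_limit.
Context (R : realType) d (T : measurableType d) (P : probability T R).
Variables (M : phase_space) (a : R) (f : R -> R) (xi : nat -> {RV P >-> R}).
Variables (p x : R) (n_ : nat -> nat) (sigma_ : nat -> R).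
Hypotheses (fA1 : A1 M f) (fA2 : A2 M a f).
Hypothesis xi_indep : mutually_independent [set n | (0 < n)%N] xi.
Hypothesis p_gt2 : 2 < p.
Hypothesis xi_A3 : A3 xi p.
Hypothesis x_in_M : carrier M x.
Hypothesis n_gt0 : forall k, (0 < n_ k)%N.
Hypothesis lyapunov :
  Lambda f p x (n_ k) / Lambda f 2 x (n_ k) `^ (p / 2) @[k --> \oo] --> (0 : R).
Hypothesis sigma_gt0 : forall k, 0 < sigma_ k.
Hypothesis C0_norm_lty : (C0_norm M (derive1 (derive1 f)) < +oo)%E.

Let F := fine (C0_norm M (derive1 (derive1 f))).
Let q k := Lambda_hat f x (n_ k) ^+ 3 * sigma_ k / Num.sqrt (Lambda f 2 x (n_ k)).

Let F_ge0 : 0 <= F. Proof. by rewrite fine_ge0// C0_norm_ge0. Qed.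

(** The deterministic linearization applies on [E k], where the noise is at most
    [tau k]: the error relative to the standard deviation
    [sigma_ k * s k >= c * sigma_ k * Num.sqrt (Lambda f 2 x (n_ k))] is a multiple
    of [F * q k * tau k ^+ 2].  The same quantity controls the smallness condition
    of the linearization and, on the interval, forces [E k] into the good event,
    because [q k >= sigma_ k * Lambda_hat f x (n_ k) ^+ 2 >= sigma_ k]. *)
Lemma scaling_limit_of_bounded_noise (B E : nat -> set T) (tau : nat -> R) (tau0 : R) :
  (forall k, measurable (B k)) -> (forall k, measurable (E k)) ->
  (forall k, E k `<=` B k) -> (forall k, P (B k `\` E k) = 0%E) ->
  pr P (E k) @[k --> \oo] --> (1 : R) ->
  (forall k w, E k w -> max_noise xi (n_ k) w <= tau k) ->
  0 < tau0 -> (\forall k \near \oo, tau0 <= tau k) ->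
  F * q k * tau k ^+ 2 @[k --> \oo] --> (0 : R) ->
  gaussian_scaling_limit M a f xi x n_ sigma_ B.
Proof.
move=> mB mE EB BE0 PE1 Etau t0 ttau Fq0.
have [c [C [c0 C0 xi2 xip]]] := A3_moments p_gt2 xi_A3.
have p0 : 0 <= p by apply: ltW; exact: lt_trans p_gt2.
have [f1 [kappa [kappa0 df quad FI]]] :=
  quadratic_control fA1 fA2 x_in_M p0 n_gt0 lyapunov C0_norm_lty.
have f_f1 m : is_derive (iter m f x) (1 : R) f (f1 (iter m f x)).
  by apply: df; exact: iter_carrier.
set s := fun k => Num.sqrt (fine 'V_P[linear_noise f xi x (n_ k)]).
have s0 k : 0 < s k by exact: (sqrt_variance_gt0 xi_indep c0 xi2 f_f1 n_gt0).
have sc k : c * Num.sqrt (Lambda f 2 x (n_ k)) <= s k.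
  exact: (sqrt_variance_ge xi_indep c0 xi2).
have H1 k : 1 <= Lambda_hat f x (n_ k) by exact: (Lambda_hat_ge1 f_f1).
have LH k : Num.sqrt (Lambda f 2 x (n_ k)) <= Lambda_hat f x (n_ k).
  exact: (sqrt_Lambda2_le f_f1).
have L0 k : 0 < Num.sqrt (Lambda f 2 x (n_ k)).
  by rewrite sqrtr_gt0; exact: lt_le_trans ltr01 (Lambda_ge1 f_f1 _ (n_gt0 k)).
have H0 k : 0 < Lambda_hat f x (n_ k) by exact: lt_le_trans (H1 k).
have qH k : sigma_ k * Lambda_hat f x (n_ k) ^+ 2 <= q k.
  rewrite /q ler_pdivlMr//; set H := Lambda_hat f x (n_ k).
  rewrite (_ : H ^+ 3 * sigma_ k = sigma_ k * H ^+ 2 * H); last by ring.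
  by rewrite ler_wpM2l// mulr_ge0 ?exprn_ge0 ?(ltW (sigma_gt0 k)) ?(ltW (H0 k)).
have near_le (e : R) : 0 < e -> \forall k \near \oo, F * q k * tau k ^+ 2 <= e.
  by move=> e0; apply: (cvgr_le _ Fq0).
have qtau k : tau0 <= tau k -> q k * tau k <= q k * tau k ^+ 2 / tau0.
  move=> h; rewrite ler_pdivlMr// -mulrA ler_wpM2l//.
    by apply: le_trans (qH k); rewrite mulr_ge0 ?exprn_ge0 ?ltW.
  by rewrite expr2 ler_wpM2l// (le_trans (ltW t0)).
have EG : \forall k \near \oo, E k `<=` good_event M a xi (sigma_ k) (n_ k).
  have [MI|MI] := pselect (M = Defs.Interval); last first.
    by apply: nearW => k w _; case: (M) MI.
  have a0 : 0 < a by have [] := fA2 MI.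
  have F0 : 0 < F := FI MI.
  have e0 : 0 < F * tau0 * a by rewrite !mulr_gt0.
  near=> k.
  have h1 : tau0 <= tau k by near: k.
  have h2 : F * q k * tau k ^+ 2 <= F * tau0 * a by near: k; exact: near_le.
  move=> w /Etau wt; rewrite MI /=.
  apply: (@le_trans _ _ (sigma_ k * tau k)); first by rewrite ler_wpM2l// ltW.
  apply: (@le_trans _ _ (q k * tau k)).
    rewrite ler_wpM2r ?(le_trans (ltW t0))//; apply: le_trans (qH k).
    by rewrite ler_peMr ?exprn_ege1// ltW.
  apply: le_trans (qtau k h1) _; rewrite ler_pdivrMr// -(ler_pM2l F0) mulrA (le_trans h2)//.
  by rewrite -mulrA (mulrC a).
pose mG k := measurable_good_event M a xi (sigma_ k) (n_ k).
have PG1 : pr P (good_event M a xi (sigma_ k) (n_ k)) @[k --> \oo] --> (1 : R).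
  apply: (squeeze_cvgr _ PE1 (cvg_cst (1 : R))); apply: filterS EG => k EGk.
  by rewrite le_pr//= pr_le1.
have PB1 : pr P (B k) @[k --> \oo] --> (1 : R).
  apply: (squeeze_cvgr _ PE1 (cvg_cst (1 : R))); apply: nearW => k.
  by rewrite le_pr//= pr_le1.
pose dl k := 4 * kappa / c * (F * q k * tau k ^+ 2).
have dl0 : dl @ \oo --> (0 : R).
  by rewrite -(mulr0 (4 * kappa / c)); apply: cvgM => //; exact: cvg_cst.
pose Y k := normalized_deviation M a f xi x (sigma_ k) (n_ k).
pose W k w := linear_noise f xi x (n_ k) w / s k.
have mY k : measurable_fun setT (Y k).
  by apply: measurable_funM => //; exact: measurable_deviation.
have YG k w : ~ good_event M a xi (sigma_ k) (n_ k) w -> Y k w = 0.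
  move=> nG; rewrite /Y /normalized_deviation /deviation indicE memNset//.
  by rewrite mulr0 mul0r.
have YW : \forall k \near \oo, forall w, E k w -> `|Y k w - W k w| <= dl k.
  have e0 : 0 < tau0 / (4 * kappa) by rewrite divr_gt0// mulr_gt0.
  near=> k.
  have h1 : tau0 <= tau k by near: k.
  have h2 : F * q k * tau k ^+ 2 <= tau0 / (4 * kappa) by near: k; exact: near_le.
  have EGk : E k `<=` good_event M a xi (sigma_ k) (n_ k) by near: k.
  have tau_ge0 : 0 <= tau k by apply: le_trans h1; exact: ltW.
  have K0 : 0 <= kappa * F by rewrite mulr_ge0// ltW.
  have small : 4 * (kappa * F) * (sigma_ k * tau k) * Lambda_hat f x (n_ k) ^+ 2 <= 1.
    apply: (@le_trans _ _ (4 * kappa * F * (q k * tau k))).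
      rewrite (_ : 4 * (kappa * F) * (sigma_ k * tau k) * Lambda_hat f x (n_ k) ^+ 2 =
        4 * kappa * F * (sigma_ k * Lambda_hat f x (n_ k) ^+ 2 * tau k)); last by ring.
      by rewrite ler_wpM2l ?ler_wpM2r// mulr_ge0// mulr_ge0// ltW.
    apply: (@le_trans _ _ (4 * kappa * F * (q k * tau k ^+ 2 / tau0))).
      by rewrite ler_wpM2l ?qtau// mulr_ge0// mulr_ge0// ltW.
    rewrite (_ : 4 * kappa * F * (q k * tau k ^+ 2 / tau0) =
      4 * kappa / tau0 * (F * q k * tau k ^+ 2)); last by field; rewrite gt_eqF.
    apply: (@le_trans _ _ (4 * kappa / tau0 * (tau0 / (4 * kappa)))).
      by rewrite ler_wpM2l// divr_ge0 ?mulr_ge0// ltW.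
    by rewrite le_eqVlt; apply/orP; left; apply/eqP; field; rewrite !gt_eqF.
  move=> w Ew.
  have := deviation_linearization fA1 fA2 x_in_M (sigma_gt0 k) K0 tau_ge0 df quad
    small (EGk w Ew) (Etau k w Ew).
  set D := deviation _ _ _ _ _ _ _ _; set L := linear_noise _ _ _ _ _ => DL.
  have -> : Y k w - W k w = (D - sigma_ k * L) / (sigma_ k * s k).
    rewrite /Y /W /normalized_deviation -/D -/L -/(s k).
    by field; rewrite !gt_eqF.
  have ss0 : 0 < sigma_ k * s k by rewrite mulr_gt0.
  rewrite normrM normfV (gtr0_norm ss0) ler_pdivrMr//.
  apply: le_trans DL _; rewrite /dl /q.
  set H := Lambda_hat f x (n_ k); set S := Num.sqrt (Lambda f 2 x (n_ k)).
  have S0 : 0 < S := L0 k.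
  rewrite (_ : 4 * kappa / c * _ * _ = 4 * (kappa * F) * (sigma_ k * tau k) ^+ 2 * H ^+ 3 *
    (s k / (c * S))); last by field; rewrite !gt_eqF.
  rewrite ler_peMr//.
    by rewrite !mulr_ge0 ?exprn_ge0// ?mulr_ge0// ltW// H0.
  by rewrite ler_pdivlMr ?mulr_gt0// mul1r sc.
have nl k := normalized_linear_noise xi_indep c0 xi2 f_f1 n_gt0 k.
have mW k : measurable_fun setT (W k) by have [] := nl k.
have clt := linear_noise_clt xi_indep p_gt2 c0 C0 xi2 xip f_f1 n_gt0 lyapunov.
split.
- apply: cvg_EFin; first by apply: nearW => k; exact: fin_num_measure.
  exact: PB1.
- exact: (cvg_normalized mW clt mG mE PE1 PG1 mY dl0 YW).
have iW k : P.-integrable setT (EFin \o W k) by have [] := nl k.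
have iW2 k : P.-integrable setT (EFin \o (fun w => W k w ^+ 2)) by have [] := nl k.
have W1 k : \int[P]_w W k w = 0 by have [] := nl k.
have W2 k : \int[P]_w (W k w ^+ 2) = 1 by have [] := nl k.
pose e k := sigma_ k * s k.
have e0 k : 0 < e k by rewrite mulr_gt0.
pose Z k w := e k * Y k w * \1_(B k) w.
have h : cvg_in_distribution (fun k => cond_good M a xi (sigma_ k) (n_ k))
  (fun k w => Z k w / Num.sqrt (fine 'V_(cond_good M a xi (sigma_ k) (n_ k))[Z k]))
  (normal_prob 0 1).
  exact: (cvg_self_normalized mW iW iW2 W1 W2 clt mG mE mB EB BE0 PE1 PG1 mY YG dl0 YW e0).
rewrite (_ : Z = fun k => truncated_deviation M a f xi x (sigma_ k) (n_ k) (B k)) in h.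
  exact: h.
apply/funext => k; apply/funext => w; rewrite /Z /truncated_deviation; congr (_ * _).
by rewrite /Y /normalized_deviation mulrC divfK// gt_eqF// e0.
Unshelve. all: by end_near. Qed.

End scaling_limit.

(** * Choice of the truncation level *)

Section truncation_levels.
Context (R : realType) d (T : measurableType d) (P : probability T R).
Variables (M : phase_space) (a : R) (f : R -> R) (xi : nat -> {RV P >-> R}).
Variables (p x : R) (n_ : nat -> nat) (sigma_ : nat -> R).
Hypotheses (fA1 : A1 M f) (fA2 : A2 M a f).
Hypothesis xi_indep : mutually_independent [set n | (0 < n)%N] xi.
Hypothesis p_gt2 : 2 < p.
Hypothesis xi_A3 : A3 xi p.
Hypothesis x_in_M : carrier M x.
Hypothesis n_gt0 : forall k, (0 < n_ k)%N.
Hypothesis lyapunov :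
  Lambda f p x (n_ k) / Lambda f 2 x (n_ k) `^ (p / 2) @[k --> \oo] --> (0 : R).
Hypothesis sigma_gt0 : forall k, 0 < sigma_ k.
Variable e : nat.
Hypothesis e_ge3 : (3 <= e)%N.
Hypothesis ratio0 :
  nonlinearity_ratio M f xi p x (n_ k) e (sigma_ k) @[k --> \oo] --> 0%E.

Let F := fine (C0_norm M (derive1 (derive1 f))).
Let q k := Lambda_hat f x (n_ k) ^+ 3 * sigma_ k / Num.sqrt (Lambda f 2 x (n_ k)).
Let N k := fine 'N[P]_p%:E[EFin \o max_noise xi (n_ k)]%E.

Let p_gt0 : 0 < p. Proof. exact: lt_trans p_gt2. Qed.

Let f_f1 : exists f1 : R -> R, forall m, is_derive (iter m f x) (1 : R) f (f1 (iter m f x)).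
Proof.
have [f1 [f2 [_ _ _ df _]]] := C2_noise_domain fA1 fA2.
exists f1 => m; apply: df; apply: (carrier_sub_interior fA2).
exact: iter_carrier.
Qed.

Let H_ge1 k : 1 <= Lambda_hat f x (n_ k).
Proof. by have [f1 df] := f_f1; exact: (Lambda_hat_ge1 df). Qed.

Let L_gt0 k : 0 < Num.sqrt (Lambda f 2 x (n_ k)).
Proof.
have [f1 df] := f_f1.
by rewrite sqrtr_gt0; exact: lt_le_trans ltr01 (Lambda_ge1 df _ (n_gt0 k)).
Qed.

Let max_norm : exists2 c : R, 0 < c & forall k, [/\
  'N[P]_p%:E[EFin \o max_noise xi (n_ k)]%E = (N k)%:E,
  P.-integrable setT (EFin \o (fun w => `|max_noise xi (n_ k) w| `^ p)),
  \int[P]_w (`|max_noise xi (n_ k) w| `^ p) = N k `^ p & c <= N k].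
Proof.
have [c [C [c0 C0 _ xip]]] := A3_moments p_gt2 xi_A3; exists c => // k.
apply: max_noise_Lnorm => //; first by move=> j /xip[].
by have [] := xip _ (n_gt0 k).
Qed.

Let r k := Lambda_hat f x (n_ k) ^+ e * sigma_ k / Num.sqrt (Lambda f 2 x (n_ k)).

Let r_gt0 k : 0 < r k.
Proof.
by rewrite divr_gt0 ?mulr_gt0 ?exprn_gt0// (lt_le_trans ltr01).
Qed.

Let C0_norm_lty : (C0_norm M (derive1 (derive1 f)) < +oo)%E.
Proof.
rewrite ltNge leye_eq; apply/negP => /eqP Coo.
have [c c0 hN] := max_norm.
have /fine_cvgP[fin _] := ratio0.
have [k] := filter_ex fin.
have [NE _ _ cN] := hN k; have N0 : 0 < N k by exact: lt_le_trans cN.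
rewrite /nonlinearity_ratio Coo NE -EFin_expe -/(r k).
by rewrite gt0_mulye ?lte_fin ?exprn_gt0// gt0_mulye ?lte_fin.
Qed.

Let ratioE k : nonlinearity_ratio M f xi p x (n_ k) e (sigma_ k) =
  (F * N k ^+ 2 * r k)%:E.
Proof.
have [c c0 hN] := max_norm; have [NE _ _ cN] := hN k.
have CE : C0_norm M (derive1 (derive1 f)) = F%:E.
  by rewrite fineK// ge0_fin_numE// C0_norm_ge0.
by rewrite /nonlinearity_ratio NE CE.
Qed.

Let F_ge0 : 0 <= F. Proof. by rewrite fine_ge0// C0_norm_ge0. Qed.

(* the exponents [e >= 3] all reduce to [3] because [Lambda_hat] is at least [1] *)
Let rho0 : F * q k * N k ^+ 2 @[k --> \oo] --> (0 : R).
Proof.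
have /fine_cvgP[_ h] := ratio0.
apply: (squeeze_cvgr _ (cvg_cst (0 : R)) h); apply: nearW => k /=.
rewrite ratioE/= -/(q k).
have q0 : 0 < q k.
  by rewrite divr_gt0 ?mulr_gt0 ?exprn_gt0// (lt_le_trans ltr01).
apply/andP; split; first exact: mulr_ge0 (mulr_ge0 F_ge0 (ltW q0)) (sqr_ge0 _).
rewrite mulrAC; apply: ler_wpM2l; first exact: mulr_ge0 F_ge0 (sqr_ge0 _).
apply: ler_wpM2r; first by rewrite invr_ge0 ltW.
by apply: ler_wpM2r; [exact: ltW|exact: ler_weXn2l].
Qed.

(** The level is [N k / theta k] with [theta] tending to zero so slowly that the
    error, of order [F * q k * N k ^+ 2 / theta k ^+ 2], still tends to zero, while
    Markov's inequality bounds the probability of exceeding the level by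
    [theta k]. *)
Lemma scaling_limit_Lp : exists2 B : nat -> set T, (forall k, measurable (B k)) &
  gaussian_scaling_limit M a f xi x n_ sigma_ B.
Proof.
have [c c0 hN] := max_norm.
(* the term [k.+1%:R^-1] keeps [theta] positive when the ratio vanishes *)
pose delta k := F * q k * N k ^+ 2 + k.+1%:R^-1.
have q_gt0 k : 0 < q k.
  by rewrite divr_gt0 ?mulr_gt0 ?exprn_gt0// (lt_le_trans ltr01).
have rho_ge0 k : 0 <= F * q k * N k ^+ 2.
  exact: mulr_ge0 (mulr_ge0 F_ge0 (ltW (q_gt0 k))) (sqr_ge0 _).
have delta_gt0 k : 0 < delta k by rewrite ltr_wpDl.
have delta0 : delta @ \oo --> (0 : R).
  by rewrite -(addr0 (0 : R)); apply: cvgD => //; exact: cvg_harmonic.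
have sqrt0 (u : nat -> R) : u @ \oo --> (0 : R) ->
    (fun k => Num.sqrt (u k)) @ \oo --> (0 : R).
  move=> u0; rewrite -(sqrtr0 R); apply: continuous_cvg => //.
  exact: sqrt_continuous.
pose theta k := Num.sqrt (Num.sqrt (delta k)).
have theta0 : theta @ \oo --> (0 : R) by exact: (sqrt0 _ (sqrt0 _ delta0)).
have theta_gt0 k : 0 < theta k by rewrite !sqrtr_gt0.
have theta2 k : theta k ^+ 2 = Num.sqrt (delta k) by rewrite sqr_sqrtr ?sqrtr_ge0.
have theta_le1 : \forall k \near \oo, theta k <= 1.
  by apply: (cvgr_le _ theta0); exact: ltr01.
pose tau k := N k / theta k.
have N_gt0 k : 0 < N k by have [_ _ _] := hN k; exact: lt_le_trans.
have tau_gt0 k : 0 < tau k by rewrite divr_gt0.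
pose E k := [set w | max_noise xi (n_ k) w <= tau k].
have mE k : measurable (E k) by apply: measurable_le_cst; exact: measurable_max_noise.
have PE1 : pr P (E k) @[k --> \oo] --> (1 : R).
  have h : 1 - theta k @[k --> \oo] --> (1 : R).
    by rewrite -[X in _ --> X](subr0 1); apply: cvgB => //; exact: cvg_cst.
  apply: (squeeze_cvgr _ h (cvg_cst (1 : R))); apply: filterS theta_le1 => k th1.
  rewrite pr_le1// andbT lerBlDr addrC -lerBlDr -prC//.
  have [_ iM EM _] := hN k.
  have -> : ~` E k = [set w | tau k < `|max_noise xi (n_ k) w|].
    by apply/seteqP; split => w /=; rewrite ger0_norm ?max_noise_ge0// ltNge => /negP.
  apply: (markov_powR _ _ (tau_gt0 k) _ iM) => //.
  - exact: measurable_max_noise.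
  - by rewrite (le_trans _ (ltW p_gt2))// ler1n.
  - by rewrite theta_gt0.
  - by rewrite EM divfK// gt_eqF.
exists E => //.
apply: (@scaling_limit_of_bounded_noise _ _ _ _ M a f xi p x n_ sigma_ fA1 fA2
  xi_indep p_gt2 xi_A3 x_in_M n_gt0 lyapunov sigma_gt0 C0_norm_lty E E tau c) => //.
- by move=> k w.
- by move=> k; rewrite setDv measure0.
- apply: filterS theta_le1 => k th1; have [_ _ _ cN] := hN k.
  by rewrite ler_pdivlMr// (le_trans _ cN)// ler_piMr// ltW.
have s0 := sqrt0 _ delta0.
apply: (squeeze_cvgr _ (cvg_cst (0 : R)) s0); apply: nearW => k.
rewrite -/(q k) /tau expr_div_n theta2 mulrA.
have sd : 0 < Num.sqrt (delta k) by rewrite sqrtr_gt0.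
apply/andP; split; first by rewrite divr_ge0 ?(ltW sd).
rewrite ler_pdivrMr// -expr2 sqr_sqrtr ?(ltW (delta_gt0 k))//.
by rewrite /delta lerDl.
Qed.

(** The noise is almost surely bounded by a constant, which serves as the
    truncation level. *)
Lemma scaling_limit_compact : compactly_supported xi ->
  gaussian_scaling_limit M a f xi x n_ sigma_ (fun=> setT).
Proof.
move=> [K cK xiK]; have [c c0 hN] := max_norm.
have [b b0 Kb] : exists2 b : R, 0 < b & forall y, K y -> `|y| <= b.
  have [B [_ hB]] := compact_bounded cK.
  exists (`|B| + 1); first by rewrite ltr_wpDl.
  move=> y Ky; apply: (hB (`|B| + 1)) => //.
  by rewrite (le_lt_trans (ler_norm _))// ltrDl.
have mxi j : measurable (xi j @^-1` K).
  rewrite -[X in measurable X]setTI; apply: measurable_funPT => //.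
  by apply: closed_measurable; apply: compact_closed => //; exact: Rhausdorff.
pose E k := [set w | max_noise xi (n_ k) w <= b].
have mE k : measurable (E k) by apply: measurable_le_cst; exact: measurable_max_noise.
have PE k : P (setT `\` E k) = 0%E.
  rewrite setTD; apply/negligibleP; first exact: measurableC.
  have ae j : {ae P, forall w, (0 < j)%N -> `|xi j w| <= b}.
    case: j => [|j]; first by apply: nearW.
    exists (~` (xi j.+1 @^-1` K)); split; first exact: measurableC.
      by rewrite probability_setC// xiK// subee.
    by move=> w /= h /Kb hb; apply: h.
  apply: negligibleS (ae_foralln ae).
  move=> w /= h hw; apply: h; apply: max_noise_le (ltW b0) _ => j /andP[j0 _].
  exact: hw.
have PE1 k : pr P (E k) = 1.
  have := prC P (mE k); rewrite /pr -setTD PE/= => h; apply/eqP.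
  by rewrite eq_sym -subr_eq0 -h.
apply: (@scaling_limit_of_bounded_noise _ _ _ _ M a f xi p x n_ sigma_ fA1 fA2
  xi_indep p_gt2 xi_A3 x_in_M n_gt0 lyapunov sigma_gt0 C0_norm_lty _ E (fun=> b) b) => //.
- by apply: cvg_near_cst; apply: nearW => k; rewrite PE1.
- by apply: nearW.
have h : (b / c) ^+ 2 * (F * q k * N k ^+ 2) @[k --> \oo] --> (0 : R).
  by rewrite -(mulr0 ((b / c) ^+ 2)); apply: cvgM => //; exact: cvg_cst.
apply: (squeeze_cvgr _ (cvg_cst (0 : R)) h); apply: nearW => k; rewrite -/(q k).
have q0 : 0 < q k.
  by rewrite divr_gt0 ?mulr_gt0 ?exprn_gt0// (lt_le_trans ltr01).
have Fq : 0 <= F * q k by rewrite mulr_ge0// ltW.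
apply/andP; split; first by rewrite mulr_ge0// sqr_ge0.
have [_ _ _ cN] := hN k; have N0 : 0 <= N k by apply: le_trans cN; exact: ltW.
rewrite -/F [leRHS]mulrCA; apply: ler_wpM2l => //.
rewrite -exprMn ler_sqr ?nnegrE ?(ltW b0)//; last first.
  by rewrite mulr_ge0// divr_ge0// ltW.
by rewrite mulrAC ler_pdivlMr// ler_wpM2l// ltW.
Qed.

End truncation_levels.

Theorem theorem2p1 (R : realType) (d : measure_display) (T : measurableType d)
    (P : probability T R) (M : phase_space) (a : R) (f : R -> R)
    (xi : nat -> {RV P >-> R}) (p : R) (x : R)
    (n_ : nat -> nat) (sigma_ : nat -> R)
    (f_A1 : A1 M f) (f_A2 : A2 M a f)
    (xi_indep : mutually_independent [set n | (0 < n)%N] xi)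
    (p_gt2 : 2 < p) (xi_A3 : A3 xi p)
    (x_in_M : carrier M x)
    (n_gt0 : forall k, (0 < n_ k)%N)
    (n_incr : forall k l, (k < l)%N -> (n_ k < n_ l)%N)
    (Lyapunov : Lambda f p x (n_ k) / Lambda f 2 x (n_ k) `^ (p / 2)
       @[k --> \oo] --> (0 : R))
    (sigma_gt0 : forall k, 0 < sigma_ k)
    (H1_or_H2 :
      (nonlinearity_ratio M f xi p x (n_ k) 6 (sigma_ k) @[k --> \oo] --> 0%E)
      \/ (4 <= p /\
          nonlinearity_ratio M f xi p x (n_ k) 3 (sigma_ k)
            @[k --> \oo] --> 0%E)) :
  (exists2 B : nat -> set T, (forall k, measurable (B k)) &
     gaussian_scaling_limit M a f xi x n_ sigma_ B) /\
  (compactly_supported xi ->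
     gaussian_scaling_limit M a f xi x n_ sigma_ (fun=> setT)).
Proof.
have [e e3 ratio0] : exists2 e, (3 <= e)%N &
    nonlinearity_ratio M f xi p x (n_ k) e (sigma_ k) @[k --> \oo] --> 0%E.
  by case: H1_or_H2 => [|[_]] h; [exists 6%N | exists 3%N].
split.
  exact: (scaling_limit_Lp f_A1 f_A2 xi_indep p_gt2 xi_A3 x_in_M n_gt0 Lyapunov
    sigma_gt0 e3 ratio0).
exact: (scaling_limit_compact f_A1 f_A2 xi_indep p_gt2 xi_A3 x_in_M n_gt0
  Lyapunov sigma_gt0 e3 ratio0).
Qed.
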